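(* Let $(X_n,Z_n)_{n\in\mathbb Z}$ be the stationary ergodic state/observation process on $I\times I$ with transition density $p$ and observation density $g$ described in the context. Suppose there are a constant $c>0$ and a set $I'\subset I$ with $\mu_Z(I')>0$ such that for almost every $z\in I'$ there is a nontrivial interval $F_z\subset I$ satisfying: 1) for a.e. $x\in J_z$, $p(x,y)>c$ for every $y\in F_z$; 2) there is a nontrivial interval $F'_z\subset F_z$ such that for every $z'\in F'_z$ one has $J_{z'}\subset F_z$ and $g(z',y)>c$ for every $y\in J_{z'}$; 3) $p<c^{-1}$ and $g<c^{-1}$. Then there is a unique absolutely continuous equivariant probability measure for the filtering cocycle $\mathcal P$, i.e. there is, uniquely up to $\boldsymbol\mu$-null sets, a family $(\hat\mu_{(\boldsymbol x,\boldsymbol z)})$ defined for $\boldsymbol\mu$-a.e. $(\boldsymbol x,\boldsymbol z)\in (I\times I)^{\mathbb Z}$ of probability measures, absolutely continuous with respect to Lebesgue measure with density in $\mathcal V_0(J_{z_0})$, such that $$\mathcal P_{(\boldsymbol x,\boldsymbol z)}\hat\mu_{(\boldsymbol x,\boldsymbol z)}=\hat\mu_{\sigma(\boldsymbol x,\boldsymbol z)}\quad\text{for }\boldsymbol\mu\text{-a.e. }(\boldsymbol x,\boldsymbol z).$$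
   Context: $I\subset\mathbb R$ is a compact interval. $(X_n)$ is a Markov chain on $I$ whose transition probability $P(x,\cdot)$ is absolutely continuous with density $p(x,y)=\frac{dP(x,\cdot)}{d\mathrm{Leb}}(y)$, and which has an absolutely continuous stationary probability measure $\mu$; $X_0$ has law $\mu$. The observations are $Z_n=X_n+s(X_n)\epsilon_n\in I$, where $s$ is a strictly positive Lipschitz function on $I$ and $(\epsilon_n)$ are i.i.d. real random variables, independent of the chain, whose law has a density $\psi'$ supported in an interval $[-\epsilon,\epsilon]$. The observation density (likelihood), i.e. the conditional density of $Z_n$ at $y$ given $X_n=x$, is $$g(y,x)=\frac1{s(x)}\psi'\Big(\frac{y-x}{s(x)}\Big)\mathbf 1_{[x-s(x)\epsilon,\;x+s(x)\epsilon]}(y).$$ For $z\in I$, $J_z\subset I$ denotes the support of $x\mapsto g(z,x)$. $\mu_Z$ denotes the law of $Z_n$ under the stationary process. The stationary process $(X_n,Z_n)$ is extended to a two-sided process $(X_n,Z_n)_{n\in\mathbb Z}$ with the same transition probabilities, and $\boldsymbol\mu$ denotes its law on $(I\times I)^{\mathbb Z}$; elements are written $(\boldsymbol x,\boldsymbol z)=((x_n)_{n},(z_n)_{n})$. In this paragraph and in the claim, $\sigma$ denotes the left shift on $(I\times I)^{\mathbb Z}$; $\boldsymbol\mu$ is $\sigma$-invariant and ergodic (standing fact of the setting). For a finite Borel measure $\nu$ on $I$ and $z\in I$ (with positive denominator below), define for bounded measurable $\phi$ $$(\mathcal P_z\nu)(\phi)=\frac{\int_I\phi(x)g(z,x)\,d\nu^+(x)}{\int_I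 g(z,x)\,d\nu^+(x)},\qquad \nu^+(\phi)=\int\Big(\int\phi(y)\,p(x,y)\,dy\Big)d\nu(x).$$ The filtering cocycle over $\sigma$ is $\mathcal P((\boldsymbol x,\boldsymbol z),\nu)=(\sigma(\boldsymbol x,\boldsymbol z),\mathcal P_{(\boldsymbol x,\boldsymbol z)}\nu)$, where $\mathcal P_{(\boldsymbol x,\boldsymbol z)}:=\mathcal P_{z_1}$ (the update from time $0$ to time $1$ using the observation $z_1$). For $J\subset I$, $\mathcal V_0(J)$ is the cone of (not identically zero) integrable nonnegative functions on $J$. The cone on the fibre over $(\boldsymbol x,\boldsymbol z)$ is $\mathcal V_0(J_{z_0})$; functions on $J_{z_0}$ are extended by $0$ to $I$. *)

(* Defs.v *)
From HB Require Import structures.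
From mathcomp Require Import all_boot all_order all_algebra.
From mathcomp Require Import all_classical all_reals all_analysis.
Import Order.TTheory GRing.Theory Num.Theory.
Import numFieldNormedType.Exports.

Set Implicit Arguments.
Unset Strict Implicit.
Unset Printing Implicit Defensive.

Local Open Scope classical_set_scope.
Local Open Scope ring_scope.

(** The state space is a subset [I] of [R]; functions on [I] are total functions
    on [R] that are only constrained, and only integrated, on [I]. *)

Definition has_density (R : realType) (m : set R -> \bar R) (f : R -> R) : Prop :=
  [/\ measurable_fun setT f, (forall x, 0 <= f x) &
      forall A, measurable A ->
        m A = (\int[lebesgue_measure]_(x in A) (f x)%:E)%E].

Definition nontrivial_interval (R : realType) (F : set R) : Prop :=
  is_interval F /\ exists u v, [/\ F u, F v & u < v].

Definition transition (R : realType) (I : set R) (p : R -> R -> R)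
    (x : R) (A : set R) : \bar R :=
  (\int[lebesgue_measure]_(y in I `&` A) (p x y)%:E)%E.

Definition transition_density (R : realType) (I : set R) (p : R -> R -> R)
    : Prop :=
  [/\ measurable_fun (I `*` I) (fun q : R * R => p q.1 q.2),
      (forall x y, I x -> I y -> 0 <= p x y) &
      forall x, I x -> transition I p x setT = 1%E].

Definition stationary_measure (R : realType) (I : set R) (p : R -> R -> R)
    (mu : probability (measurableTypeR R) R) : Prop :=
  mu I = 1%E /\
  forall A, measurable A -> mu A = (\int[mu]_(x in I) transition I p x A)%E.

Definition sigma_of (R : realType) (T : Type) (Y : int -> T -> R) (D : set int)
    : set (set T) :=
  <<s \bigcup_(n in D) preimage_set_system setT (Y n) measurable >>.

(** The second clause is the Markov property with respect to the whole past
    [X k], [k <= n], with transition probability [transition I p]. *)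
Definition markov_chain (R : realType) (d : measure_display)
    (T : measurableType d) (P : probability T R) (I : set R) (p : R -> R -> R)
    (X : int -> T -> R) : Prop :=
  (forall n w, I (X n w)) /\
  forall (n : int) (E : set T) (A : set R),
    sigma_of X [set k | k <= n] E -> measurable A ->
    P (E `&` X (n + 1) @^-1` A) =
      (\int[P]_(w in E) transition I p (X n w) A)%E.

Definition mutually_independent (R : realType) (d : measure_display)
    (T : measurableType d) (P : probability T R) (Y : int -> T -> R) : Prop :=
  forall (s : seq int) (A : int -> set R), uniq s ->
    (forall n, measurable (A n)) ->
    P (\bigcap_(n in [set` s]) (Y n @^-1` A n)) =
      (\prod_(n <- s) P (Y n @^-1` A n))%E.

Definition independent_processes (R : realType) (d : measure_display)
    (T : measurableType d) (P : probability T R) (X Y : int -> T -> R) : Prop :=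
  forall A B, sigma_of X setT A -> sigma_of Y setT B ->
    P (A `&` B) = (P A * P B)%E.

(** Two-sided paths take values in [R * R], with the product sigma-algebra; the
    laws considered are carried by the paths with values in [I * I]. *)

Definition coordinate_sets (R : realType) : set (set (int -> R * R)) :=
  \bigcup_(n in [set: int])
    preimage_set_system setT (fun w : int -> R * R => w n) measurable.

Definition path_space (R : realType) := g_sigma_algebraType (@coordinate_sets R).

Definition shift (R : realType) (w : path_space R) : path_space R :=
  fun n => w (n + 1).

Definition joint_path (R : realType) (d : measure_display)
    (T : measurableType d) (X Z : int -> {mfun T >-> R})
    : T -> path_space R :=
  fun w n => (X n w, Z n w).

Section joint_path_measurable.
Context (R : realType) (d : measure_display) (T : measurableType d).
Context (X Z : int -> {mfun T >-> R}).

Lemma measurable_joint_path : measurable_fun setT (joint_path X Z).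
Proof.
apply: (@measurability _ _ _ (path_space R) _ _ (@coordinate_sets R)) => //.
move=> _ [_ [n _ [A mA <-]] <-]; rewrite !setTI -comp_preimage -[Y in measurable Y]setTI.
have -> : (fun w : int -> R * R => w n) \o joint_path X Z
        = (fun w => (X n w, Z n w)) by [].
have mXZ : measurable_fun setT (fun w => (X n w, Z n w)).
  apply: measurable_fun_pair.
  - exact: (@measurable_funPT _ _ _ _ (X n)).
  - exact: (@measurable_funPT _ _ _ _ (Z n)).
exact: mXZ.
Qed.

HB.instance Definition _ :=
  isMeasurableFun.Build _ _ _ _ (joint_path X Z) measurable_joint_path.
End joint_path_measurable.

Definition invariant_ergodic (R : realType)
    (m : probability (path_space R) R) : Prop :=
  (forall A, measurable A -> m (@shift R @^-1` A) = m A) /\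
  (forall A, measurable A -> @shift R @^-1` A = A -> m A = 0%E \/ m A = 1%E).

(** [obs_density s psi eps y x] is the density of the observation at [y] given
    the state [x]. *)
Definition obs_density (R : realType) (s psi : R -> R) (eps y x : R) : R :=
  (s x)^-1 * psi ((y - x) / s x) * \1_(`[x - s x * eps, x + s x * eps]) y.

(** Topological (closed) support of [g z] as a function on the closed set [I]. *)
Definition obs_support (R : realType) (I : set R) (g : R -> R -> R) (z : R)
    : set R :=
  closure [set x | I x /\ g z x != 0].

(** Elements of the cone are extended by zero outside [J]; as they are
    integrable functions, "not identically zero" is up to null sets. *)
Definition cone0 (R : realType) (J : set R) : set (R -> R) :=
  [set f | [/\ (forall x, 0 <= f x), (forall x, ~ J x -> f x = 0),
      (@lebesgue_measure R).-integrable setT (EFin \o f) &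
      ~ (f = cst 0 %[ae @lebesgue_measure R])]].

(** The measure [nu^+], as a functional. The integrals are real-valued, with
    default value 0 when infinite: this is meaningful for a finite measure [nu]
    and a bounded [phi]. *)
Definition predict (R : realType) (I : set R) (p : R -> R -> R)
    (nu : {measure set (measurableTypeR R) -> \bar R}) (phi : R -> R) : R :=
  \int[nu]_(x in I) \int[lebesgue_measure]_(y in I) (phi y * p x y).

Definition update (R : realType) (I : set R) (p g : R -> R -> R) (z : R)
    (nu : {measure set (measurableTypeR R) -> \bar R}) (phi : R -> R) : R :=
  predict I p nu (fun x => phi x * g z x) / predict I p nu (g z).

(** Fibre map of the filtering cocycle over [shift], from the fibre over [w] to
    the fibre over [shift w]. *)
Definition filter_map (R : realType) (I : set R) (p g : R -> R -> R)
    (w : path_space R) (nu : {measure set (measurableTypeR R) -> \bar R})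
    : (R -> R) -> R :=
  update I p g (w 1).2 nu.

(** The positivity clause says that the denominator in [filter_map] is nonzero,
    i.e. that the image of [nu w] is defined. *)
Definition ac_equivariant (R : realType) (I : set R) (p g : R -> R -> R)
    (m : probability (path_space R) R)
    (nu : path_space R -> {measure set (measurableTypeR R) -> \bar R}) : Prop :=
  \forall w \ae m,
    [/\ nu w setT = 1%E,
        (exists2 f, cone0 (obs_support I g (w 0).2) f & has_density (nu w) f),
        0 < predict I p (nu w) (g (w 1).2) &
        forall phi : R -> R, measurable_fun setT phi ->
          (exists M, forall x, `|phi x| <= M) ->
          filter_map I p g w (nu w) phi = \int[nu (shift w)]_x phi x].

(* Main.v *)
From HB Require Import structures.
Require Import Defs.
From mathcomp Require Import all_boot all_order all_algebra.
From mathcomp Require Import all_classical all_reals all_analysis.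
From mathcomp Require Import measurable_realfun ring lra.
Import Order.TTheory GRing.Theory Num.Theory.
Import numFieldNormedType.Exports.
Import HBNNSimple.
Set Implicit Arguments.
Unset Strict Implicit.
Unset Printing Implicit Defensive.

Local Open Scope classical_set_scope.
Local Open Scope ring_scope.

(** Write [x] and [z] for the coordinates of a path. The equivariant measure is
    the filter: the conditional law of [x 0] given the observations [z 0],
    [z (-1)], ...

    Existence. One step of the stationary process has a density with respect to
    the Lebesgue measure ([one_step]). Therefore the joint law of the past
    observations and of the present state is dominated by the product of the law
    of the past observations with the Lebesgue measure ([state_obs_dominated]).
    The Radon-Nikodym density is the filter. The law of the past observations, of
    the next observation and of the next state can be computed before or after the
    shift, and the comparison is Bayes' rule ([bayes]), which says that the filter
    is equivariant ([filter_equivariant]). The denominator is almost surely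
    positive, being the density of an observation at its own value
    ([evidence_gt0]).

    Uniqueness. Two equivariant families define, along the backward orbit of a
    path, two sequences of densities that are updated with the same observations.
    Up to scaling, the density at time [- j] is the image of the density at time
    [- j - 1] by a linear operator ([propagate]). Its dual maps the likelihood
    [b j] of the [j] latest observations, a function of the state at time [- j], to
    [b (j + 1)]. So the two densities [F j] and [F' j] have mass 1 against [b j]
    for all [j], and one follows their [overlap], the integral of
    [min (F j) (F' j)] against [b j].

    Call [(z, y)] a merging if almost every state that may have produced the
    observation [z] jumps to [y] with density at least [c]. Between the times
    [- j - 1] and [- j], both densities are spread over the mergings of
    [z (- j - 1)]. If these carry at least the proportion [delta] of the likelihood
    of the later observations, then the overlap recovers a fixed proportion of the
    mass that it misses ([overlap_step]). If that happens for infinitely many [j],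
    then the overlap is the whole mass at time 0, and the two densities coincide
    ([filter_past_unique]).

    It remains to see that this happens. A merging takes place between [- j - 1]
    and [- j] with a positive probability that does not depend on [j]
    ([merging_gt0]). It is improbable, uniformly in [j], that one takes place while
    mergings carry less than the proportion [delta] of the likelihood, because the
    later observations are then unlikely ([bad_merging_le]). Hence, for some
    [delta], infinitely many [j] are good with positive probability
    ([frequent_merging_gt0]). By ergodicity, almost every path meets this event at
    some time of its past ([ae_past_recurrent]), where the two families agree, and
    equivariance carries the agreement forward to time 0 ([equivariant_agree]). *)

(** * Nonnegative integrals *)

Section product_sigma_finite.
Local Open Scope ereal_scope.
Context d1 d2 (T1 : measurableType d1) (T2 : measurableType d2) (R : realType).
Variables (m1 : {sigma_finite_measure set T1 -> \bar R})
          (m2 : {sigma_finite_measure set T2 -> \bar R}).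

(** The product measure under a name of its own, so that its sigma-finiteness
    can be recorded and products can be iterated. *)
Definition sf_product : set (T1 * T2) -> \bar R := (m1 \x m2)%E.

HB.instance Definition _ := Measure.on sf_product.

Let sf_product_sigma_finite : sigma_finite setT sf_product.
Proof.
have /sigma_finiteP[F [TF ndF Foo]] := sigma_finiteT m1.
have /sigma_finiteP[G [TG ndG Goo]] := sigma_finiteT m2.
exists (fun n => F n `*` G n).
  rewrite -setXTT TF TG predeqE => -[x y]; split.
    move=> [/= [n _ Fnx] [k _ Gky]]; exists (maxn n k) => //; split.
    - by move: x Fnx; exact/subsetPset/ndF/leq_maxl.
    - by move: y Gky; exact/subsetPset/ndG/leq_maxr.
  by move=> [n _ []/= ? ?]; split; exists n.
move=> k; have [mF Fk] := Foo k; have [mG Gk] := Goo k.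
split; first exact: measurableX.
by rewrite /sf_product product_measure1E// lte_mul_pinfty// ge0_fin_numE.
Qed.

HB.instance Definition _ :=
  Measure_isSigmaFinite.Build _ _ _ sf_product sf_product_sigma_finite.

End product_sigma_finite.
Notation "m1 '\*x' m2" := (sf_product m1 m2) (at level 40) : ereal_scope.

Section tonelli.
Local Open Scope ereal_scope.
Context d1 d2 (T1 : measurableType d1) (T2 : measurableType d2) (R : realType).
Implicit Types f : T1 -> T2 -> \bar R.

Lemma measurable_fun_integral (m2 : {sigma_finite_measure set T2 -> \bar R}) f :
  measurable_fun setT (fun u : T1 * T2 => f u.1 u.2) ->
  (forall x y, 0 <= f x y) ->
  measurable_fun setT (fun x => \int[m2]_y f x y).
Proof.
move=> mf f0; pose F := fun u : T1 * T2 => f u.1 u.2.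
by apply: (measurable_fun_fubini_tonelli_F F) => // -[x y]; exact: f0.
Qed.

Lemma tonelli (m1 : {sigma_finite_measure set T1 -> \bar R})
    (m2 : {sigma_finite_measure set T2 -> \bar R}) f :
  measurable_fun setT (fun u : T1 * T2 => f u.1 u.2) ->
  (forall x y, 0 <= f x y) ->
  \int[m1]_x \int[m2]_y f x y = \int[m2]_y \int[m1]_x f x y.
Proof.
move=> mf f0; pose F := fun u : T1 * T2 => f u.1 u.2.
by apply: (fubini_tonelli F) => // -[x y]; exact: f0.
Qed.

Lemma tonelli_prod (m1 : {sigma_finite_measure set T1 -> \bar R})
    (m2 : {sigma_finite_measure set T2 -> \bar R}) (F : T1 * T2 -> \bar R) :
  measurable_fun setT F -> (forall u, 0 <= F u) ->
  \int[m1 \*x m2]_u F u = \int[m1]_x \int[m2]_y F (x, y).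
Proof. by move=> mF F0; exact: fubini_tonelli1. Qed.

End tonelli.

Section density.
Local Open Scope ereal_scope.
Context d (T : measurableType d) (R : realType).
Variables (mu : {measure set T -> \bar R}) (h : T -> \bar R).
Hypotheses (mh : measurable_fun setT h) (h0 : forall x, 0 <= h x).

Definition density_measure of measurable_fun setT h & (forall x, 0 <= h x) :=
  fun A : set T => \int[mu]_(x in A) h x.
Local Notation dm := (density_measure mh h0).

Let density0 : dm set0 = 0.
Proof. exact: integral_set0. Qed.

Let density_ge0 A : 0 <= dm A.
Proof. by apply: integral_ge0 => x _; exact: h0. Qed.

Let density_sigma_additive : semi_sigma_additive dm.
Proof.
move=> F mF tF mUF; rewrite /density_measure.
rewrite ge0_integral_bigcup//; last exact: measurable_funTS.
apply: is_cvg_ereal_nneg_natsum_cond => n _ _.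
by apply: integral_ge0 => x _; exact: h0.
Qed.

HB.instance Definition _ := isMeasure.Build _ _ _ dm
  density0 density_ge0 density_sigma_additive.

Lemma ge0_integral_density (m : {measure set T -> \bar R}) (F : T -> \bar R) :
  (forall x, h x \is a fin_num) ->
  (forall A, measurable A -> m A = \int[mu]_(x in A) h x) ->
  measurable_fun setT F -> (forall x, 0 <= F x) ->
  \int[m]_x F x = \int[mu]_x (F x * h x).
Proof.
move=> hfin mE mF F0; pose f_ := nnsfun_approx measurableT mF.
have cf x : (f_ n x)%:E @[n --> \oo] --> F x by exact: cvg_nnsfun_approx.
have ndf x : {homo (fun n => f_ n x) : a b / (a <= b)%N >-> (a <= b)%R}.
  by move=> a b ab; exact/lefP/nd_nnsfun_approx.
have mf n : measurable_fun setT (fun x => (f_ n x)%:E).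
  exact/measurable_EFinP/measurable_funP.
transitivity (limn (fun n => \int[m]_x (f_ n x)%:E)).
  rewrite -monotone_convergence//.
  - by apply: eq_integral => y _; apply/esym/cvg_lim => //; exact: cf.
  - by move=> n y _; rewrite lee_fin.
  - by move=> y _ a b ab; rewrite lee_fin; exact: ndf.
transitivity (limn (fun n => \int[mu]_x ((f_ n x)%:E * h x))); last first.
  rewrite -monotone_convergence//.
  - by apply: eq_integral => y _; apply/cvg_lim => //; apply: cvgeZr.
  - by move=> n; exact: emeasurable_funM.
  - by move=> n y _; rewrite mule_ge0// lee_fin.
  - by move=> y _ a b ab; rewrite lee_wpmul2r// lee_fin; exact: ndf.
congr (limn _); apply/funext => n.
have mr r : measurable_fun setT (fun x => (r * \1_(f_ n @^-1` [set r]) x)%:E).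
  by apply/measurable_EFinP; exact: measurable_funM.
have step x : (f_ n x)%:E = \sum_(y \in range (f_ n))
   (y * \1_(f_ n @^-1` [set y]) x)%:E.
  by rewrite fsumEFin// -fimfunE.
transitivity (\sum_(y \in range (f_ n)) \int[m]_x
   (y * \1_(f_ n @^-1` [set y]) x)%:E).
  rewrite -ge0_integral_fsum//; last first.
    by move=> r x _; exact: nnfun_muleindic_ge0.
  by apply: eq_integral => x _; rewrite step.
transitivity (\sum_(y \in range (f_ n)) \int[mu]_x
   ((y * \1_(f_ n @^-1` [set y]) x)%:E * h x)); last first.
  rewrite -ge0_integral_fsum//.
  - apply: eq_integral => x _; rewrite step// ge0_mule_fsuml//.
    by move=> r; exact: nnfun_muleindic_ge0.
  - by move=> r; exact: emeasurable_funM.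
  - by move=> r x _; rewrite mule_ge0//; exact: nnfun_muleindic_ge0.
apply: eq_fsbigr => r /[!inE] -[t _ ft].
have r0 : (0 <= r)%R by rewrite -ft.
have mfr : measurable (f_ n @^-1` [set r]).
  by rewrite -[X in measurable X]setTI; exact: measurable_funP.
transitivity (r%:E * \int[m]_x (\1_(f_ n @^-1` [set r]) x)%:E).
  rewrite -ge0_integralZl//; last exact/measurable_EFinP.
transitivity (r%:E * \int[mu]_x ((\1_(f_ n @^-1` [set r]) x)%:E * h x)); last first.
  rewrite -ge0_integralZl//.
  - by apply: eq_integral => x _; rewrite EFinM muleA.
  - by apply: emeasurable_funM => //; exact/measurable_EFinP.
  - by move=> x _; rewrite mule_ge0// lee_fin.
congr (_ * _); rewrite integral_indic// setIT mE//.
rewrite integral_mkcond; apply: eq_integral => x _.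
by rewrite patchE indicE; case: ifPn => xr; rewrite ?mul1e ?mul0e.
Qed.

End density.

(** A proof of measurability is needed to see a pushforward as a measure. *)
Lemma pushforward_measure d1 d2 (T1 : measurableType d1)
    (T2 : measurableType d2) (R : realType) (m : {measure set T1 -> \bar R})
    (f : T1 -> T2) : measurable_fun setT f ->
  exists m' : {measure set T2 -> \bar R}, forall A, m' A = m (f @^-1` A).
Proof.
by move=> mf; unshelve eexists (pushforward m f).
Qed.

Section affine.
Local Open Scope ereal_scope.
Context (R : realType).
Notation leb := (@lebesgue_measure R).

Lemma ge0_integral_affine (x s : R) (G : R -> \bar R) : (0 < s)%R ->
  measurable_fun setT G -> (forall z, 0 <= G z) ->
  \int[leb]_z G z = s%:E * \int[leb]_t G (x + s * t)%R.
Proof.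
move=> s0 mG G0.
pose phi : measurableTypeR R -> measurableTypeR R := fun t => (x + s * t)%R.
have mphi : measurable_fun setT phi by apply: measurable_funD => //; exact: measurable_funM.
have [m0 m0E] := pushforward_measure leb mphi.
pose m := mscale (NngNum (ltW s0)) m0.
have mE A : measurable A -> leb A = m A.
  move=> mA; apply: lebesgue_measure_unique => // _ [[a b]] _ <-.
  transitivity (s%:E * leb (phi @^-1` `]a, b]%classic)); last by rewrite -m0E.
  have -> : phi @^-1` `]a, b] = `]((a - x) / s)%R, ((b - x) / s)%R]%classic.
    apply/seteqP; split => t /=; rewrite !in_itv/= ltr_pdivrMr// ler_pdivlMr//.
      by rewrite ltrBlDl lerBrDl mulrC.
    by rewrite ltrBlDl lerBrDl mulrC.
  rewrite !lebesgue_measure_itv/= !lte_fin ltr_pM2r ?invr_gt0// ltrD2r.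
  case: ifPn => _; last by rewrite mule0.
  by rewrite -!EFinD -EFinM; congr EFin; field; rewrite gt_eqF.
rewrite (eq_measure_integral m)//; last by move=> A mA _; exact: mE.
rewrite /m ge0_integral_mscale//=; congr (_ * _).
rewrite (eq_measure_integral (pushforward leb phi)); last by move=> A mA _; exact: m0E.
by rewrite ge0_integral_pushforward.
Qed.

End affine.

(** * Spaces of sequences *)

Section history.
Context d (T : measurableType d).

Definition history_sets : set (set (nat -> T)) :=
  \bigcup_(n in [set: nat])
    preimage_set_system setT (fun h : nat -> T => h n) measurable.

Definition history := g_sigma_algebraType history_sets.

Lemma measurable_history_coord n :
  measurable_fun setT (fun h : history => h n).
Proof.
move=> _ A mA; rewrite setTI; apply: sub_sigma_algebra.
by exists n => //; exists A => //; rewrite setTI.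
Qed.

Lemma measurable_to_history d' (U : measurableType d') (f : U -> history) :
  (forall n, measurable_fun setT (fun u => f u n)) -> measurable_fun setT f.
Proof.
move=> mf; apply: (@measurability _ _ _ history _ _ history_sets) => //.
move=> _ [_ [n _ [A mA <-]] <-]; rewrite !setTI -comp_preimage.
by rewrite -[Y in measurable Y]setTI; exact: mf.
Qed.

Definition hcons (h : history) (x : T) : history :=
  fun n => if n is k.+1 then h k else x.

Definition htail (h : history) : history := fun n => h n.+1.

Lemma hconsK h x : htail (hcons h x) = h.
Proof. by apply/funext. Qed.

Lemma measurable_hcons :
  measurable_fun setT (fun u : history * T => hcons u.1 u.2).
Proof.
apply: measurable_to_history => -[|n]; first exact: measurable_snd.
exact: (measurableT_comp (measurable_history_coord n) measurable_fst).
Qed.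

Lemma measurable_htail : measurable_fun setT htail.
Proof. by apply: measurable_to_history => n; exact: measurable_history_coord. Qed.

End history.

Section paths.
Context (R : realType).
Notation path := (path_space R).

Lemma measurable_path_coord n : measurable_fun setT (fun w : path => w n).
Proof.
move=> _ A mA; rewrite setTI; apply: sub_sigma_algebra.
by exists n => //; exists A => //; rewrite setTI.
Qed.

Lemma measurable_to_path d' (U : measurableType d') (f : U -> path) :
  (forall n, measurable_fun setT (fun u => f u n)) -> measurable_fun setT f.
Proof.
move=> mf; apply: (@measurability _ _ _ path _ _ (@coordinate_sets R)) => //.
move=> _ [_ [n _ [A mA <-]] <-]; rewrite !setTI -comp_preimage.
by rewrite -[Y in measurable Y]setTI; exact: mf.
Qed.

Definition at_time (n : int) (w : path) : R * R := w n.

Lemma measurable_at_time n : measurable_fun setT (at_time n).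
Proof. exact: measurable_path_coord. Qed.

(** Integer powers of the shift: the contraction argument runs along the backward
    orbit of a path. *)
Definition shiftn (k : int) (w : path) : path := fun n => w (n + k).

Lemma measurable_shiftn k : measurable_fun setT (shiftn k).
Proof. by apply: measurable_to_path => n; exact: measurable_path_coord. Qed.

Lemma shiftnD j k w : shiftn j (shiftn k w) = shiftn (j + k) w.
Proof. by apply/funext => n; rewrite /shiftn addrA. Qed.

Lemma shiftn0 w : shiftn 0 w = w.
Proof. by apply/funext => n; rewrite /shiftn addr0. Qed.

Definition past (w : path) : history (R * R)%type := fun n => w (- n%:Z).

Lemma measurable_past : measurable_fun setT past.
Proof. by apply: measurable_to_history => n; exact: measurable_path_coord. Qed.

Lemma past_shift w : past (Defs.shift w) = hcons (past w) (w 1).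
Proof.
apply/funext => -[|n]; rewrite /past /Defs.shift/= ?add0r//.
by congr w; rewrite -addn1 PoszD opprD subrK.
Qed.

Definition obs_past (w : path) : history R := fun n => (w (- n%:Z)).2.

Lemma obs_past_shift w : obs_past (Defs.shift w) = hcons (obs_past w) (w 1).2.
Proof.
apply/funext => -[|n]; rewrite /obs_past /Defs.shift/= ?add0r//.
by congr (w _).2; rewrite -addn1 PoszD opprD subrK.
Qed.

Definition obs_history (h : history (R * R)%type) : history R := fun n => (h n).2.

Lemma measurable_obs_history : measurable_fun setT obs_history.
Proof.
apply: measurable_to_history => n.
exact: (measurableT_comp measurable_snd (measurable_history_coord n)).
Qed.

Lemma measurable_obs_past : measurable_fun setT obs_past.
Proof. exact: (measurableT_comp measurable_obs_history measurable_past). Qed.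

(** Under [m], the next state and observation have the conditional density
    [p x' x * g z x] with respect to the Lebesgue measure, given the whole past,
    where [x'] is the present state. *)
Definition hidden_markov (m : probability path R) (p g : R -> R -> R) :=
  forall F : history (R * R)%type * (R * R) -> \bar R,
  measurable_fun setT F -> (forall u, 0 <= F u)%E ->
  (\int[m]_w F (past w, at_time 1 w) =
  \int[m]_w \int[@lebesgue_measure R]_x \int[@lebesgue_measure R]_z
    ((p (at_time 0 w).1 x * g z x)%:E * F (past w, (x, z))))%E.

End paths.

Lemma measurable_EFin2 (R : realType) (p : R -> R -> R)
    (mp : measurable_fun setT (fun u : R * R => p u.1 u.2))
    d (T : measurableType d) (a b : T -> measurableTypeR R) :
  measurable_fun setT a -> measurable_fun setT b ->
  measurable_fun setT (fun v => (p (a v) (b v))%:E).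
Proof.
move=> ma mb; apply/measurable_EFinP.
apply: (measurableT_comp mp (g := fun v => (a v, b v))).
exact: measurable_fun_pair.
Qed.

(** * One step of the state and observation process *)

Lemma integral_indicl d (T : measurableType d) (R : realType)
    (m : {measure set T -> \bar R}) (A : set T) (f : T -> \bar R) :
  (\int[m]_(x in A) f x = \int[m]_x ((\1_A x)%:E * f x))%E.
Proof.
rewrite integral_mkcond; apply: eq_integral => x _.
by rewrite patchE indicE; case: ifPn => _; rewrite ?mul1e ?mul0e.
Qed.

Section laws.
Local Open Scope ereal_scope.
Context d1 d2 (T1 : measurableType d1) (T2 : measurableType d2) (R : realType).

Lemma eq_measure_prod (m1 m2 : {measure set (T1 * T2)%type -> \bar R}) :
  m1 setT < +oo ->
  (forall A B, measurable A -> measurable B -> m1 (A `*` B) = m2 (A `*` B)) ->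
  forall C, measurable C -> m1 C = m2 C.
Proof.
move=> m1fin m12 C mC.
pose G := [set A `*` B | A in @measurable _ T1 & B in @measurable _ T2].
apply: (measure_unique G (fun=> setT)) => //.
- exact: measurable_prod_measurableType.
- move=> _ _ [A mA [B mB <-]] [A' mA' [B' mB' <-]].
  rewrite -setXI; exists (A `&` A'); first exact: measurableI.
  by exists (B `&` B') => //; exact: measurableI.
- by move=> _; exists setT => //; exists setT => //; rewrite setXTT.
- by rewrite bigcup_const//; exists 0%N.
- by move=> _ [A mA [B mB <-]]; exact: m12.
Qed.

Lemma ge0_integral_mrestr (m : {measure set T1 -> \bar R}) (E : set T1)
    (mE : measurable E) (F : T1 -> \bar R) :
  measurable_fun setT F -> (forall x, 0 <= F x) ->
  \int[mrestr m mE]_x F x = \int[m]_(x in E) F x.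
Proof.
move=> mF F0.
rewrite (@ge0_integral_density _ _ _ m (fun x => (\1_E x)%:E))//.
- rewrite [RHS]integral_mkcond; apply: eq_integral => x _.
  by rewrite patchE indicE; case: ifPn => _; rewrite ?mule1 ?mule0.
- exact/measurable_EFinP.
- by move=> A mA; rewrite integral_indic// setIC.
Qed.

Lemma exists_law (m : {measure set T1 -> \bar R}) (Y : T1 -> T2) (E : set T1) :
  measurable_fun setT Y -> measurable E ->
  exists rho : {measure set T2 -> \bar R},
    (forall B, rho B = m (E `&` Y @^-1` B)) /\
    forall F, measurable_fun setT F -> (forall y, 0 <= F y) ->
      \int[rho]_y F y = \int[m]_(x in E) F (Y x).
Proof.
move=> mY mE; have [rho rhoE] := pushforward_measure (mrestr m mE) mY.
exists rho; split => [B|F mF F0]; first by rewrite rhoE/= /mrestr setIC.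
rewrite (eq_measure_integral (pushforward (mrestr m mE) Y))//.
rewrite ge0_integral_pushforward// preimage_setT ge0_integral_mrestr//=.
exact: measurableT_comp.
Qed.

End laws.

Section sigma_of.
Context (R : realType) d (T : measurableType d) (P : probability T R).
Variable Y : int -> {RV P >-> R}.

Lemma sigma_of_sub D E : sigma_of Y D E -> measurable E.
Proof.
apply: smallest_sub; first exact: sigma_algebra_measurable.
by move=> _ [n _ [A mA <-]]; rewrite setTI; exact: measurable_funPTI.
Qed.

Lemma sigma_of_preimage D n A : D n -> measurable A ->
  sigma_of Y D (Y n @^-1` A).
Proof.
by move=> Dn mA; apply: sub_sigma_algebra; exists n => //; exists A => //; rewrite setTI.
Qed.

Lemma sigma_ofI D E F : sigma_of Y D E -> sigma_of Y D F -> sigma_of Y D (E `&` F).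
Proof.
exact: (@measurableI _ (g_sigma_algebraType (\bigcup_(n in D)
   preimage_set_system setT (Y n) measurable))).
Qed.

Lemma sigma_ofT D : sigma_of Y D setT.
Proof.
exact: (@measurableT _ (g_sigma_algebraType (\bigcup_(n in D)
   preimage_set_system setT (Y n) measurable))).
Qed.

Lemma sigma_of_mono D D' : D `<=` D' -> sigma_of Y D `<=` sigma_of Y D'.
Proof.
move=> DD'; apply: sub_sigma_algebra2 => E [n Dn YE].
by exists n => //; exact: DD'.
Qed.

(** From the finite families of the definition to the whole past, by the
    uniqueness of measures on a pi-system. *)
Lemma independent_of_past E D : mutually_independent P Y ->
  sigma_of Y [set k | k <= 0] E -> measurable D ->
  P (E `&` Y 1 @^-1` D) = (P E * P (Y 1 @^-1` D))%E.
Proof.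
move=> ind sE mD.
pose G := [set E : set T | exists (s : seq int) (A : int -> set R),
  [/\ uniq s, (forall n, n \in s -> n <= 0), (forall n, measurable (A n)) &
      E = \bigcap_(n in [set` s]) (Y n @^-1` A n)]].
have mY n A : measurable A -> measurable (Y n @^-1` A).
  by move=> mA; exact: measurable_funPTI.
have mYD := mY 1 D mD.
have PD0 : 0 <= fine (P (Y 1 @^-1` D)) by rewrite fine_ge0.
pose m1 : {measure set T -> \bar R} := mrestr P mYD.
pose m2 : {measure set T -> \bar R} := mscale (NngNum PD0) P.
have Gm : G `<=` measurable.
  move=> _ [s [A [_ _ mA ->]]]; apply: fin_bigcap_measurable => //.
  by move=> n _; exact: mY.
have GT : G setT.
  exists [::], (fun=> setT); split => //.
  by apply/seteqP; split.
suff : m1 E = m2 E.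
  by rewrite /m1 /m2 /= /mrestr /mscale /= fineK ?fin_num_measure// muleC.
apply: (@g_sigma_algebra_measure_unique _ _ _ G Gm (fun=> setT)) => //.
- by rewrite bigcup_const//; exists 0%N.
- move=> _ _ [s [A [us s0 mA ->]]] [t [B [ut t0 mB ->]]].
  pose C n := (if n \in s then A n else setT) `&` (if n \in t then B n else setT).
  exists (undup (s ++ t)), C; split.
  + exact: undup_uniq.
  + by move=> n; rewrite mem_undup mem_cat => /orP[/s0|/t0].
  + by move=> n; apply: measurableI; case: ifPn.
  + apply/seteqP; split => [w [sw tw] n /= _|w Cw].
      by split; case: ifPn => // ?; [exact: sw|exact: tw].
    split => n /= ns.
      have := Cw n; rewrite /= mem_undup mem_cat ns => /(_ isT)[].
      by rewrite ns.
    have := Cw n; rewrite /= mem_undup mem_cat ns orbT => /(_ isT)[_].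
    by rewrite ns.
- move=> _ [s [A [us s0 mA ->]]].
  rewrite /m1 /m2 /= /mrestr /mscale /= fineK ?fin_num_measure//.
  pose A' n := if n == 1 then D else A n.
  have s1 : 1 \notin s by apply/negP => /s0.
  have A's n : n \in s -> A' n = A n.
    by move=> ns; rewrite /A'; case: eqP => // n1; move: s1; rewrite -n1 ns.
  have mA' n : measurable (A' n) by rewrite /A'; case: ifPn.
  have := ind (1 :: s) A'; rewrite /= s1 us => /(_ isT mA').
  have sE' : \bigcap_(n in [set` s]) Y n @^-1` A' n = \bigcap_(n in [set` s]) Y n @^-1` A n.
    by apply: eq_bigcapr => n /= ns; rewrite A's.
  have -> : \bigcap_(n in [set` 1 :: s]) Y n @^-1` A' n =
      Y 1 @^-1` A' 1 `&` \bigcap_(n in [set` s]) Y n @^-1` A' n.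
    apply/seteqP; split => [w wA|w [w1 wA] n /=].
      split; first by apply: wA; rewrite /= mem_head.
      by move=> n /= ns; apply: wA; rewrite /= inE ns orbT.
    by rewrite inE => /predU1P[->//|ns]; exact: wA.
  rewrite big_cons.
  have -> : (\prod_(n <- s) P (Y n @^-1` A' n) = \prod_(n <- s) P (Y n @^-1` A n))%E.
    by rewrite !big_seq; apply: eq_bigr => n ns; rewrite A's.
  rewrite -(ind s A us mA) sE' setIC.
  by have -> : A' 1 = D by rewrite /A' eqxx.
- by move=> _; rewrite /m1/= /mrestr setTI ltey_eq fin_num_measure.
- move: sE; apply: sub_sigma_algebra2 => _ [n n0 [A mA <-]]; rewrite setTI.
  exists [:: n], (fun=> A); split => //.
    by move=> k; rewrite inE => /eqP ->.
  by apply/seteqP; split => [w wA k /=|w /(_ n)]; rewrite /= ?inE ?eqxx; [move=> /eqP ->|exact].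
Qed.

End sigma_of.

Section one_step.
Local Open Scope ereal_scope.
Context (R : realType) d (Omega : measurableType d) (P : probability Omega R).
Variables (X Z xi : int -> {RV P >-> R}).
Variables (p : R -> R -> R) (s psi : R -> R) (B : R).
Notation leb := (@lebesgue_measure R).
Notation mR := (measurableTypeR R).

Hypothesis mp : measurable_fun setT (fun u : R * R => p u.1 u.2).
Hypothesis p0 : forall x y, (0 <= p x y)%R.
Hypothesis pB : forall x y, (p x y <= B)%R.
Hypothesis ms : measurable_fun setT s.
Hypothesis s0 : forall x, (0 < s x)%R.
Hypothesis markov : forall E A, sigma_of X [set k | (k <= 0)%R] E ->
  measurable A ->
  P (E `&` X 1 @^-1` A) = \int[P]_(w in E) \int[leb]_(y in A) (p (X 0 w) y)%:E.
Hypothesis xid : forall n, has_density (distribution P (xi n)) psi.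
Hypothesis xii : mutually_independent P xi.
Hypothesis Xxi : independent_processes P X xi.
Hypothesis ZE : forall n w, Z n w = (X n w + s (X n w) * xi n w)%R.

Let mpsi : measurable_fun setT psi. Proof. by case: (xid 0). Qed.
Let psi0 t : (0 <= psi t)%R. Proof. by case: (xid 0). Qed.

(** The joint past of the state and of the noise is generated by products of
    events, one from each process. *)
Let past_events : set (set Omega) :=
  [set E | exists E1 E2, [/\ sigma_of X [set k | (k <= 0)%R] E1,
    sigma_of xi [set k | (k <= 0)%R] E2 & E = E1 `&` E2]].

Let past_eventsm : past_events `<=` measurable.
Proof.
by move=> _ [E1 [E2 [sE1 sE2 ->]]]; apply: measurableI;
  [exact: sigma_of_sub sE1|exact: sigma_of_sub sE2].
Qed.

Let past_eventsI : setI_closed past_events.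
Proof.
move=> _ _ [E1 [E2 [sE1 sE2 ->]]] [F1 [F2 [sF1 sF2 ->]]].
by exists (E1 `&` F1), (E2 `&` F2); split;
  [exact: sigma_ofI|exact: sigma_ofI|rewrite setIACA].
Qed.

Let past_eventsT : past_events setT.
Proof.
by exists setT, setT; split; [exact: sigma_ofT|exact: sigma_ofT|rewrite setIT].
Qed.

Let mpA A : measurable A ->
  measurable_fun setT (fun x => \int[leb]_(y in A) (p x y)%:E).
Proof.
move=> mA; have -> : (fun x => \int[leb]_(y in A) (p x y)%:E) =
    (fun x => \int[leb]_y ((p x y)%:E * (\1_A y)%:E)).
  apply/funext => x; rewrite integral_mkcond; apply: eq_integral => y _.
  by rewrite patchE indicE; case: ifPn => _; rewrite ?mule1 ?mule0.
apply: measurable_fun_integral => /=.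
  apply: emeasurable_funM; first exact/measurable_EFinP.
  by apply/measurable_EFinP; apply: measurableT_comp => //.
by move=> x y; rewrite mule_ge0// lee_fin.
Qed.

Let pA0 A x : 0 <= \int[leb]_(y in A) (p x y)%:E.
Proof. by apply: integral_ge0 => y _; rewrite lee_fin. Qed.

Let mX n : measurable_fun setT (X n). Proof. exact: measurable_funPT. Qed.

Let integral_indep E1 E2 (F : R -> \bar R) :
  sigma_of X [set k | (k <= 0)%R] E1 -> sigma_of xi [set k | (k <= 0)%R] E2 ->
  measurable_fun setT F -> (forall x, 0 <= F x) ->
  \int[P]_(w in E1 `&` E2) F (X 0 w) = P E2 * \int[P]_(w in E1) F (X 0 w).
Proof.
move=> sE1 sE2 mF F0.
have mE1 := sigma_of_sub sE1; have mE2 := sigma_of_sub sE2.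
have [r1 [r1E r1I]] := exists_law P (mX 0) mE1.
have [r2 [r2E r2I]] := exists_law P (mX 0) (measurableI _ _ mE1 mE2).
rewrite -r1I// -r2I//.
have PE2 : (0 <= fine (P E2))%R by rewrite fine_ge0.
rewrite (eq_measure_integral (mscale (NngNum PE2) r1)).
  by rewrite ge0_integral_mscale//= fineK// fin_num_measure.
move=> A mA _; rewrite r2E /= /mscale /= [r1 A]r1E fineK ?fin_num_measure//.
rewrite muleC -Xxi//.
- by rewrite setIAC.
- apply: sigma_ofI; first exact: sigma_of_mono sE1.
  exact: sigma_of_preimage.
- exact: sigma_of_mono sE2.
Qed.

Let step_rect E A D : past_events E -> measurable A -> measurable D ->
  P (E `&` (X 1 @^-1` A `&` xi 1 @^-1` D)) =
  (\int[P]_(w in E) \int[leb]_(y in A) (p (X 0 w) y)%:E) * P (xi 1 @^-1` D).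
Proof.
move=> [E1 [E2 [sE1 sE2 ->]]] mA mD.
rewrite (integral_indep (F := fun x => \int[leb]_(y in A) (p x y)%:E))//;
  last exact: mpA.
rewrite setIACA Xxi.
- by rewrite markov// independent_of_past// muleA [in RHS](muleC (P E2)).
- apply: sigma_ofI; first exact: sigma_of_mono sE1.
  exact: sigma_of_preimage.
- apply: sigma_ofI; first exact: sigma_of_mono sE2.
  exact: sigma_of_preimage.
Qed.

Let step_sigma E A D : <<s past_events >> E -> measurable A -> measurable D ->
  P (E `&` (X 1 @^-1` A `&` xi 1 @^-1` D)) =
  (\int[P]_(w in E) \int[leb]_(y in A) (p (X 0 w) y)%:E) * P (xi 1 @^-1` D).
Proof.
move=> sE mA mD.
have mAD : measurable (X 1 @^-1` A `&` xi 1 @^-1` D).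
  by apply: measurableI; exact: measurable_funPTI.
have mxiD : measurable (xi 1 @^-1` D) by exact: measurable_funPTI.
have PD : (0 <= fine (P (xi 1 @^-1` D)))%R by rewrite fine_ge0.
have mh : measurable_fun setT (fun w => \int[leb]_(y in A) (p (X 0 w) y)%:E).
  exact: (measurableT_comp (mpA mA) (mX 0)).
have h0 w : 0 <= \int[leb]_(y in A) (p (X 0 w) y)%:E by exact: pA0.
pose m1 : {measure set Omega -> \bar R} := mrestr P mAD.
pose m2 : {measure set Omega -> \bar R} :=
  mscale (NngNum PD) (density_measure P mh h0).
suff m12 : m1 E = m2 E.
  transitivity (m1 E) => //; rewrite m12 /m2/= /mscale/= fineK ?fin_num_measure//.
  exact: muleC.
apply: (@g_sigma_algebra_measure_unique _ _ _ past_events past_eventsm (fun=> setT)) => //.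
- by rewrite bigcup_const//; exists 0%N.
- move=> F sF; rewrite /m1 /m2 /= /mrestr /mscale /= fineK ?fin_num_measure//.
  by rewrite muleC step_rect.
- by move=> _; rewrite /m1/= /mrestr setTI ltey_eq fin_num_measure.
Qed.

Let g z x : R := ((s x)^-1 * psi ((z - x) / s x))%R.

Let g0 z x : (0 <= g z x)%R.
Proof. by rewrite mulr_ge0// invr_ge0 ltW. Qed.

Let mg : measurable_fun setT (fun u : R * R => g u.2 u.1).
Proof.
have msV : measurable_fun setT (fun x => (s x)^-1)%R.
  have -> : (fun x => (s x)^-1)%R = (@powR R ^~ (-1)%R) \o s.
    by apply/funext => x /=; rewrite powR_inv1// ltW.
  exact: measurableT_comp.
apply: measurable_funM; first exact: (measurableT_comp msV measurable_fst).
apply: measurableT_comp => //; apply: measurable_funM.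
  exact: measurable_funB.
exact: (measurableT_comp msV measurable_fst).
Qed.

Let mgx x : measurable_fun setT (fun z => (g z x)%:E).
Proof.
apply/measurable_EFinP.
exact: (measurableT_comp mg (g := fun z => (x, z)) (measurable_pair1 x)).
Qed.

Let mpg : measurable_fun setT (fun v : Omega * (R * R) =>
  (p (X 0 v.1) v.2.1 * g v.2.2 v.2.1)%:E).
Proof.
apply/measurable_EFinP; apply: measurable_funM.
  apply: (measurableT_comp mp (g := fun v : Omega * (R * R) => (X 0 v.1, v.2.1))).
  apply: measurable_fun_pair; first exact: measurableT_comp.
  exact: measurableT_comp measurable_fst measurable_snd.
exact: (measurableT_comp mg measurable_snd).
Qed.

Section fixed_event.
Variables (E : set Omega) (sE : <<s past_events >> E).
Let mE : measurable E.
Proof.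
by move: sE; apply: smallest_sub => //; exact: sigma_algebra_measurable.
Qed.

Let r x : \bar R := \int[mrestr P mE]_w (p (X 0 w) x)%:E.

Let r0 x : 0 <= r x. Proof. by apply: integral_ge0 => w _; rewrite lee_fin. Qed.

Let mpX : measurable_fun setT (fun u : R * Omega => (p (X 0 u.2) u.1)%:E).
Proof.
apply/measurable_EFinP.
apply: (measurableT_comp mp (g := fun u : R * Omega => (X 0 u.2, u.1))).
by apply: measurable_fun_pair => //; exact: measurableT_comp.
Qed.

Let mpX' : measurable_fun setT (fun u : Omega * R => (p (X 0 u.1) u.2)%:E).
Proof.
apply: (measurableT_comp mpX (g := fun u : Omega * R => (u.2, u.1))).
exact: measurable_fun_pair.
Qed.

Let mr : measurable_fun setT r.
Proof.
apply: (@measurable_fun_integral _ _ _ _ _ _ (fun x w => (p (X 0 w) x)%:E)) => //.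
by move=> x w; rewrite lee_fin.
Qed.

Let rfin x : r x \is a fin_num.
Proof.
rewrite ge0_fin_numE//; apply: (@le_lt_trans _ _ (\int[mrestr P mE]_w (cst B%:E w))).
  apply: ge0_le_integral => //.
  - by move=> w _; rewrite lee_fin.
  - exact: (measurableT_comp mpX (measurable_pair1 x)).
  - by move=> w _; rewrite lee_fin.
rewrite integral_cst//= lte_mul_pinfty//.
  by rewrite lee_fin (le_trans (p0 0 0)).
by rewrite /mrestr setTI ltey_eq fin_num_measure.
Qed.

Let step_noise (F : R * R -> \bar R) :
  measurable_fun setT F -> (forall u, 0 <= F u) ->
  \int[P]_(w in E) F (X 1 w, xi 1 w) =
  \int[leb]_x (r x * \int[leb]_t (F (x, t) * (psi t)%:E)).
Proof.
move=> mF F0.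
have mXxi : measurable_fun setT (fun w => (X 1 w, xi 1 w)).
  by apply: measurable_fun_pair.
have [rho [rhoE rhoI]] := @exists_law _ _ _ (mR * mR)%type _ P _ E mXxi mE.
rewrite -rhoI//.
pose h u := r u.1 * (psi u.2)%:E.
have mh : measurable_fun setT h.
  apply: emeasurable_funM; first exact: measurableT_comp.
  by apply/measurable_EFinP; exact: measurableT_comp.
have h0 u : 0 <= h u by rewrite mule_ge0// lee_fin.
have hfin u : h u \is a fin_num by rewrite fin_numM.
have rho_density A : measurable A -> rho A = \int[(leb \*x leb)%E]_(u in A) h u.
  move=> mA.
  rewrite -[RHS]/(density_measure (leb \*x leb)%E mh h0 A).
  apply: eq_measure_prod => //.
    by rewrite rhoE preimage_setT setIT ltey_eq fin_num_measure.
  move=> C D mC mD; rewrite rhoE /=.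
  have -> : E `&` (fun w => (X 1 w, xi 1 w)) @^-1` (C `*` D) =
    E `&` (X 1 @^-1` C `&` xi 1 @^-1` D) by [].
  rewrite step_sigma// /density_measure integral_mkcond.
  have -> : (h \_ (C `*` D)) = fun u => (r \_ C) u.1 * ((EFin \o psi) \_ D) u.2.
    apply/funext => -[x t]; rewrite !patchE/= in_setX.
    by case: (x \in C); case: (t \in D); rewrite /= ?mule0 ?mul0e.
  have rC0 x : 0 <= (r \_ C) x by rewrite patchE; case: ifPn.
  have pD0 t : 0 <= ((EFin \o psi) \_ D) t.
    by rewrite patchE; case: ifPn => // _; rewrite lee_fin.
  have mrC : measurable_fun setT (r \_ C) by apply/(measurable_restrictT _ _).1 => //;
      exact: measurable_funTS.
  have mpD : measurable_fun setT ((EFin \o psi) \_ D).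
    by apply/(measurable_restrictT _ _).1 => //; apply: measurable_funTS; exact/measurable_EFinP.
  rewrite tonelli_prod//=; last 2 first.
  - by apply: emeasurable_funM; exact: measurableT_comp.
  - by move=> u; exact: mule_ge0.
  transitivity (\int[leb]_x ((r \_ C) x * \int[leb]_t (((EFin \o psi) \_ D) t))); last first.
    by apply: eq_integral => x _; rewrite -ge0_integralZl.
  rewrite ge0_integralZr//; last exact: integral_ge0.
  rewrite -!integral_mkcond; congr (_ * _).
    rewrite -(ge0_integral_mrestr P mE); last 2 first.
    - exact: (measurableT_comp (mpA mC) (mX 0)).
    - by move=> w; exact: pA0.
    rewrite integral_mkcond [LHS](_ : _ = \int[mrestr P mE]_w
        \int[leb]_x ((\1_C x)%:E * (p (X 0 w) x)%:E)); last first.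
      apply: eq_integral => w _; rewrite integral_mkcond; apply: eq_integral => y _.
      by rewrite patchE indicE; case: ifPn => _; rewrite ?mul1e ?mul0e.
    have mC1 : measurable_fun setT (fun x : R => (\1_C x : R)%:E).
      exact/measurable_EFinP.
    rewrite tonelli//=; last 2 first.
    - apply: emeasurable_funM; first exact: (measurableT_comp mC1).
      exact: mpX'.
    - by move=> w x; rewrite mule_ge0// lee_fin.
    apply: eq_integral => x _; rewrite ge0_integralZl//.
    - by rewrite patchE indicE; case: ifPn => _; rewrite ?mul1e ?mul0e.
    - exact: (measurableT_comp mpX (measurable_pair1 x)).
    - by move=> w _; rewrite lee_fin.
  by have [_ _ xiE] := xid 1; exact: xiE.
rewrite (@ge0_integral_density _ _ _ (leb \*x leb)%E h)//.
rewrite tonelli_prod//; last 2 first.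
- exact: emeasurable_funM.
- by move=> u; rewrite mule_ge0.
apply: eq_integral => x _; rewrite -ge0_integralZl//.
- by apply: eq_integral => t _; rewrite /h/= muleCA.
- apply: emeasurable_funM; last exact/measurable_EFinP.
  exact: (measurableT_comp mF (measurable_pair1 x)).
- by move=> t _; rewrite mule_ge0// lee_fin.
Qed.

(** The observation is an affine function of the noise, given the state: its
    density is a change of variable away from the density of the noise. *)
Lemma one_step_on_event (F : R * R -> \bar R) :
  measurable_fun setT F -> (forall u, 0 <= F u) ->
  \int[P]_(w in E) F (X 1 w, Z 1 w) =
  \int[P]_(w in E) \int[leb]_x \int[leb]_z
    ((p (X 0 w) x * g z x)%:E * F (x, z)).
Proof.
move=> mF F0.
pose F' u := F (u.1, (u.1 + s u.1 * u.2)%R).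
have mF' : measurable_fun setT F'.
  apply: (measurableT_comp mF); apply: measurable_fun_pair => //.
  apply: measurable_funD => //; apply: measurable_funM => //.
  exact: measurableT_comp.
transitivity (\int[P]_(w in E) F' (X 1 w, xi 1 w)).
  by apply: eq_integral => w _; rewrite ZE.
rewrite step_noise//; last by move=> u; exact: F0.
pose J x := \int[leb]_z (F (x, z) * (g z x)%:E).
have mFg : measurable_fun setT (fun u => F u * (g u.2 u.1)%:E).
  by apply: emeasurable_funM => //; exact/measurable_EFinP.
have J0 x : 0 <= J x.
  by apply: integral_ge0 => z _; rewrite mule_ge0// lee_fin.
have mJ : measurable_fun setT J.
  apply: (@measurable_fun_integral _ _ _ _ _ _ (fun x z : mR => F (x, z) * (g z x)%:E)).
    by apply: eq_measurable_fun mFg => -[x z] _.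
  by move=> x z; rewrite mule_ge0// lee_fin.
have F'J x : \int[leb]_t (F' (x, t) * (psi t)%:E) = J x.
  rewrite /J [RHS](@ge0_integral_affine _ x (s x))//; last 2 first.
  - exact: (measurableT_comp mFg (measurable_pair1 x)).
  - by move=> z; rewrite mule_ge0// lee_fin.
  rewrite -ge0_integralZl//=.
  - apply: eq_integral => t _; rewrite /F' /g/= addrAC subrr add0r.
    rewrite (mulrC (s x) t) mulfK ?gt_eqF// muleCA -EFinM mulrA divff ?gt_eqF// mul1r//.
  - apply: (measurableT_comp mFg (g := fun t => (x, (x + s x * t)%R))).
    by apply: measurable_fun_pair => //; apply: measurable_funD.
  - by move=> t _; rewrite mule_ge0// lee_fin.
  - by rewrite lee_fin ltW.
under eq_integral do rewrite F'J.
transitivity (\int[leb]_x \int[mrestr P mE]_w ((p (X 0 w) x)%:E * J x)).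
  apply: eq_integral => x _; rewrite ge0_integralZr//.
  - exact: (measurableT_comp mpX (measurable_pair1 x)).
  - by move=> w _; rewrite lee_fin.
rewrite tonelli//=; last 2 first.
- by apply: emeasurable_funM => //; exact: measurableT_comp.
- by move=> x w; rewrite mule_ge0// lee_fin.
have mI : measurable_fun setT (fun w => \int[leb]_x ((p (X 0 w) x)%:E * J x)).
  apply: (@measurable_fun_integral _ _ _ _ _ _ (fun w (x : mR) => (p (X 0 w) x)%:E * J x)) => /=.
    apply: emeasurable_funM; last exact: measurableT_comp.
    exact: mpX'.
  by move=> w x; rewrite mule_ge0// lee_fin.
rewrite (ge0_integral_mrestr P mE mI); last first.
  by move=> w; apply: integral_ge0 => x _; rewrite mule_ge0// lee_fin.
apply: eq_integral => w _; apply: eq_integral => x _.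
rewrite /J -ge0_integralZl//=.
- by apply: eq_integral => z _;
    rewrite (EFinM (p (X 0 w) x)) -[RHS]muleA [in RHS](muleC (g z x)%:E).
- exact: (measurableT_comp mFg (measurable_pair1 x)).
- by move=> z _; rewrite mule_ge0// lee_fin.
- by rewrite lee_fin.
Qed.

End fixed_event.

Let kappa w : history (R * R)%type := fun n => (X (- n%:Z)%R w, Z (- n%:Z)%R w).

Let mkappa : measurable_fun setT kappa.
Proof.
apply: measurable_to_history => n.
by apply: measurable_fun_pair; exact: measurable_funPT.
Qed.

Let past_event_kappa C : measurable C -> <<s past_events >> (kappa @^-1` C).
Proof.
move=> mC.
have mX' n : measurable_fun setT (X (- n%:Z)%R : g_sigma_algebraType past_events -> R).
  move=> _ A mA; rewrite setTI; apply: sub_sigma_algebra.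
  exists (X (- n%:Z)%R @^-1` A), setT; split; last by rewrite setIT.
    by apply: sigma_of_preimage => //=; rewrite oppr_le0.
  exact: sigma_ofT.
have mxi' n : measurable_fun setT (xi (- n%:Z)%R : g_sigma_algebraType past_events -> R).
  move=> _ A mA; rewrite setTI; apply: sub_sigma_algebra.
  exists setT, (xi (- n%:Z)%R @^-1` A); split; last by rewrite setTI.
    exact: sigma_ofT.
  by apply: sigma_of_preimage => //=; rewrite oppr_le0.
have mk : measurable_fun setT (kappa : g_sigma_algebraType past_events -> history (R * R)%type).
  apply: measurable_to_history => n; apply: measurable_fun_pair => //=.
  have -> : (Z (- n%:Z)%R : Omega -> R) =
      fun w => (X (- n%:Z) w + s (X (- n%:Z) w) * xi (- n%:Z) w)%R.
    by apply/funext => w; exact: ZE.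
  apply: measurable_funD => //; apply: measurable_funM => //.
  exact: (measurableT_comp ms).
by have := mk measurableT _ mC; rewrite setTI.
Qed.

Let m := distribution P (joint_path X Z).

(** The law of the past and of the next pair is compared with its expected
    density on products, one event of the past at a time. *)
Lemma one_step : hidden_markov m p g.
Proof.
move=> F mF F0.
have pg0 (w : R) x z : (0 <= p w x * g z x)%R by rewrite mulr_ge0.
have mpath : measurable_fun setT (fun w : path_space R => (past w, at_time 1 w)).
  apply: measurable_fun_pair; first exact: measurable_past.
  exact: measurable_at_time.
have mFin : measurable_fun setT (fun w : path_space R => \int[leb]_x \int[leb]_z
    ((p (at_time 0 w).1 x * g z x)%:E * F (past w, (x, z)))).
  apply: (@measurable_fun_integral _ _ _ _ _ _ (fun (w : path_space R) (x : mR) =>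
     \int[leb]_z ((p (at_time 0 w).1 x * g z x)%:E * F (past w, (x, z))))); last first.
    by move=> w x; apply: integral_ge0 => z _; rewrite mule_ge0// lee_fin.
  apply: (@measurable_fun_integral _ _ _ _ _ _ (fun (v : path_space R * mR) (z : mR) =>
    ((p (at_time 0 v.1).1 v.2 * g z v.2)%:E * F (past v.1, (v.2, z))))); last first.
    by move=> w x; rewrite mule_ge0// lee_fin.
  have m11 : measurable_fun setT (fun u : path_space R * R * R => u.1.1).
    exact: measurableT_comp measurable_fst measurable_fst.
  have m12 : measurable_fun setT (fun u : path_space R * R * R => u.1.2).
    exact: measurableT_comp measurable_snd measurable_fst.
  apply: emeasurable_funM.
    apply/measurable_EFinP; apply: measurable_funM.
      apply: (measurableT_comp mp (g :=
          fun u : path_space R * R * R => ((at_time 0 u.1.1).1, u.1.2))).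
      apply: measurable_fun_pair => //.
      apply: (measurableT_comp measurable_fst).
      exact: (measurableT_comp (@measurable_at_time R 0)).
    apply: (measurableT_comp mg (g := fun u : path_space R * R * R => (u.1.2, u.2))).
    exact: measurable_fun_pair.
  apply: (measurableT_comp mF (g := fun u : path_space R * R * R => (past u.1.1, (u.1.2, u.2)))).
  apply: measurable_fun_pair; first exact: (measurableT_comp (@measurable_past R)).
  exact: measurable_fun_pair.
rewrite /m [LHS]ge0_integral_distribution; last 2 first.
- exact: (measurableT_comp mF).
- by move=> w; exact: F0.
rewrite [RHS]ge0_integral_distribution; last 2 first.
- exact: mFin.
- by move=> w; apply: integral_ge0 => x _; apply: integral_ge0 => z _; rewrite mule_ge0// lee_fin.
have mY : measurable_fun setT (fun w => (kappa w, (X 1 w, Z 1 w))).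
  apply: measurable_fun_pair; first exact: mkappa.
  by apply: measurable_fun_pair; exact: measurable_funPT.
have [M1 [M1E M1I]] := @exists_law _ _ _ (history (R * R)%type * (mR * mR))%type
  R P _ setT mY measurableT.
pose h (v : Omega * (mR * mR)) := (p (X 0 v.1) v.2.1 * g v.2.2 v.2.1)%:E.
have mh : measurable_fun setT h by exact: mpg.
have h0 v : 0 <= h v by rewrite lee_fin.
pose L2 : {sigma_finite_measure set (mR * mR)%type -> \bar R} := (leb \*x leb)%E.
pose L : {measure set (Omega * (mR * mR))%type -> \bar R} := (P \*x L2)%E.
pose D : {measure set (Omega * (mR * mR))%type -> \bar R} := density_measure L mh h0.
have mK : measurable_fun setT (fun v : Omega * (mR * mR) => (kappa v.1, v.2)).
  by apply: measurable_fun_pair => //; exact: (measurableT_comp mkappa).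
have [M2 [M2E M2I]] := @exists_law _ _ _ (history (R * R)%type * (mR * mR))%type
  R D _ setT mK measurableT.
have DI G : measurable_fun setT G -> (forall v, 0 <= G v) ->
    \int[D]_v G v = \int[P]_w \int[leb]_x \int[leb]_z (h (w, (x, z)) * G (w, (x, z))).
  move=> mG G0.
  rewrite (@ge0_integral_density _ _ _ L h)//.
  rewrite tonelli_prod//; last 2 first.
  - exact: emeasurable_funM.
  - by move=> u; rewrite mule_ge0.
  apply: eq_integral => w _.
  pose Gw (u : mR * mR) := G (w, u) * h (w, u).
  have mGw : measurable_fun setT Gw.
    exact: (measurableT_comp (emeasurable_funM mG mh) (g := pair w)).
  have Gw0 u : 0 <= Gw u by rewrite mule_ge0.
  rewrite -[LHS]/(\int[leb \*x leb]_u Gw u) (tonelli_prod leb leb mGw Gw0).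
  by apply: eq_integral => x _; apply: eq_integral => z _; rewrite muleC.
suff M12 C : measurable C -> M1 C = M2 C.
  transitivity (\int[M1]_y F y); first by rewrite M1I.
  transitivity (\int[M2]_y F y).
    by apply: eq_measure_integral => A mA _; exact: M12.
  rewrite M2I// DI//.
  exact: measurableT_comp.
move: C; apply: eq_measure_prod.
  by rewrite M1E preimage_setT setIT ltey_eq fin_num_measure.
move=> C A mC mA; rewrite M1E M2E !setTI.
have sC := past_event_kappa mC.
have mAf : measurable_fun setT (fun u : R * R => (\1_A u : R)%:E) by exact/measurable_EFinP.
have mCC : measurable_fun setT (fun w => (\1_(kappa @^-1` C) w : R)%:E).
  apply/measurable_EFinP; apply: measurable_indic.
  by have := mkappa measurableT mC; rewrite setTI.
pose E := kappa @^-1` C.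
have mE : measurable E by have := mkappa measurableT mC; rewrite setTI.
pose Y w := (X 1 w, Z 1 w).
have mYA : measurable (Y @^-1` A).
  rewrite -[X in measurable X]setTI; apply: (_ : measurable_fun setT Y) => //.
  by apply: measurable_fun_pair; exact: measurable_funPT.
transitivity (\int[P]_(w in E) (\1_A (Y w))%:E).
  rewrite integral_indicl -[LHS]/(P (E `&` Y @^-1` A)).
  rewrite -(setIT (E `&` _)) -integral_indic//; last exact: measurableI.
  by apply: eq_integral => w _; rewrite -EFinM indicI.
rewrite (one_step_on_event sC (F := fun u => (\1_A u)%:E))//.
rewrite integral_indicl.
transitivity (\int[D]_v (\1_((fun v => (kappa v.1, v.2)) @^-1` (C `*` A)) v)%:E); last first.
  rewrite integral_indic ?setIT//.
  by have := mK measurableT (C `*` A) (measurableX mC mA); rewrite setTI.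
rewrite DI//; last first.
  apply/measurable_EFinP; apply: measurable_indic.
  by have := mK measurableT (C `*` A) (measurableX mC mA); rewrite setTI.
have indE w u : (\1_((fun v : Omega * (R * R) => (kappa v.1, v.2)) @^-1` (C `*` A)) (w, u) =
    \1_E w * \1_A u :> R)%R.
  rewrite !indicE -natrM mulnb; congr (nat_of_bool _)%:R.
  by apply/idP/andP => [/set_mem[Cw Au]|[/set_mem Cw /set_mem Au]];
    [split; exact/mem_set|exact/mem_set].
apply: eq_integral => w _.
have [Ew|Ew] := boolP (w \in E).
  have E1 : \1_E w = 1%R :> R by rewrite indicE Ew.
  rewrite E1 mul1e; apply: eq_integral => x _; apply: eq_integral => z _.
  by rewrite indE E1 mul1r.
have E0 : \1_E w = 0%R :> R by rewrite indicE (negbTE Ew).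
rewrite E0 mul0e; apply/esym; apply: integral0_eq => x _; apply: integral0_eq => z _.
by rewrite indE E0 mul0r mule0.
Qed.

End one_step.

(** * The filter of a stationary hidden Markov process *)

Section null_integrals.
Local Open Scope ereal_scope.
Context d (T : measurableType d) (R : realType) (mu : {measure set T -> \bar R}).
Implicit Types f k : T -> \bar R.

Lemma ge0_integral_eq0P f : measurable_fun setT f -> (forall x, 0 <= f x) ->
  \int[mu]_x f x = 0 <-> \forall x \ae mu, f x = 0.
Proof.
move=> mf f0; have H := ae_eq_integral_abs mu measurableT mf.
have E : \int[mu]_x f x = \int[mu]_x `|f x|.
  by apply: eq_integral => x _; rewrite gee0_abs.
rewrite E; split => [/H|fz]; first by apply: filterS => x /(_ I).
by apply/H; apply: filterS fz => x fx _.
Qed.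

Lemma ge0_integral_eq0S f k : measurable_fun setT f -> (forall x, 0 <= f x) ->
  measurable_fun setT k -> (forall x, 0 <= k x) ->
  (forall x, f x = 0 -> k x = 0) -> \int[mu]_x f x = 0 -> \int[mu]_x k x = 0.
Proof.
move=> mf f0 mk k0 fk /(ge0_integral_eq0P mf f0) fz.
by apply/(ge0_integral_eq0P mk k0); apply: filterS fz => x; exact: fk.
Qed.

End null_integrals.

Lemma measurable_fun_integral_pair d1 d2 (T1 : measurableType d1)
    (T2 : measurableType d2) (R : realType)
    (m2 : {sigma_finite_measure set T2 -> \bar R}) (F : T1 * T2 -> \bar R) :
  measurable_fun setT F -> (forall u, 0 <= F u)%E ->
  measurable_fun setT (fun x => \int[m2]_y F (x, y))%E.
Proof. by move=> mF F0; exact: measurable_fun_fubini_tonelli_F. Qed.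

Section measurable_paths.
Context (R : realType).

Definition state_obs (w : path_space R) : (history R * measurableTypeR R)%type :=
  (obs_past w, (at_time 0 w).1).

Lemma measurable_state_obs : measurable_fun setT state_obs.
Proof.
apply: measurable_fun_pair; first exact: measurable_obs_past.
exact: (measurableT_comp measurable_fst (@measurable_at_time R 0)).
Qed.

HB.instance Definition _ :=
  isMeasurableFun.Build _ _ _ _ (@obs_past R) (@measurable_obs_past R).
HB.instance Definition _ :=
  isMeasurableFun.Build _ _ _ _ state_obs measurable_state_obs.

End measurable_paths.

Section hmm.
Local Open Scope ereal_scope.
Context (R : realType).
Notation leb := (@lebesgue_measure R).
Notation mR := (measurableTypeR R).
Notation path := (path_space R).
Notation H := (history R).
Variables (m : probability (path_space R) R) (p g : R -> R -> R).
Hypothesis mp : measurable_fun setT (fun u : R * R => p u.1 u.2).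
Hypothesis p0 : forall x y, (0 <= p x y)%R.
Hypothesis mg : measurable_fun setT (fun u : R * R => g u.1 u.2).
Hypothesis g0 : forall z x, (0 <= g z x)%R.
Hypothesis m_inv : forall A, measurable A -> m (@Defs.shift R @^-1` A) = m A.
Hypothesis m_step : hidden_markov m p g.

Let measurable_p := measurable_EFin2 mp.
Let measurable_g := measurable_EFin2 mg.
Let pe0 x y : 0 <= (p x y)%:E. Proof. by rewrite lee_fin. Qed.
Let ge0 z x : 0 <= (g z x)%:E. Proof. by rewrite lee_fin. Qed.

Lemma shiftn_invariant k A : measurable A -> m (@shiftn R k @^-1` A) = m A.
Proof.
have pos n : forall A, measurable A -> m (@shiftn R n%:Z @^-1` A) = m A.
  elim: n => [|n IHn] B mB.
    by congr (m _); apply/seteqP; split => w; rewrite /preimage/= shiftn0.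
  rewrite -[RHS](IHn B mB) -(m_inv (A := shiftn n%:Z @^-1` B)); last first.
    by rewrite -[X in measurable X]setTI; exact: measurable_shiftn.
  congr (m _); apply/seteqP; split => w; rewrite /preimage/=.
    by have -> : shiftn n%:Z (Defs.shift w) = shiftn n.+1%:Z w by
      apply/funext => j; rewrite /shiftn /Defs.shift -addn1 PoszD addrA.
  by have -> : shiftn n%:Z (Defs.shift w) = shiftn n.+1%:Z w by
      apply/funext => j; rewrite /shiftn /Defs.shift -addn1 PoszD addrA.
move=> mA; case: k => [n|n]; first exact: pos.
have mB : measurable (@shiftn R (Negz n) @^-1` A).
  by rewrite -[X in measurable X]setTI; exact: measurable_shiftn.
rewrite -(pos n.+1 _ mB); congr (m _).
by apply/seteqP; split => w; rewrite /preimage/= shiftnD NegzE addNr shiftn0.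
Qed.

Lemma integral_shiftn k (F : path -> \bar R) :
  measurable_fun setT F -> (forall w, 0 <= F w) ->
  \int[m]_w F (shiftn k w) = \int[m]_w F w.
Proof.
move=> mF F0.
have [rho [rhoE rhoI]] := exists_law m (@measurable_shiftn R k) measurableT.
rewrite -rhoI//; apply: eq_measure_integral => A mA _.
rewrite rhoE setTI; exact: shiftn_invariant.
Qed.

Lemma integral_shift (F : path -> \bar R) :
  measurable_fun setT F -> (forall w, 0 <= F w) ->
  \int[m]_w F (Defs.shift w) = \int[m]_w F w.
Proof. exact: (integral_shiftn 1). Qed.

Lemma ae_shiftn k (S : path -> Prop) :
  (\forall w \ae m, S w) -> \forall w \ae m, S (shiftn k w).
Proof.
move=> [N [mN N0 SN]]; exists (shiftn k @^-1` N); split.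
- by rewrite -[X in measurable X]setTI; exact: measurable_shiftn.
- by rewrite shiftn_invariant.
- by move=> w /= Sw; exact: SN.
Qed.

Let eta := distribution m (@obs_past R).
Let Q := distribution m (@state_obs R).

(** The Markov property for functions that see the past only through the present
    state and the observations. *)
Lemma step (F : (H * mR) * (mR * mR) -> \bar R) :
  measurable_fun setT F -> (forall u, 0 <= F u) ->
  \int[m]_w F (state_obs w, ((at_time 1 w).2, (at_time 1 w).1)) =
  \int[m]_w \int[leb]_z \int[leb]_x
    ((p (at_time 0 w).1 x)%:E * (g z x)%:E * F (state_obs w, (z, x))).
Proof.
move=> mF F0.
pose G (u : history (R * R)%type * (R * R)) :=
  F ((obs_history u.1, (u.1 0%N).1), (u.2.2, u.2.1)).
have mG : measurable_fun setT G.
  apply: (measurableT_comp mF); apply: measurable_fun_pair.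
    apply: measurable_fun_pair.
      exact: (measurableT_comp (@measurable_obs_history R) measurable_fst).
    apply: (measurableT_comp measurable_fst).
    exact: (measurableT_comp (@measurable_history_coord _ _ 0%N) measurable_fst).
  apply: measurable_fun_pair.
    exact: (measurableT_comp measurable_snd measurable_snd).
  exact: (measurableT_comp measurable_fst measurable_snd).
transitivity (\int[m]_w G (past w, at_time 1 w)).
  by apply: eq_integral => w _; rewrite /G /state_obs /= /past oppr0.
have G0 u : 0 <= G u by exact: F0.
rewrite (m_step mG G0); apply: eq_integral => w _.
transitivity (\int[leb]_x \int[leb]_z
    ((p (at_time 0 w).1 x)%:E * (g z x)%:E * F (state_obs w, (z, x)))).
  apply: eq_integral => x _; apply: eq_integral => z _.
  by rewrite EFinM /G /state_obs /= /past oppr0.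
apply: (tonelli leb leb (f :=
    fun x z : mR => (p (at_time 0 w).1 x)%:E * (g z x)%:E * F (state_obs w, (z, x)))) => /=.
  apply: emeasurable_funM.
    by apply: emeasurable_funM; [exact: measurable_p|exact: measurable_g].
  apply: (measurableT_comp mF (g := fun u : mR * mR => (state_obs w, (u.2, u.1)))).
  by apply: measurable_fun_pair => //; exact: measurable_fun_pair.
by move=> x z; rewrite mule_ge0// mule_ge0.
Qed.

Lemma state_obs_shift w :
  state_obs (Defs.shift w) = (hcons (obs_past w) (at_time 1 w).2, (at_time 1 w).1) :> H * mR.
Proof. by rewrite /state_obs obs_past_shift. Qed.

Let msec d (T : measurableType d) (N : set T) : measurable N ->
  measurable_fun setT (fun v => (\1_N v : R)%:E).
Proof. by move=> mN; exact/measurable_EFinP. Qed.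

Lemma measurable_hcons2 d (T : measurableType d) (a : T -> H) (b : T -> mR) :
  measurable_fun setT a -> measurable_fun setT b ->
  measurable_fun setT (fun v => hcons (a v) (b v)).
Proof.
move=> ma mb.
apply: (measurableT_comp (@measurable_hcons _ R) (g := fun v => (a v, b v : R))).
exact: measurable_fun_pair.
Qed.

(** The law of the state and of the past observations is absolutely continuous
    because a step of the chain is; its density is the filter. *)
Lemma state_obs_dominated : Q `<< (eta \*x leb).
Proof.
apply/null_content_dominatesP => N mN N0.
pose phi h := \int[leb]_x (\1_N (h, x))%:E.
have phi0 h : 0 <= phi h by apply: integral_ge0 => x _; rewrite lee_fin.
have mN' : measurable_fun setT (fun v : H * mR => (\1_N (v.1, v.2))%:E : \bar R).
  by apply: eq_measurable_fun (msec mN) => -[].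
have mphi : measurable_fun setT phi.
  by apply: (@measurable_fun_integral _ _ _ _ _ leb (fun h x => (\1_N (h, x))%:E)).
have phi_null : \int[m]_w phi (obs_past w) = 0.
  transitivity (\int[eta]_h phi h); first by rewrite ge0_integral_distribution.
  rewrite -(tonelli_prod eta leb (F := fun v => (\1_N v)%:E))//; last exact: msec.
  by rewrite integral_indic// setIT.
have mphip : measurable_fun setT (phi \o @obs_past R).
  by apply: measurableT_comp => //; exact: measurable_obs_past.
have mA : measurable_fun setT (fun v : path * mR * mR =>
    (p (at_time 0 v.1.1).1 v.2)%:E * (g v.1.2 v.2)%:E).
  apply: emeasurable_funM.
    apply: measurable_p => //; apply: (measurableT_comp measurable_fst).
    apply: (measurableT_comp (@measurable_at_time R 0)).
    exact: measurableT_comp measurable_fst measurable_fst.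
  apply: measurable_g => //.
  exact: measurableT_comp measurable_snd measurable_fst.
have mNs : measurable_fun setT (fun v : path * mR * mR =>
    (\1_N (hcons (obs_past v.1.1) v.1.2, v.2))%:E : \bar R).
  apply: (measurableT_comp (msec mN) (g := fun v : path * mR * mR =>
    (hcons (obs_past v.1.1) v.1.2, v.2))).
  apply: measurable_fun_pair => //; apply: measurable_hcons2.
    apply: (measurableT_comp (@measurable_obs_past R)).
    exact: measurableT_comp measurable_fst measurable_fst.
  exact: measurableT_comp measurable_snd measurable_fst.
have sec w z : measurable_fun setT (fun x : mR => ((w, z), x) : path * mR * mR).
  exact: measurable_pair1.
pose A (v : path * mR) := \int[leb]_x ((p (at_time 0 v.1).1 x)%:E * (g v.2 x)%:E).
pose B (v : path * mR) := \int[leb]_x ((p (at_time 0 v.1).1 x)%:E * (g v.2 x)%:E *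
  (\1_N (hcons (obs_past v.1) v.2, x))%:E).
have A0 v : 0 <= A v by apply: integral_ge0 => x _; rewrite mule_ge0.
have B0 v : 0 <= B v.
  by apply: integral_ge0 => x _; rewrite !mule_ge0 ?lee_fin.
have mAv : measurable_fun setT A.
  apply: (@measurable_fun_integral _ _ _ _ _ leb (fun (v : path * mR) x =>
    (p (at_time 0 v.1).1 x)%:E * (g v.2 x)%:E)) => //.
  by move=> v x; rewrite mule_ge0.
have mBv : measurable_fun setT B.
  apply: (@measurable_fun_integral _ _ _ _ _ leb (fun (v : path * mR) x =>
    (p (at_time 0 v.1).1 x)%:E * (g v.2 x)%:E *
    (\1_N (hcons (obs_past v.1) v.2, x))%:E)).
    exact: emeasurable_funM.
  by move=> v x; rewrite !mule_ge0 ?lee_fin.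
pose phi1 (v : path * mR) := phi (hcons (obs_past v.1) v.2).
have mphi1 : measurable_fun setT phi1.
  apply: (measurableT_comp mphi); apply: measurable_hcons2 => //.
  exact: (measurableT_comp (@measurable_obs_past R)).
have step1 : \int[m \*x leb]_v (A v * phi1 v) = 0.
  rewrite (tonelli_prod m leb (F := fun v => A v * phi1 v)); last 2 first.
  - exact: emeasurable_funM.
  - by move=> v; rewrite mule_ge0//; exact: phi0.
  have := integral_shift mphip (fun w => phi0 _); rewrite /= phi_null => <-.
  pose F (u : (H * mR) * (mR * mR)) := phi (hcons u.1.1 u.2.1).
  have mF : measurable_fun setT F.
    apply: (measurableT_comp mphi); apply: measurable_hcons2.
      exact: measurableT_comp measurable_fst measurable_fst.
    exact: measurableT_comp measurable_fst measurable_snd.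
  transitivity (\int[m]_w F (state_obs w, ((at_time 1 w).2, (at_time 1 w).1))); last first.
    by apply: eq_integral => w _; rewrite obs_past_shift.
  rewrite (step mF (fun u => phi0 _)); apply: eq_integral => w _.
  apply: eq_integral => z _; rewrite /A -ge0_integralZr//.
  + exact: (measurableT_comp mA (sec w z)).
  + by move=> x _; rewrite mule_ge0.
  + exact: phi0.
have step2 : \int[m \*x leb]_v B v = 0.
  apply: ge0_integral_eq0S step1 => //.
  - exact: emeasurable_funM.
  - by move=> v; rewrite mule_ge0//; exact: phi0.
  move=> [w z] /eqP; rewrite mule_eq0 => /orP[/eqP Az|/eqP phiz].
    move: Az; apply: ge0_integral_eq0S => //.
    + exact: (measurableT_comp mA (sec w z)).
    + by move=> x; rewrite mule_ge0.
    + apply: emeasurable_funM.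
        exact: (measurableT_comp mA (sec w z)).
      exact: (measurableT_comp mNs (sec w z)).
    + by move=> x; rewrite !mule_ge0 ?lee_fin.
    + by move=> x /= ->; rewrite mul0e.
  move: phiz; apply: ge0_integral_eq0S => //.
  + exact: (measurableT_comp mNs (sec w z)).
  + apply: emeasurable_funM.
      exact: (measurableT_comp mA (sec w z)).
    exact: (measurableT_comp mNs (sec w z)).
  + by move=> x; rewrite !mule_ge0 ?lee_fin.
  + by move=> x /= ->; rewrite mule0.
transitivity (\int[Q]_v (\1_N v)%:E); first by rewrite integral_indic// setIT.
rewrite ge0_integral_distribution//; last exact: msec.
rewrite -step2 (tonelli_prod m leb (F := B))//.
pose N1 (v : H * mR) : \bar R := (\1_N v)%:E.
have mNo : measurable_fun setT (N1 \o @state_obs R).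
  by apply: measurableT_comp; [exact: msec|exact: measurable_state_obs].
have N10 w : 0 <= (N1 \o @state_obs R) w by rewrite lee_fin.
rewrite -[LHS](integral_shift mNo N10).
pose F (u : (H * mR) * (mR * mR)) : \bar R := (\1_N (hcons u.1.1 u.2.1, u.2.2))%:E.
have mF : measurable_fun setT F.
  apply: (measurableT_comp (msec mN)); apply: measurable_fun_pair.
    apply: measurable_hcons2.
      exact: measurableT_comp measurable_fst measurable_fst.
    exact: measurableT_comp measurable_fst measurable_snd.
  exact: measurableT_comp measurable_snd measurable_snd.
have F0 u : 0 <= F u by rewrite lee_fin.
rewrite -[RHS](step mF F0).
by apply: eq_integral => w _; rewrite /= state_obs_shift.
Qed.

Definition filter_density (v : H * mR) : \bar R :=
  Radon_Nikodym_SigmaFinite.f Q (eta \*x leb) v.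
Local Notation f := filter_density.

Lemma filter_density_ge0 v : 0 <= f v.
Proof. exact: Radon_Nikodym_SigmaFinite.f_ge0 state_obs_dominated v. Qed.

Lemma filter_density_fin_num v : f v \is a fin_num.
Proof. exact: Radon_Nikodym_SigmaFinite.f_fin_num state_obs_dominated v. Qed.

Lemma measurable_filter_density : measurable_fun setT f.
Proof.
exact: measurable_int (Radon_Nikodym_SigmaFinite.f_integrable state_obs_dominated).
Qed.
Let f0 := filter_density_ge0.
Let mf := measurable_filter_density.

(** The filter is the conditional law of the state given the observations. *)
Lemma integral_filter_density (F : H * mR -> \bar R) :
  measurable_fun setT F -> (forall u, 0 <= F u) ->
  \int[m]_w F (state_obs w) =
  \int[m]_w \int[leb]_x (F (obs_past w, x) * f (obs_past w, x)).
Proof.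
move=> mF F0.
transitivity (\int[Q]_u F u); first by rewrite ge0_integral_distribution.
rewrite -(Radon_Nikodym_SigmaFinite.change_of_variables state_obs_dominated)// -/f.
pose Ff v := F v * f v.
have mFf : measurable_fun setT Ff by exact: emeasurable_funM.
have Ff0 v : 0 <= Ff v by rewrite mule_ge0.
rewrite -[LHS]/(\int[eta \*x leb]_v Ff v) (tonelli_prod eta leb mFf Ff0).
rewrite ge0_integral_distribution//.
  apply: (@measurable_fun_integral _ _ _ _ _ leb (fun h x => Ff (h, x))) => //.
  by apply: eq_measurable_fun mFf => -[].
by move=> h; apply: integral_ge0.
Qed.

Let mfx h : measurable_fun setT (fun x : mR => f (h, x)).
Proof. exact: (measurableT_comp mf (g := pair h)). Qed.

(** The law of the past observations is the marginal of the joint law. *)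
Lemma filter_density_integral1 : \forall w \ae m, \int[leb]_x f (obs_past w, x) = 1.
Proof.
pose k h := \int[leb]_x f (h, x).
have mk : measurable_fun setT k.
  apply: (@measurable_fun_integral _ _ _ _ _ leb (fun h x => f (h, x))) => //.
  by apply: eq_measurable_fun mf => -[].
have k0 h : 0 <= k h by apply: integral_ge0.
have : ae_eq eta setT (cst 1) k.
  apply: integral_ae_eq => //.
    exact: finite_measure_integrable_cst.
  move=> C _ mC; rewrite integral_cst// mul1e.
  transitivity (\int[m]_w (\1_C (obs_past w))%:E).
    transitivity (\int[eta]_h (\1_C h)%:E); first by rewrite integral_indic// setIT.
    by rewrite ge0_integral_distribution//; exact: msec.
  have mC1 : measurable_fun setT (fun v : H * mR => (\1_C v.1)%:E : \bar R).
    by apply: (measurableT_comp (msec mC)).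
  rewrite [LHS](integral_filter_density mC1)//.
  rewrite integral_indicl ge0_integral_distribution//; last 2 first.
  - by apply: emeasurable_funM => //; exact: msec.
  - by move=> h; rewrite mule_ge0 ?lee_fin.
  by apply: eq_integral => w _ /=; rewrite ge0_integralZl//.
move=> [N [mN N0 kN]].
exists (@obs_past R @^-1` N); split => //.
  by rewrite -[X in measurable X]setTI; exact: measurable_obs_past.
move=> w /= kw; apply: kN => /= /(_ I) k1; apply: kw.
exact: esym.
Qed.

Definition predictive (h : H) (x : R) : \bar R :=
  \int[leb]_u (f (h, u) * (p u x)%:E).

Definition unnormalized (h : H) (z x : R) : \bar R :=
  predictive h x * (g z x)%:E.

Definition evidence (h : H) (z : R) : \bar R := \int[leb]_x unnormalized h z x.

Lemma predictive_ge0 h x : 0 <= predictive h x.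
Proof. by apply: integral_ge0 => u _; rewrite mule_ge0. Qed.

Lemma unnormalized_ge0 h z x : 0 <= unnormalized h z x.
Proof. by rewrite mule_ge0// predictive_ge0. Qed.

Lemma evidence_ge0 h z : 0 <= evidence h z.
Proof. by apply: integral_ge0 => x _; exact: unnormalized_ge0. Qed.
Let unn0 := unnormalized_ge0.
Let evi0 := evidence_ge0.

Lemma measurable_predictive :
  measurable_fun setT (fun v : H * mR => predictive v.1 v.2).
Proof.
apply: (@measurable_fun_integral _ _ _ _ _ leb
  (fun (v : H * mR) (u : mR) => f (v.1, u) * (p u v.2)%:E)).
  apply: emeasurable_funM.
    apply: (measurableT_comp mf (g := fun v : H * mR * mR => (v.1.1, v.2))).
    apply: measurable_fun_pair => //.
    exact: measurableT_comp measurable_fst measurable_fst.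
  apply: measurable_p => //.
  exact: measurableT_comp measurable_snd measurable_fst.
by move=> v u; rewrite mule_ge0.
Qed.

Lemma measurable_unnormalized :
  measurable_fun setT (fun v : H * mR * mR => unnormalized v.1.1 v.1.2 v.2).
Proof.
apply: emeasurable_funM.
  apply: (measurableT_comp measurable_predictive
    (g := fun v : H * mR * mR => (v.1.1, v.2))).
  apply: measurable_fun_pair => //.
  exact: measurableT_comp measurable_fst measurable_fst.
apply: measurable_g => //.
exact: measurableT_comp measurable_snd measurable_fst.
Qed.

Lemma measurable_evidence :
  measurable_fun setT (fun v : H * mR => evidence v.1 v.2).
Proof.
apply: (@measurable_fun_integral _ _ _ _ _ leb
  (fun (v : H * mR) (x : mR) => unnormalized v.1 v.2 x)) => //.
exact: measurable_unnormalized.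
Qed.

(** The prediction step: the law of the next observation and state given the
    past observations. *)
Lemma integral_unnormalized (G : H * mR * mR -> \bar R) :
  measurable_fun setT G -> (forall u, 0 <= G u) ->
  \int[m]_w G ((obs_past w, (at_time 1 w).2), (at_time 1 w).1) =
  \int[m]_w \int[leb]_z \int[leb]_x
    (unnormalized (obs_past w) z x * G ((obs_past w, z), x)).
Proof.
move=> mG G0.
pose F (u : (H * mR) * (mR * mR)) := G ((u.1.1, u.2.1), u.2.2).
have mF : measurable_fun setT F.
  apply: (measurableT_comp mG); apply: measurable_fun_pair.
    apply: measurable_fun_pair.
      exact: measurableT_comp measurable_fst measurable_fst.
    exact: measurableT_comp measurable_fst measurable_snd.
  exact: measurableT_comp measurable_snd measurable_snd.
have F0 u : 0 <= F u by exact: G0.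
rewrite -[LHS]/(\int[m]_w F (state_obs w, ((at_time 1 w).2, (at_time 1 w).1))).
rewrite (step mF F0).
pose T4 := (H * mR * mR * mR)%type.
pose K (v : T4) := (p v.1.1.2 v.2)%:E * (g v.1.2 v.2)%:E * G ((v.1.1.1, v.1.2), v.2).
have m111 : measurable_fun setT (fun v : T4 => v.1.1.1).
  apply: (measurableT_comp measurable_fst).
  exact: measurableT_comp measurable_fst measurable_fst.
have m112 : measurable_fun setT (fun v : T4 => v.1.1.2).
  apply: (measurableT_comp measurable_snd).
  exact: measurableT_comp measurable_fst measurable_fst.
have m12 : measurable_fun setT (fun v : T4 => v.1.2).
  exact: measurableT_comp measurable_snd measurable_fst.
have mK : measurable_fun setT K.
  apply: emeasurable_funM.
    apply: emeasurable_funM; first exact: measurable_p.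
    exact: measurable_g.
  apply: (measurableT_comp mG); apply: measurable_fun_pair => //.
  exact: measurable_fun_pair.
have K0 v : 0 <= K v by rewrite !mule_ge0 ?lee_fin.
pose Kx (v : H * mR * mR) := \int[leb]_x K (v, x).
have mKx : measurable_fun setT Kx.
  apply: (@measurable_fun_integral _ _ _ _ _ leb (fun v x => K (v, x))) => //.
have Kx0 v : 0 <= Kx v by apply: integral_ge0.
pose Kzx (v : H * mR) := \int[leb]_z Kx (v, z).
have mKzx : measurable_fun setT Kzx.
  apply: (@measurable_fun_integral _ _ _ _ _ leb (fun v z => Kx (v, z))) => //.
have Kzx0 v : 0 <= Kzx v by apply: integral_ge0.
transitivity (\int[m]_w Kzx (state_obs w)); first by [].
apply: etrans (integral_filter_density mKzx Kzx0) _.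
apply: eq_integral => w _; set h := obs_past w.
transitivity (\int[leb]_u \int[leb]_z (Kx (h, u, z) * f (h, u))).
  apply: eq_integral => u _; rewrite -ge0_integralZr//.
  exact: (measurableT_comp mKx (g := pair (h, u))).
pose K1 (u z : mR) := Kx (h, u, z) * f (h, u).
have mK1 : measurable_fun setT (fun v : mR * mR => K1 v.1 v.2).
  apply: emeasurable_funM.
    apply: (measurableT_comp mKx (g := fun v : mR * mR => ((h, v.1), v.2))).
    by apply: measurable_fun_pair => //; exact: measurable_fun_pair.
  apply: (measurableT_comp mf (g := fun v : mR * mR => (h, v.1))).
  exact: measurable_fun_pair.
have K10 u z : 0 <= K1 u z by rewrite mule_ge0.
rewrite -[LHS]/(\int[leb]_u \int[leb]_z K1 u z) (tonelli leb leb mK1 K10).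
apply: eq_integral => z _.
pose K2 (u x : mR) := K (h, u, z, x) * f (h, u).
have mK2 : measurable_fun setT (fun v : mR * mR => K2 v.1 v.2).
  apply: emeasurable_funM.
    apply: (measurableT_comp mK (g := fun v : mR * mR => ((h, v.1, z), v.2))).
    apply: measurable_fun_pair => //; apply: measurable_fun_pair => //.
    exact: measurable_fun_pair.
  apply: (measurableT_comp mf (g := fun v : mR * mR => (h, v.1))).
  exact: measurable_fun_pair.
transitivity (\int[leb]_u \int[leb]_x (K (h, u, z, x) * f (h, u))).
  apply: eq_integral => u _; rewrite /K1 /Kx -ge0_integralZr//.
  exact: (measurableT_comp mK (g := pair (h, u, z))).
have K20 u x : 0 <= K2 u x by rewrite mule_ge0.
rewrite -[LHS]/(\int[leb]_u \int[leb]_x K2 u x) (tonelli leb leb mK2 K20).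
apply: eq_integral => x _; rewrite /unnormalized /predictive -muleA -ge0_integralZr//.
- by apply: eq_integral => u _; rewrite /K2 /K/= muleC -!muleA.
- by apply: emeasurable_funM => //; exact: measurable_p.
- by move=> u _; rewrite mule_ge0.
- by rewrite mule_ge0.
Qed.

Lemma integral_evidence (G : H * mR -> \bar R) :
  measurable_fun setT G -> (forall u, 0 <= G u) ->
  \int[m]_w G (obs_past w, (at_time 1 w).2) =
  \int[m]_w \int[leb]_z (evidence (obs_past w) z * G (obs_past w, z)).
Proof.
move=> mG G0.
pose F (u : H * mR * mR) := G u.1.
have mF : measurable_fun setT F by exact: measurableT_comp.
have F0 u : 0 <= F u by exact: G0.
have -> := integral_unnormalized mF F0.
apply: eq_integral => w _; apply: eq_integral => z _.
rewrite /evidence -ge0_integralZr//.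
exact: (measurableT_comp measurable_unnormalized (g := pair (obs_past w, z))).
Qed.

(** The evidence is the density of the next observation given the past ones. *)
Lemma evidence_gt0 : \forall w \ae m, 0 < evidence (obs_past w) (at_time 1 w).2.
Proof.
pose E0 := [set v : H * mR | evidence v.1 v.2 = 0].
have mE0 : measurable E0.
  have -> : E0 = setT `&` [set v | evidence v.1 v.2 = 0] by rewrite setTI.
  exact: (measurable_evidence measurableT (emeasurable_set1 0)).
pose G v : \bar R := (\1_E0 v)%:E.
have mG : measurable_fun setT G by exact: msec.
have G0 v : 0 <= G v by rewrite lee_fin.
have mGw : measurable_fun setT (fun w : path => G (obs_past w, (at_time 1 w).2)).
  apply: (measurableT_comp mG); apply: measurable_fun_pair.
    exact: measurable_obs_past.
  exact: (measurableT_comp measurable_snd (@measurable_at_time R 1)).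
have : \int[m]_w G (obs_past w, (at_time 1 w).2) = 0.
  rewrite (integral_evidence mG G0); apply: integral0_eq => w _.
  apply: integral0_eq => z _; rewrite /G indicE.
  by have [/set_mem/= ->|_] := boolP (_ \in E0); rewrite ?mul0e ?mule0.
move=> /(ge0_integral_eq0P _ mGw (fun w => G0 _)); apply: filterS => w.
rewrite /G => -[] /eqP; rewrite indicE pnatr_eq0 eqb0 => /negP wE0.
by rewrite lt0e evi0 andbT; apply/eqP => w0; apply: wE0; exact/mem_set.
Qed.

(** Bayes' rule. The law of the past observations, of the next one and of the
    next state is computed twice, before and after the shift. *)
Lemma bayes : \forall w \ae m, \forall x \ae leb,
  unnormalized (obs_past w) (at_time 1 w).2 x =
  evidence (obs_past w) (at_time 1 w).2 * f (obs_past (Defs.shift w), x).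
Proof.
pose T3 := (H * mR * mR)%type.
pose k1 (v : T3) := unnormalized v.1.1 v.1.2 v.2.
pose k2 (v : T3) := evidence v.1.1 v.1.2 * f (hcons v.1.1 v.1.2, v.2).
have mh3 : measurable_fun setT (fun v : T3 => (hcons v.1.1 v.1.2, v.2)).
  apply: measurable_fun_pair => //; apply: measurable_hcons2.
    exact: measurableT_comp measurable_fst measurable_fst.
  exact: measurableT_comp measurable_snd measurable_fst.
have mk1 : measurable_fun setT k1 by exact: measurable_unnormalized.
have mk2 : measurable_fun setT k2.
  apply: emeasurable_funM.
    exact: (measurableT_comp measurable_evidence measurable_fst).
  exact: (measurableT_comp mf mh3).
have k10 v : 0 <= k1 v by exact: unn0.
have k20 v : 0 <= k2 v by rewrite mule_ge0.
pose L := (eta \*x leb) \*x leb.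
have LE (G : T3 -> \bar R) : measurable_fun setT G -> (forall v, 0 <= G v) ->
    \int[L]_v G v = \int[m]_w \int[leb]_z \int[leb]_x G ((obs_past w, z), x).
  move=> mG G0; rewrite (tonelli_prod (eta \*x leb) leb mG G0).
  pose G1 (v : H * mR) := \int[leb]_x G (v, x).
  have mG1 : measurable_fun setT G1.
    exact: measurable_fun_integral_pair.
  have G10 v : 0 <= G1 v by apply: integral_ge0.
  rewrite (tonelli_prod eta leb mG1 G10).
  rewrite ge0_integral_distribution//; last by move=> h; apply: integral_ge0.
  exact: (measurable_fun_integral_pair leb mG1 G10).
have law1 (G : T3 -> \bar R) : measurable_fun setT G -> (forall v, 0 <= G v) ->
    \int[m]_w G ((obs_past w, (at_time 1 w).2), (at_time 1 w).1) =
    \int[L]_v (k1 v * G v).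
  move=> mG G0; rewrite LE; last 2 first.
  - exact: emeasurable_funM.
  - by move=> v; rewrite mule_ge0.
  by rewrite integral_unnormalized.
have law2 (G : T3 -> \bar R) : measurable_fun setT G -> (forall v, 0 <= G v) ->
    \int[m]_w G ((obs_past w, (at_time 1 w).2), (at_time 1 w).1) =
    \int[L]_v (k2 v * G v).
  move=> mG G0; rewrite LE; last 2 first.
  - exact: emeasurable_funM.
  - by move=> v; rewrite mule_ge0.
  pose G' (v : H * mR) := G ((htail v.1, v.1 0%N), v.2).
  have mG' : measurable_fun setT G'.
    apply: (measurableT_comp mG); apply: measurable_fun_pair => //.
    apply: measurable_fun_pair.
      exact: (measurableT_comp (@measurable_htail _ R) measurable_fst).
    exact: (measurableT_comp (@measurable_history_coord _ R 0%N) measurable_fst).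
  have G'0 v : 0 <= G' v by exact: G0.
  transitivity (\int[m]_w G' (state_obs (Defs.shift w))).
    by apply: eq_integral => w _; rewrite state_obs_shift /G'/= hconsK.
  have mG's : measurable_fun setT (G' \o @state_obs R).
    by apply: measurableT_comp => //; exact: measurable_state_obs.
  transitivity (\int[m]_w G' (state_obs w)).
    exact: (integral_shift mG's (fun=> G'0 _)).
  rewrite (integral_filter_density mG' G'0).
  pose N (h : H) := \int[leb]_x (G' (h, x) * f (h, x)).
  have mN : measurable_fun setT N.
    apply: (@measurable_fun_integral _ _ _ _ _ leb (fun h x => G' (h, x) * f (h, x))).
      by apply: eq_measurable_fun (emeasurable_funM mG' mf) => -[].
    by move=> h x; rewrite mule_ge0.
  have N0 h : 0 <= N h by apply: integral_ge0 => x _; rewrite mule_ge0.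
  rewrite -[LHS]/(\int[m]_w (N \o @obs_past R) w).
  have mNo : measurable_fun setT (N \o @obs_past R).
    by apply: measurableT_comp => //; exact: measurable_obs_past.
  rewrite -(integral_shift mNo (fun=> N0 _)).
  pose N' (v : H * mR) := N (hcons v.1 v.2).
  have mN'' : measurable_fun setT N'.
    by apply: (measurableT_comp mN); exact: measurable_hcons2.
  transitivity (\int[m]_w N' (obs_past w, (at_time 1 w).2)).
    by apply: eq_integral => w _; rewrite /N' /= obs_past_shift.
  rewrite (integral_evidence mN'' (fun=> N0 _)).
  apply: eq_integral => w _; apply: eq_integral => z _.
  rewrite /N' /N /= -ge0_integralZl//.
  - by apply: eq_integral => x _; rewrite /k2 /G' /= hconsK muleA muleAC.
  - apply: emeasurable_funM; last exact: mfx.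
    exact: (measurableT_comp mG' (g := pair (hcons (obs_past w) z))).
  - by move=> x _; rewrite mule_ge0.
have k1k2 : ae_eq L setT k1 k2.
  have LI k A : measurable_fun setT k -> (forall v, 0 <= k v) -> measurable A ->
      \int[L]_(v in A) k v = \int[L]_v (k v * (\1_A v)%:E).
    by move=> mk kz mA; rewrite integral_indicl; apply: eq_integral => v _; rewrite muleC.
  apply: integral_ae_eq => //.
    apply/integrableP; split => //.
    have -> : \int[L]_v `|k1 v| = \int[L]_v (k1 v * cst 1 v).
      by apply: eq_integral => v _; rewrite mule1 gee0_abs.
    rewrite -law1// integral_cst// mul1e.
    by rewrite ltey_eq fin_num_measure.
  move=> A _ mA; rewrite (LI k1)// (LI k2)//.
  have A10 v : 0 <= (\1_A v)%:E :> \bar R by rewrite lee_fin.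
  exact: etrans (esym (law1 _ (msec mA) A10)) (law2 _ (msec mA) A10).
have [N [mN N0 kN]] := k1k2.
pose J (v : H * mR) := \int[leb]_x (\1_N (v, x))%:E.
have mJ : measurable_fun setT J.
  by apply: (measurable_fun_integral_pair leb (msec mN)) => v; rewrite lee_fin.
have J0 v : 0 <= J v by apply: integral_ge0 => x _; rewrite lee_fin.
have mJw : measurable_fun setT (fun w : path => J (obs_past w, (at_time 1 w).2)).
  apply: (measurableT_comp mJ); apply: measurable_fun_pair.
    exact: measurable_obs_past.
  exact: (measurableT_comp measurable_snd (@measurable_at_time R 1)).
have Jz : \int[m]_w J (obs_past w, (at_time 1 w).2) = 0.
  pose G (v : T3) := J v.1.
  have mG : measurable_fun setT G by exact: measurableT_comp.
  have G0 v : 0 <= G v by exact: J0.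
  rewrite -[LHS]/(\int[m]_w G ((obs_past w, (at_time 1 w).2), (at_time 1 w).1)).
  rewrite (law1 G mG G0).
  have mN1 := msec mN.
  rewrite (tonelli_prod (eta \*x leb) leb (F := fun v => k1 v * G v)); last 2 first.
  - exact: emeasurable_funM.
  - by move=> v; rewrite mule_ge0.
  have J00 : \int[eta \*x leb]_v J v = 0.
    rewrite -(tonelli_prod (eta \*x leb) leb (F := fun v => (\1_N v)%:E))//.
    by rewrite integral_indic// setIT.
  move: J00; apply: ge0_integral_eq0S => //.
  - apply: (@measurable_fun_integral _ _ _ _ _ leb (fun v x => k1 (v, x) * G (v, x))).
      by apply: eq_measurable_fun (emeasurable_funM mk1 mG) => -[].
    by move=> v x; rewrite mule_ge0.
  - by move=> v; apply: integral_ge0 => x _; rewrite mule_ge0.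
  - by move=> v Jv; apply: integral0_eq => x _; rewrite /G /= Jv mule0.
have /(ge0_integral_eq0P _ mJw (fun w => J0 _)) := Jz.
apply: filterS => w Jw.
have mNw : measurable_fun setT (fun x : mR =>
    (\1_N ((obs_past w, (at_time 1 w).2), x))%:E : \bar R).
  exact: (measurableT_comp (msec mN) (g := pair (obs_past w, (at_time 1 w).2))).
have : \forall x \ae leb, (\1_N ((obs_past w, (at_time 1 w).2), x))%:E = 0 :> \bar R.
  by apply/(ge0_integral_eq0P _ mNw) => // x; rewrite lee_fin.
apply: filterS => x [] /eqP; rewrite indicE pnatr_eq0 eqb0 => /negP xN.
apply: contrapT => neq; apply: xN; apply/mem_set; apply: kN => /= /(_ I).
by rewrite /k1 /k2 /= obs_past_shift in neq *.
Qed.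

End hmm.

(** * Backward weights and the cost of a merging *)

Section backward.
Local Open Scope ereal_scope.
Context (R : realType).
Notation leb := (@lebesgue_measure R).
Notation mR := (measurableTypeR R).
Notation path := (path_space R).
Notation H := (history R).
Variables (m : probability (path_space R) R) (p g : R -> R -> R).
Hypothesis mp : measurable_fun setT (fun u : R * R => p u.1 u.2).
Hypothesis p0 : forall x y, (0 <= p x y)%R.
Hypothesis mg : measurable_fun setT (fun u : R * R => g u.1 u.2).
Hypothesis g0 : forall z x, (0 <= g z x)%R.
Hypothesis m_inv : forall A, measurable A -> m (@Defs.shift R @^-1` A) = m A.
Hypothesis m_step : hidden_markov m p g.

Let pe0 x y : 0 <= (p x y)%:E. Proof. by rewrite lee_fin. Qed.
Let ge0 z x : 0 <= (g z x)%:E. Proof. by rewrite lee_fin. Qed.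
Let mpe := measurable_EFin2 mp.
Let mge := measurable_EFin2 mg.

(** Likelihood of the [k] latest observations for a state [x] at time [- k]. *)
Fixpoint backward_weight (k : nat) (x : R) (h : H) : \bar R :=
  if k is j.+1
  then \int[leb]_y ((p x y)%:E * (g (h j) y)%:E * backward_weight j y h)
  else 1.
Local Notation bw := backward_weight.

Lemma backward_weight_ge0 k x h : 0 <= bw k x h.
Proof.
elim: k x => [|k IHk] x //=.
by apply: integral_ge0 => y _; rewrite !mule_ge0.
Qed.
Let bw0 := backward_weight_ge0.

Let mcoord n d (T : measurableType d) (b : T -> H) :
  measurable_fun setT b -> measurable_fun setT (fun v => b v n : mR).
Proof. by move=> mb; exact: (measurableT_comp (@measurable_history_coord _ R n)). Qed.

Lemma measurable_backward_weight k d (T : measurableType d) (a : T -> mR) (b : T -> H) :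
  measurable_fun setT a -> measurable_fun setT b ->
  measurable_fun setT (fun v => bw k (a v) (b v)).
Proof.
elim: k d T a b => [|k IHk] d T a b ma mb; first exact: measurable_cst.
apply: (@measurable_fun_integral _ _ _ _ _ leb (fun v y =>
  (p (a v) y)%:E * (g (b v k) y)%:E * bw k y (b v))).
  have ma1 : measurable_fun setT (fun u : T * mR => a u.1) by exact: measurableT_comp.
  have mb1 : measurable_fun setT (fun u : T * mR => b u.1) by exact: measurableT_comp.
  apply: emeasurable_funM; last exact: IHk.
  apply: emeasurable_funM; first exact: mpe.
  by apply: mge => //; exact: (mcoord k mb1).
by move=> v y; rewrite !mule_ge0.
Qed.
Let mbw := measurable_backward_weight.

(** The probabilities of the future observations are integrals of this kind,
    which makes pointwise bounds on their densities available. *)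
Fixpoint obs_integral (k : nat) (Phi : H -> \bar R) (h : H) : \bar R :=
  if k is j.+1 then \int[leb]_z obs_integral j Phi (hcons h z) else Phi h.
Local Notation Ik := obs_integral.

Lemma obs_integral_ge0 k Phi h : (forall h', 0 <= Phi h') -> 0 <= Ik k Phi h.
Proof.
by move=> Phi0; elim: k h => [|k IHk] h //=; apply: integral_ge0.
Qed.

Lemma measurable_obs_integral k d (T : measurableType d) (Phi : T -> H -> \bar R) :
  measurable_fun setT (fun v : T * H => Phi v.1 v.2) ->
  (forall t h, 0 <= Phi t h) ->
  measurable_fun setT (fun v : T * H => Ik k (Phi v.1) v.2).
Proof.
move=> mPhi Phi0; elim: k => [|k IHk] //=.
apply: (@measurable_fun_integral _ _ _ _ _ leb (fun (v : T * H) (z : mR) =>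
  Ik k (Phi v.1) (hcons v.2 z))).
  apply: (measurableT_comp IHk (g := fun u : T * H * mR => (u.1.1, hcons u.1.2 u.2))).
  apply: measurable_fun_pair; first exact: measurableT_comp measurable_fst measurable_fst.
  apply: measurable_hcons2 => //.
  exact: measurableT_comp measurable_snd measurable_fst.
by move=> v z; exact: obs_integral_ge0.
Qed.

Let mIk k Phi : measurable_fun setT Phi -> (forall h, 0 <= Phi h) ->
  measurable_fun setT (Ik k Phi).
Proof.
move=> mPhi Phi0.
have := @measurable_obs_integral k _ mR (fun=> Phi)
  (measurableT_comp mPhi measurable_snd) (fun=> Phi0).
move=> /(fun M => measurableT_comp M (measurable_pair1 (0%R : mR))); exact.
Qed.

Let mIkc k Phi h : measurable_fun setT Phi -> (forall h, 0 <= Phi h) ->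
  measurable_fun setT (fun z : mR => Ik k Phi (hcons h z)).
Proof.
move=> mPhi Phi0; apply: (measurableT_comp (mIk k mPhi Phi0)).
by apply: measurable_hcons2 => //; exact: measurable_cst.
Qed.

Lemma le_obs_integral k (Phi Psi : H -> \bar R) (h : H) :
  measurable_fun setT Phi -> (forall h : H, 0 <= Phi h) ->
  measurable_fun setT Psi -> (forall h : H, 0 <= Psi h) ->
  (forall h' : H, Phi h' <= Psi h') ->
  Ik k Phi h <= Ik k Psi h.
Proof.
move=> mPhi Phi0 mPsi Psi0 PhiPsi; elim: k h => [|k IHk] h //=.
apply: ge0_le_integral => //.
- by move=> z _; exact: obs_integral_ge0.
- exact: mIkc.
- exact: mIkc.
Qed.

(** Stated for the extensions of [h], because the merging set is read off the
    entries that they inherit from [h]. *)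
Lemma eq_obs_integral k (Phi Psi : H -> \bar R) (h : H) :
  (forall h' : H, (forall j, h' (k + j)%N = h j) -> Phi h' = Psi h') ->
  Ik k Phi h = Ik k Psi h.
Proof.
elim: k h => [|k IHk] h PhiPsi /=; first exact: PhiPsi.
apply: eq_integral => z _; apply: IHk => h' h'E; apply: PhiPsi => j.
by rewrite addSnnS h'E.
Qed.

Lemma obs_integralZl k (c : \bar R) (Phi : H -> \bar R) (h : H) : 0 <= c ->
  measurable_fun setT Phi -> (forall h : H, 0 <= Phi h) ->
  Ik k (fun h' : H => c * Phi h') h = c * Ik k Phi h.
Proof.
move=> c0 mPhi Phi0; elim: k h => [|k IHk] h //=.
rewrite -ge0_integralZl//; first by apply: eq_integral => z _; exact: IHk.
  exact: mIkc.
by move=> z _; exact: obs_integral_ge0.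
Qed.

Lemma obs_integral_tonelli k (Phi : mR -> H -> \bar R) (h : H) :
  measurable_fun setT (fun v : mR * H => Phi v.1 v.2) ->
  (forall (y : mR) (h : H), 0 <= Phi y h) ->
  \int[leb]_y Ik k (Phi y) h = Ik k (fun h' : H => \int[leb]_y Phi y h') h.
Proof.
move=> mPhi Phi0; elim: k h => [|k IHk] h //=.
rewrite (tonelli leb leb (f := fun y z => Ik k (Phi y) (hcons h z)))//.
- by apply: eq_integral => z _; exact: IHk.
- apply: (measurableT_comp (measurable_obs_integral k mPhi Phi0)
    (g := fun u : mR * mR => (u.1, hcons h u.2))).
  apply: measurable_fun_pair => //.
  by apply: measurable_hcons2 => //; exact: measurable_cst.
- by move=> y z; exact: obs_integral_ge0.
Qed.

(** Conditional expectation of [chi] of the observations, [k] steps after the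
    state [x] and the observations [h]. *)
Fixpoint forward_mean (k : nat) (chi : H -> \bar R) (x : R) (h : H) : \bar R :=
  if k is j.+1
  then \int[leb]_z \int[leb]_y
    ((p x y)%:E * (g z y)%:E * forward_mean j chi y (hcons h z))
  else chi h.
Local Notation Qk := forward_mean.

Lemma forward_mean_ge0 k (chi : H -> \bar R) (x : R) (h : H) :
  (forall h' : H, 0 <= chi h') -> 0 <= Qk k chi x h.
Proof.
move=> chi0; elim: k x h => [|k IHk] x h //=.
apply: integral_ge0 => z _; apply: integral_ge0 => y _.
by rewrite !mule_ge0.
Qed.

(** Integrating out the intermediate states before the observations produces the
    backward weight. *)
Lemma forward_meanE k (chi : H -> \bar R) (x : R) (h : H) :
  measurable_fun setT chi -> (forall h : H, 0 <= chi h) ->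
  Qk k chi x h = Ik k (fun h' : H => bw k x h' * chi h') h.
Proof.
move=> mchi chi0; elim: k x h => [|k IHk] x h /=; first by rewrite mul1e.
apply: eq_integral => z _.
pose Phi (y : mR) (h' : H) := (p x y)%:E * (g z y)%:E * (bw k y h' * chi h').
have mPhi : measurable_fun setT (fun v : mR * H => Phi v.1 v.2).
  apply: emeasurable_funM.
    by apply: emeasurable_funM; [exact: mpe|exact: mge].
  by apply: emeasurable_funM; [exact: mbw|exact: measurableT_comp].
have Phi0 y h' : 0 <= Phi y h' by rewrite !mule_ge0.
transitivity (\int[leb]_y Ik k (Phi y) (hcons h z)).
  apply: eq_integral => y _; rewrite IHk obs_integralZl//.
  - by rewrite mule_ge0.
  - by apply: emeasurable_funM => //; apply: mbw => //; exact: measurable_cst.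
  - by move=> h'; rewrite mule_ge0.
rewrite obs_integral_tonelli//; apply: eq_obs_integral => h' h'E.
have -> : h' k = z by have := h'E 0%N; rewrite addn0.
rewrite -ge0_integralZr//.
- by apply: eq_integral => y _; rewrite /Phi muleA.
- apply: emeasurable_funM.
    by apply: emeasurable_funM; [exact: mpe|exact: mge].
  by apply: mbw => //; exact: measurable_cst.
- by move=> y _; rewrite !mule_ge0.
Qed.

Lemma measurable_forward_mean k (chi : H -> \bar R) d (T : measurableType d)
    (a : T -> mR) (b : T -> H) :
  measurable_fun setT chi -> (forall h : H, 0 <= chi h) ->
  measurable_fun setT a -> measurable_fun setT b ->
  measurable_fun setT (fun v => Qk k chi (a v) (b v)).
Proof.
move=> mchi chi0 ma mb.
have -> : (fun v => Qk k chi (a v) (b v)) =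
    (fun v => Ik k (fun h' => bw k (a v) h' * chi h') (b v)).
  by apply/funext => v; rewrite forward_meanE.
apply: (measurableT_comp (measurable_obs_integral k
   (Phi := fun (x : mR) h' => bw k x h' * chi h') _ _) (g := fun v => (a v, b v))).
- by apply: emeasurable_funM; [exact: mbw|exact: measurableT_comp].
- by move=> x h'; rewrite mule_ge0.
- exact: measurable_fun_pair.
Qed.

(** The Markov property, [k] steps ahead. *)
Lemma integral_forward_mean k (alpha : history (R * R)%type -> \bar R)
    (chi : H -> \bar R) :
  measurable_fun setT alpha -> (forall u, 0 <= alpha u) ->
  measurable_fun setT chi -> (forall h : H, 0 <= chi h) ->
  \int[m]_w (alpha (past w) * chi (obs_past (shiftn k%:Z w))) =
  \int[m]_w (alpha (past w) * Qk k chi (at_time 0 w).1 (obs_past w)).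
Proof.
move=> malpha alpha0 mchi chi0.
have mop := @measurable_obs_past R.
have mx0 : measurable_fun setT (fun w : path => (at_time 0 w).1 : mR).
  exact: (measurableT_comp measurable_fst (@measurable_at_time R 0)).
elim: k alpha malpha alpha0 => [|k IHk] alpha malpha alpha0.
  by apply: eq_integral => w _; rewrite shiftn0.
pose beta (u : history (R * R)%type) := alpha (htail u).
have mbeta : measurable_fun setT beta.
  exact: (measurableT_comp malpha (@measurable_htail _ _)).
pose F1 (w : path) := beta (past w) * chi (obs_past (shiftn k%:Z w)).
have mF1 : measurable_fun setT F1.
  apply: emeasurable_funM; first exact: (measurableT_comp mbeta (@measurable_past R)).
  apply: (measurableT_comp mchi); apply: (measurableT_comp mop).
  exact: measurable_shiftn.
have F10 w : 0 <= F1 w by rewrite mule_ge0//; exact: alpha0.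
transitivity (\int[m]_w F1 (Defs.shift w)).
  apply: eq_integral => w _; rewrite /F1 past_shift /beta hconsK.
  congr (_ * chi (obs_past _)); apply/funext => n.
  by rewrite /shiftn /Defs.shift -addn1 PoszD addrA.
rewrite (integral_shift m_inv mF1 F10) [LHS]IHk//; last by move=> u; exact: alpha0.
pose F2 (w : path) := beta (past w) * Qk k chi (at_time 0 w).1 (obs_past w).
have mF2 : measurable_fun setT F2.
  apply: emeasurable_funM; first exact: (measurableT_comp mbeta (@measurable_past R)).
  exact: measurable_forward_mean.
have F20 w : 0 <= F2 w.
  by rewrite mule_ge0//; [exact: alpha0|exact: forward_mean_ge0].
rewrite -[LHS](integral_shift m_inv mF2 F20).
pose F (u : history (R * R)%type * (R * R)) :=
  alpha u.1 * Qk k chi u.2.1 (hcons (obs_history u.1) u.2.2).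
have mF : measurable_fun setT F.
  apply: emeasurable_funM; first exact: measurableT_comp.
  apply: measurable_forward_mean => //.
    exact: (measurableT_comp measurable_fst measurable_snd).
  apply: measurable_hcons2.
    exact: (measurableT_comp (@measurable_obs_history R) measurable_fst).
  exact: (measurableT_comp measurable_snd measurable_snd).
have F0 u : 0 <= F u by rewrite mule_ge0//; exact: forward_mean_ge0.
transitivity (\int[m]_w F (past w, at_time 1 w)).
  apply: eq_integral => w _; rewrite /F2 past_shift /beta hconsK obs_past_shift.
  by [].
rewrite (m_step mF F0); apply: eq_integral => w _ /=.
set h := obs_past w; set x0 := (at_time 0 w).1.
pose K (z y : mR) := (p x0 y)%:E * (g z y)%:E * Qk k chi y (hcons h z).
have mK : measurable_fun setT (fun u : mR * mR => K u.1 u.2).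
  apply: emeasurable_funM.
    by apply: emeasurable_funM; [exact: mpe|exact: mge].
  apply: measurable_forward_mean => //.
  by apply: measurable_hcons2 => //; exact: measurable_cst.
have K0 z y : 0 <= K z y.
  by rewrite mule_ge0 ?mule_ge0//; exact: forward_mean_ge0.
rewrite -[RHS]/(alpha (past w) * \int[leb]_z \int[leb]_y K z y).
have swapK := tonelli leb leb mK K0.
rewrite [X in alpha (past w) * X]swapK.
pose Kz (y : mR) := \int[leb]_z K z y.
have mKyz : measurable_fun setT (fun u : mR * mR => K u.2 u.1).
  exact: (measurableT_comp mK (g :=
      fun u : mR * mR => (u.2, u.1)) (measurable_fun_pair measurable_snd measurable_fst)).
have mKz : measurable_fun setT Kz.
  apply: (@measurable_fun_integral _ _ _ _ _ leb (fun y z : mR => K z y)) => //.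
have Kz0 y : 0 <= Kz y by exact: integral_ge0.
rewrite -[RHS]/(alpha (past w) * \int[leb]_y Kz y).
rewrite -(ge0_integralZl _ measurableT mKz (fun y _ => Kz0 y) (alpha0 _)).
apply: eq_integral => y _.
have mKy : measurable_fun setT (fun z : mR => K z y).
  exact: (measurableT_comp mKyz (g := pair y)).
rewrite -(ge0_integralZl _ measurableT mKy (fun z _ => K0 z y) (alpha0 _)).
apply: eq_integral => z _; rewrite /F /K /= EFinM.
by rewrite muleCA.
Qed.

Variables (B l : R) (W : set (mR * mR)).
Hypothesis B0 : (0 <= B)%R.
Hypothesis pB : forall x y, (p x y <= B)%R.
Hypothesis p1 : forall x, \int[leb]_y (p x y)%:E <= 1.
Hypothesis g1 : forall x, \int[leb]_z (g z x)%:E <= 1.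
Hypothesis gl : \int[leb]_x \int[leb]_z (g z x)%:E <= l%:E.
Hypothesis mW : measurable W.

Let W1 (z y : R) : \bar R := (\1_W (z, y))%:E.
Let W10 z y : 0 <= W1 z y. Proof. by rewrite lee_fin. Qed.
Let mW1 d (T : measurableType d) (a b : T -> mR) :
  measurable_fun setT a -> measurable_fun setT b ->
  measurable_fun setT (fun v => W1 (a v) (b v)).
Proof.
move=> ma mb; apply/measurable_EFinP.
apply: (measurableT_comp (measurable_indic (D := setT) mW) (g := fun v => (a v, b v))).
exact: measurable_fun_pair.
Qed.

(** Likelihood of the last [k + 1] observations for a state at time [- k] drawn
    from the Lebesgue measure. *)
Definition total_weight (k : nat) (h : H) : \bar R :=
  \int[leb]_y ((g (h k) y)%:E * bw k y h).

(** The part of the total weight of the states [y] that all the states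
    compatible with the observation at time [- k.+1] reach. *)
Definition merging_weight (k : nat) (h : H) : \bar R :=
  \int[leb]_y (W1 (h k.+1) y * ((g (h k) y)%:E * bw k y h)).
Local Notation U := merging_weight.
Local Notation V := total_weight.

Lemma total_weight_ge0 k h : 0 <= V k h.
Proof. by apply: integral_ge0 => y _; rewrite mule_ge0. Qed.

Lemma merging_weight_ge0 k h : 0 <= U k h.
Proof. by apply: integral_ge0 => y _; rewrite !mule_ge0. Qed.
Let V0 := total_weight_ge0.
Let U0 := merging_weight_ge0.

Let mgbw k d (T : measurableType d) (a : T -> mR) (b : T -> H) :
  measurable_fun setT a -> measurable_fun setT b ->
  measurable_fun setT (fun v => (g (b v k) (a v))%:E * bw k (a v) (b v)).
Proof.
move=> ma mb; apply: emeasurable_funM; last exact: mbw.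
exact: (mge (mcoord k mb) ma).
Qed.

Lemma measurable_total_weight k : measurable_fun setT (V k).
Proof.
apply: (@measurable_fun_integral _ _ _ _ _ leb (fun (h : H) (y : mR) =>
  (g (h k) y)%:E * bw k y h)).
  by apply: mgbw.
by move=> h y; rewrite mule_ge0.
Qed.

Lemma measurable_merging_weight k : measurable_fun setT (U k).
Proof.
apply: (@measurable_fun_integral _ _ _ _ _ leb (fun (h : H) (y : mR) =>
  W1 (h k.+1) y * ((g (h k) y)%:E * bw k y h))).
  apply: emeasurable_funM; last exact: mgbw.
  by apply: mW1 => //; exact: (mcoord k.+1 measurable_fst).
by move=> h y; rewrite !mule_ge0.
Qed.

Lemma backward_weight_le k x h : bw k.+1 x h <= B%:E * V k h.
Proof.
rewrite /= /V -ge0_integralZl//; last 2 first.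
- by apply: mgbw => //; exact: measurable_cst.
- by move=> y _; rewrite mule_ge0.
apply: ge0_le_integral => //.
- by move=> y _; rewrite !mule_ge0.
- apply: emeasurable_funM; last by apply: mbw => //; exact: measurable_cst.
  by apply: emeasurable_funM; [exact: mpe|exact: mge].
- apply: emeasurable_funM => //.
  by apply: mgbw => //; exact: measurable_cst.
- by move=> y _; rewrite -muleA lee_pmul ?mule_ge0 ?lee_fin.
Qed.

Lemma forward_mean_le1 k (x : R) (h : H) : Qk k (cst 1) x h <= 1.
Proof.
elim: k x h => [|k IHk] x h //=.
have mpg (a : mR) : measurable_fun setT (fun u : mR * mR => (p a u.2)%:E * (g u.1 u.2)%:E).
  by apply: emeasurable_funM; [exact: mpe|exact: mge].
have mc : measurable_fun setT (cst 1 : H -> \bar R) by exact: measurable_cst.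
have c0 (h' : H) : 0 <= cst 1 h' :> \bar R by rewrite lee_fin.
have mpgQ : measurable_fun setT (fun u : mR * mR =>
    (p x u.2)%:E * (g u.1 u.2)%:E * Qk k (cst 1) u.2 (hcons h u.1)).
  apply: emeasurable_funM; first exact: mpg.
  apply: (measurable_forward_mean k mc c0) => //.
  by apply: measurable_hcons2 => //; exact: measurable_cst.
have Q0 y (h' : H) : 0 <= Qk k (cst 1) y h' by apply: forward_mean_ge0.
apply: (@le_trans _ _ (\int[leb]_z \int[leb]_y ((p x y)%:E * (g z y)%:E))).
  apply: ge0_le_integral => //.
  - by move=> z _; apply: integral_ge0 => y _; rewrite !mule_ge0.
  - apply: (@measurable_fun_integral _ _ _ _ _ leb (fun z y : mR =>
      (p x y)%:E * (g z y)%:E * Qk k (cst 1) y (hcons h z))) => //.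
    by move=> z y; rewrite !mule_ge0.
  - apply: (@measurable_fun_integral _ _ _ _ _ leb (fun z y : mR =>
      (p x y)%:E * (g z y)%:E)) => //.
    by move=> z y; rewrite !mule_ge0.
  - move=> z _; apply: ge0_le_integral => //.
    + by move=> y _; rewrite !mule_ge0.
    + exact: (measurableT_comp mpgQ (g := pair z)).
    + exact: (measurableT_comp (mpg x) (g := pair z)).
    + move=> y _; rewrite -[leRHS]mule1; apply: lee_pmul => //.
      by rewrite mule_ge0.
pose K (z y : mR) := (p x y)%:E * (g z y)%:E.
have K0 z y : 0 <= K z y by rewrite mule_ge0.
rewrite -[leLHS]/(\int[leb]_z \int[leb]_y K z y) (tonelli leb leb (mpg x) K0).
apply: le_trans (p1 x); apply: ge0_le_integral => //.
- by move=> y _; apply: integral_ge0.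
- apply: (@measurable_fun_integral _ _ _ _ _ leb (fun y z : mR => K z y)) => //.
  by apply: emeasurable_funM; [exact: mpe|exact: mge].
- exact: mpe.
- move=> y _; rewrite /K ge0_integralZl//; last exact: mge.
  by rewrite -[leRHS]mule1 lee_pmul// integral_ge0.
Qed.

Lemma integral_mul_forward_mean k (chi : H -> \bar R) (r : mR -> \bar R) (h : H) :
  measurable_fun setT chi -> (forall h : H, 0 <= chi h) ->
  measurable_fun setT r -> (forall y, 0 <= r y) ->
  \int[leb]_y (r y * Qk k chi y h) =
  Ik k (fun h' : H => \int[leb]_y (r y * (bw k y h' * chi h'))) h.
Proof.
move=> mchi chi0 mr r0.
pose Phi (y : mR) (h' : H) := r y * (bw k y h' * chi h').
have mPhi : measurable_fun setT (fun v : mR * H => Phi v.1 v.2).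
  apply: emeasurable_funM; first exact: measurableT_comp.
  by apply: emeasurable_funM; [exact: mbw|exact: measurableT_comp].
have Phi0 y h' : 0 <= Phi y h' by rewrite !mule_ge0.
rewrite -(obs_integral_tonelli k h mPhi Phi0); apply: eq_integral => y _.
rewrite forward_meanE// obs_integralZl//.
- by apply: emeasurable_funM => //; apply: mbw => //; exact: measurable_cst.
- by move=> h'; rewrite mule_ge0.
Qed.

Definition weak_merging (delta : R) (k : nat) : set H :=
  [set h : H | U k h < delta%:E * V k h].

Lemma measurable_weak_merging delta k : measurable (weak_merging delta k).
Proof.
have -> : weak_merging delta k = setT `&` weak_merging delta k by rewrite setTI.
apply: emeasurable_fun_lt => //; first exact: measurable_merging_weight.
apply: emeasurable_funM; first exact: measurable_cst.
exact: measurable_total_weight.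
Qed.

(** The bound of [bad_merging_le] given the past and the observation [z] that
    comes with the merging. *)
Lemma weak_merging_forward (delta : R) k (h : H) (z : R) : (0 <= delta)%R ->
  \int[leb]_y ((g z y)%:E * W1 (h 0%N) y *
    Qk k (fun h' : H => (\1_(weak_merging delta k) h')%:E) y (hcons h z)) <=
  delta%:E * \int[leb]_y (g z y)%:E.
Proof.
move=> delta0.
pose chi (h' : H) : \bar R := (\1_(weak_merging delta k) h')%:E.
have mchi : measurable_fun setT chi.
  by apply/measurable_EFinP; apply: measurable_indic; exact: measurable_weak_merging.
have chi0 h' : 0 <= chi h' by rewrite lee_fin.
have mV := measurable_total_weight k.
have mU := measurable_merging_weight k.
have mgz : measurable_fun setT (fun y : mR => (g z y)%:E).
  by apply: mge => //; exact: measurable_cst.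
have mgW : measurable_fun setT (fun y : mR => (g z y)%:E * W1 (h 0%N) y).
  by apply: emeasurable_funM => //; apply: mW1 => //; exact: measurable_cst.
have mc : measurable_fun setT (cst 1 : H -> \bar R) by exact: measurable_cst.
have c0 (h' : H) : 0 <= cst 1 h' :> \bar R by rewrite lee_fin.
have gW0 y : 0 <= (g z y)%:E * W1 (h 0%N) y by rewrite mule_ge0.
rewrite (integral_mul_forward_mean k (hcons h z) mchi chi0 mgW gW0).
have h'k (h' : H) : (forall j, h' (k + j)%N = hcons h z j) -> h' k = z.
  by move=> /(_ 0%N); rewrite addn0.
apply: (@le_trans _ _ (Ik k (fun h' : H => delta%:E * V k h') (hcons h z))).
  rewrite (_ : Ik k _ _ = Ik k (fun h' : H => U k h' * chi h') (hcons h z)).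
    apply: le_obs_integral => //.
    - exact: emeasurable_funM.
    - by move=> h'; rewrite mule_ge0.
    - by apply: emeasurable_funM => //; exact: measurable_cst.
    - by move=> h'; rewrite mule_ge0 ?lee_fin.
    - move=> h'; rewrite /chi indicE.
      have [/set_mem/ltW|_] := boolP (_ \in _); first by rewrite mule1.
      by rewrite mule0 mule_ge0 ?lee_fin.
  apply: eq_obs_integral => h' h'E.
  have <- := h'k _ h'E.
  have <- : h' k.+1 = h 0%N by have := h'E 1%N; rewrite addn1.
  rewrite /U -ge0_integralZr//.
  - by apply: eq_integral => y _; rewrite [W1 _ _ * _]muleCA !muleA.
  - apply: emeasurable_funM; last by apply: mgbw => //; exact: measurable_cst.
    by apply: mW1 => //; exact: measurable_cst.
  - by move=> y _; rewrite !mule_ge0.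
rewrite obs_integralZl ?lee_fin//; apply: lee_wpmul2l; first by rewrite lee_fin.
rewrite (_ : Ik k _ _ = \int[leb]_y ((g z y)%:E * Qk k (cst 1) y (hcons h z))).
  apply: ge0_le_integral => //.
  - by move=> y _; rewrite mule_ge0 ?forward_mean_ge0.
  - by apply: emeasurable_funM => //; exact: measurable_forward_mean.
  - move=> y _; rewrite -[leRHS]mule1; apply: lee_wpmul2l => //.
    exact: forward_mean_le1.
rewrite (integral_mul_forward_mean k (hcons h z) mc c0 mgz (fun y => ge0 z y)).
apply: eq_obs_integral => h' h'E.
have <- := h'k _ h'E.
by apply: eq_integral => y _; rewrite /cst/= mule1.
Qed.

(** It is unlikely that a merging takes place and has small weight: given the
    past up to the merging, the density of the later observations is at most [B]
    times the merging weight, hence [B * delta] times the total weight, and the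
    total weight integrates to the mass [l] of the state space. *)
Lemma bad_merging_le k (delta : R) : (0 <= delta)%R ->
  \int[m]_w (W1 (obs_past w k.+1) (at_time (- k%:Z) w).1 *
    (\1_(weak_merging delta k) (obs_past w))%:E) <=
  (B * delta * l)%:E.
Proof.
move=> delta0; set C := weak_merging delta k.
have mC : measurable C by exact: measurable_weak_merging.
pose chi (h : H) : \bar R := (\1_C h)%:E.
have mchi : measurable_fun setT chi by exact/measurable_EFinP.
have chi0 h : 0 <= chi h by rewrite lee_fin.
have mop := @measurable_obs_past R.
have mQ := measurable_forward_mean k mchi chi0.
have Q0 x h : 0 <= Qk k chi x h by exact: forward_mean_ge0.
pose alpha (kap : history (R * R)%type) := W1 (kap 1%N).2 (kap 0%N).1.
have malpha : measurable_fun setT alpha.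
  apply: mW1.
    exact: (measurableT_comp measurable_snd (@measurable_history_coord _ _ 1%N)).
  exact: (measurableT_comp measurable_fst (@measurable_history_coord _ _ 0%N)).
pose F0 (w : path) := W1 (obs_past w k.+1) (at_time (- k%:Z) w).1 * chi (obs_past w).
have mF0 : measurable_fun setT F0.
  apply: emeasurable_funM; last exact: (measurableT_comp mchi mop).
  apply: mW1; first exact: mcoord.
  exact: (measurableT_comp measurable_fst (@measurable_at_time R _)).
have F00 w : 0 <= F0 w by rewrite mule_ge0.
(* the shift moves the merging to the times [-1] and [0] *)
rewrite -[leLHS](integral_shiftn m_inv k%:Z mF0 F00).
have -> : \int[m]_w F0 (shiftn k%:Z w) =
    \int[m]_w (alpha (past w) * chi (obs_past (shiftn k%:Z w))).
  apply: eq_integral => w _; rewrite /F0 /alpha; congr (W1 _ _ * _).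
    rewrite /obs_past /past /shiftn /=; congr (w _).2.
    by rewrite -addn1 PoszD opprD addrAC addNr add0r.
  by rewrite /at_time /past /shiftn /=; congr (w _).1; rewrite addNr oppr0.
rewrite (integral_forward_mean k malpha (fun u => W10 _ _) mchi chi0).
pose F1 (w : path) := alpha (past w) * Qk k chi (at_time 0 w).1 (obs_past w).
have mF1 : measurable_fun setT F1.
  apply: emeasurable_funM; first exact: (measurableT_comp malpha (@measurable_past R)).
  apply: mQ => //.
  exact: (measurableT_comp measurable_fst (@measurable_at_time R 0)).
have F10 w : 0 <= F1 w by rewrite mule_ge0//; exact: W10.
(* one more shift: the state of the merging is now integrated against [p] *)
rewrite -[leLHS](integral_shift m_inv mF1 F10).
pose F (u : (H * mR) * (mR * mR)) :=
  W1 (u.1.1 0%N) u.2.2 * Qk k chi u.2.2 (hcons u.1.1 u.2.1).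
have m11 : measurable_fun setT (fun u : (H * mR) * (mR * mR) => u.1.1).
  exact: measurableT_comp measurable_fst measurable_fst.
have m21 : measurable_fun setT (fun u : (H * mR) * (mR * mR) => u.2.1).
  exact: measurableT_comp measurable_fst measurable_snd.
have m22 : measurable_fun setT (fun u : (H * mR) * (mR * mR) => u.2.2).
  exact: measurableT_comp measurable_snd measurable_snd.
have mF : measurable_fun setT F.
  apply: emeasurable_funM; first exact: mW1 (mcoord 0 m11) m22.
  by apply: mQ => //; exact: measurable_hcons2.
have F0' u : 0 <= F u by rewrite mule_ge0.
have -> : \int[m]_w F1 (Defs.shift w) =
    \int[m]_w F (state_obs w, ((at_time 1 w).2, (at_time 1 w).1)).
  apply: eq_integral => w _; rewrite /F1 /F obs_past_shift /alpha /= past_shift /=.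
  by rewrite /past /obs_past /past /= oppr0.
have stepF := step mp p0 mg g0 m_step mF F0'.
rewrite stepF.
apply: (@le_trans _ _ (\int[m]_(w in setT) (B * delta * l)%:E)); last first.
  by rewrite integral_cst//= probability_setT mule1.
pose K (v : path * mR * mR) :=
  (p (at_time 0 v.1.1).1 v.2)%:E * (g v.1.2 v.2)%:E *
  F (state_obs v.1.1, (v.1.2, v.2)).
have mK : measurable_fun setT K.
  apply: emeasurable_funM.
    apply: emeasurable_funM; [apply: mpe|apply: mge] => //.
    - apply: (measurableT_comp measurable_fst).
      apply: (measurableT_comp (@measurable_at_time R 0)).
      exact: measurableT_comp measurable_fst measurable_fst.
    - exact: measurableT_comp measurable_snd measurable_fst.
  apply: (measurableT_comp mF); apply: measurable_fun_pair.
    apply: (measurableT_comp (@measurable_state_obs R)).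
    exact: measurableT_comp measurable_fst measurable_fst.
  apply: measurable_fun_pair => //.
  exact: measurableT_comp measurable_snd measurable_fst.
have K0 v : 0 <= K v by rewrite !mule_ge0 ?F0'.
pose Kz (v : path * mR) := \int[leb]_y K (v, y).
have mKz : measurable_fun setT Kz by exact: measurable_fun_integral_pair.
have Kz0 v : 0 <= Kz v by exact: integral_ge0.
rewrite -[leLHS]/(\int[m]_w \int[leb]_z Kz (w, z)).
have mgzy : measurable_fun setT (fun u : mR * mR => (g u.1 u.2)%:E) by exact: mge.
pose G (z : mR) := \int[leb]_y (g z y)%:E.
have mG : measurable_fun setT G.
  exact: (@measurable_fun_integral _ _ _ _ _ leb (fun z y : mR => (g z y)%:E)).
have G0 z : 0 <= G z by exact: integral_ge0.
have GB : \int[leb]_z G z <= l%:E by rewrite /G (tonelli leb leb mgzy).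
apply: ge0_le_integral => //.
- by move=> w _; apply: integral_ge0.
- exact: measurable_fun_integral_pair.
move=> w _; set h := obs_past w; set x0 := (at_time 0 w).1.
apply: (@le_trans _ _ (\int[leb]_z ((B * delta)%:E * G z))); last first.
  rewrite ge0_integralZl// ?lee_fin ?mulr_ge0// [leRHS]EFinM.
  by apply: lee_wpmul2l => //; rewrite lee_fin mulr_ge0.
apply: ge0_le_integral => //.
- exact: (measurableT_comp mKz (g := pair w)).
- by apply: emeasurable_funM => //; exact: measurable_cst.
move=> z _.
have mgW : measurable_fun setT (fun y : mR => (g z y)%:E * W1 (h 0%N) y *
    Qk k chi y (hcons h z)).
  apply: emeasurable_funM; last by apply: mQ => //; exact: measurable_cst.
  apply: emeasurable_funM; first by apply: mge => //; exact: measurable_cst.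
  by apply: mW1 => //; exact: measurable_cst.
have gW0 y : 0 <= (g z y)%:E * W1 (h 0%N) y * Qk k chi y (hcons h z).
  by rewrite !mule_ge0.
apply: (@le_trans _ _ (B%:E * \int[leb]_y ((g z y)%:E * W1 (h 0%N) y *
    Qk k chi y (hcons h z)))).
  rewrite -ge0_integralZl//; apply: ge0_le_integral => //.
  - exact: (measurableT_comp mK (g := pair (w, z))).
  - by apply: emeasurable_funM => //; exact: measurable_cst.
  - move=> y _; rewrite /K /F /= -muleA (muleA (g z y)%:E).
    by apply: lee_wpmul2r => //; rewrite lee_fin.
rewrite EFinM -muleA; apply: lee_wpmul2l; first by rewrite lee_fin.
exact: weak_merging_forward.
Qed.

End backward.

(** * Overlap of two filters along the past *)

Section recurrence.
Local Open Scope ereal_scope.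
Context (R : realType).

Lemma measure_lim_sup_ge d (T : measurableType d) (m : probability T R)
    (E : (set T)^nat) (r : \bar R) :
  (forall k, measurable (E k)) -> (forall k, r <= m (E k)) ->
  r <= m (lim_sup_set E).
Proof.
move=> mE rE; have mU n : measurable (\bigcup_(k >= n) E k).
  by apply: bigcup_measurable => k _; exact: mE.
have cvgE := lim_sup_set_cvg m E mE.
have fin : m (\bigcup_(k >= 0%N) E k) < +oo.
  by rewrite ltey_eq fin_num_measure.
have {cvgE} cvgE := cvgE fin.
rewrite -(cvg_lim _ cvgE)//; apply: lime_ge; first by apply/cvg_ex; exists (m (lim_sup_set E)).
apply: nearW => n; apply: le_trans (rE n) _.
by apply: le_measure; rewrite ?inE//; apply: bigcup_sup => /=.
Qed.

(** The paths with infinitely many visits to [S] in the past form an invariant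
    set, of probability at least that of [S]. *)
Lemma ae_past_recurrent (m : probability (path_space R) R)
    (S : set (path_space R)) :
  invariant_ergodic m -> measurable S -> 0 < m S ->
  \forall w \ae m, exists k : nat, S (shiftn (- k%:Z) w).
Proof.
move=> [m_inv m_erg] mS S0.
pose E (k : nat) := @shiftn R (- k%:Z) @^-1` S.
have mE k : measurable (E k).
  by rewrite -[X in measurable X]setTI; exact: measurable_shiftn.
have mA : measurable (lim_sup_set E).
  by apply: bigcap_measurable => // n _; apply: bigcup_measurable.
have EA : @Defs.shift R @^-1` lim_sup_set E = lim_sup_set E.
  have sE k w : E k.+1 (Defs.shift w) = E k w.
    rewrite /E /preimage /=; congr S; apply/funext => n.
    rewrite /shiftn /Defs.shift; congr (w _).
    by rewrite -addn1 PoszD opprD -!addrA addNr addr0.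
  apply/seteqP; split => w /= wE n _.
    by have [[//|k] /= nk] := wE n.+1 I; rewrite sE => Ek; exists k.
  have [k /= nk Ek] := wE n I; exists k.+1 => /=; last by rewrite sE.
  exact: leqW.
have A0 : 0 < m (lim_sup_set E).
  apply: lt_le_trans S0 _; apply: measure_lim_sup_ge => // k.
  by rewrite (shiftn_invariant m_inv).
have A1 : m (lim_sup_set E) = 1.
  by have [A0'|//] := m_erg _ mA EA; rewrite A0' ltxx in A0.
exists (~` lim_sup_set E); split.
- exact: measurableC.
- by rewrite probability_setC// A1 subee.
- move=> w /= wE wA; apply: wE; have [k _ Ek] := wA 0%N I.
  by exists k.
Qed.

(** Each gain is at least [t * u 0], for which a bounded sequence has no room
    near its supremum. *)
Lemma nondecreasing_gain0 (u : nat -> R) (t : R) : (0 < t)%R ->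
  (forall j, 0 <= u j <= 1)%R -> (forall j, u j <= u j.+1)%R ->
  (forall n, exists2 j, (n <= j)%N & (u j + t * u j.+1 <= u j.+1)%R) ->
  u 0%N = 0%R.
Proof.
move=> t0 u01 uS gain.
have u_nd : {homo u : i j / (i <= j)%N >-> (i <= j)%R}.
  by apply/nondecreasing_seqP.
have u_ub : has_sup (range u).
  split; first by exists (u 0%N), 0%N.
  by exists 1%R => _ [j _ <-]; case/andP: (u01 j).
have le_sup j : (u j <= sup (range u))%R by apply: sup_upper_bound => //; exists j.
have : (sup (range u) <= sup (range u) - t * u 0%N)%R.
  apply: sup_le_ub; first by exists (u 0%N), 0%N.
  move=> _ [j _ <-]; have [i ji gi] := gain j.
  rewrite lerBrDr (le_trans _ (le_sup i.+1))// (le_trans _ gi)//.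
  by rewrite lerD ?u_nd// ler_wpM2l ?u_nd// ltW.
set M := sup _ => MtM; have : (t * u 0%N <= 0)%R by lra.
rewrite pmulr_rle0// => u0.
by apply/eqP; rewrite eq_le u0; case/andP: (u01 0%N).
Qed.

End recurrence.

Lemma ae_imply d (T : measurableType d) (R : realType)
    (mu : {measure set T -> \bar R}) (P S : T -> Prop) :
  (\forall x \ae mu, P x) -> (forall x, P x -> S x) -> \forall x \ae mu, S x.
Proof. by move=> aeP PS; apply: filterS aeP. Qed.

Lemma ae_imply2 d (T : measurableType d) (R : realType)
    (mu : {measure set T -> \bar R}) (P Q S : T -> Prop) :
  (\forall x \ae mu, P x) -> (\forall x \ae mu, Q x) ->
  (forall x, P x -> Q x -> S x) -> \forall x \ae mu, S x.
Proof. by move=> aeP aeQ PQS; apply: filterS2 aeP aeQ. Qed.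

Section overlap.
Local Open Scope ereal_scope.
Context (R : realType).
Notation leb := (@lebesgue_measure R).
Notation mR := (measurableTypeR R).
Notation H := (history R).
Variables (p g : R -> R -> R) (B c : R) (W : set (mR * mR)).
Hypothesis mp : measurable_fun setT (fun u : R * R => p u.1 u.2).
Hypothesis p0 : forall x y, (0 <= p x y)%R.
Hypothesis mg : measurable_fun setT (fun u : R * R => g u.1 u.2).
Hypothesis g0 : forall z x, (0 <= g z x)%R.
Hypothesis B0 : (0 < B)%R.
Hypothesis pB : forall x y, (p x y <= B)%R.
Hypothesis mW : measurable W.
Hypothesis c0 : (0 < c)%R.
Hypothesis Wc : forall z y, W (z, y) ->
  \forall x \ae leb, g z x != 0%R -> (c <= p x y)%R.

Let pe0 x y : 0 <= (p x y)%:E. Proof. by rewrite lee_fin. Qed.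
Let ge0 z x : 0 <= (g z x)%:E. Proof. by rewrite lee_fin. Qed.
Let mpe := measurable_EFin2 mp.
Let mge := measurable_EFin2 mg.
Local Notation bw := (backward_weight p g).
Local Notation U := (merging_weight p g W).
Local Notation V := (total_weight p g).
Let bw0 k x h : 0 <= bw k x h. Proof. exact: backward_weight_ge0. Qed.
Let V0 j h : 0 <= V j h. Proof. exact: total_weight_ge0. Qed.
Let U0 j h : 0 <= U j h. Proof. exact: merging_weight_ge0. Qed.
Let mbw k (h : H) : measurable_fun setT (fun x : mR => bw k x h).
Proof. by apply: measurable_backward_weight => //; exact: measurable_cst. Qed.

Let W1 (z y : R) : \bar R := (\1_W (z, y))%:E.
Let W10 z y : 0 <= W1 z y. Proof. by rewrite lee_fin. Qed.
Let mW1 z : measurable_fun setT (fun y : mR => W1 z y).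
Proof.
apply/measurable_EFinP.
by apply: (measurableT_comp (measurable_indic (D := setT) mW) (g := pair z)).
Qed.

Implicit Type F : mR -> \bar R.

(** Unnormalised density of the next filter, given the observation [z]. *)
Definition propagate (F : mR -> \bar R) (z y : R) : \bar R :=
  (g z y)%:E * \int[leb]_x (F x * (p x y)%:E).

Let mFp F : measurable_fun setT F ->
  measurable_fun setT (fun u : mR * mR => F u.1 * (p u.1 u.2)%:E).
Proof.
by move=> mF; apply: emeasurable_funM; [exact: measurableT_comp|exact: mpe].
Qed.

Let mFpy F y : measurable_fun setT F ->
  measurable_fun setT (fun x : mR => F x * (p x y)%:E).
Proof.
by move=> mF; apply: emeasurable_funM => //; apply: mpe => //; exact: measurable_cst.
Qed.

Lemma propagate_ge0 F z y : (forall x, 0 <= F x) -> 0 <= propagate F z y.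
Proof. by move=> F0; rewrite mule_ge0// integral_ge0// => x _; rewrite mule_ge0. Qed.

Lemma measurable_propagate F z : measurable_fun setT F -> (forall x, 0 <= F x) ->
  measurable_fun setT (fun y : mR => propagate F z y).
Proof.
move=> mF F0; apply: emeasurable_funM; first by apply: mge => //; exact: measurable_cst.
apply: (@measurable_fun_integral _ _ _ _ _ leb (fun y x : mR => F x * (p x y)%:E)).
  exact: (measurableT_comp (mFp mF) (g := fun u : mR * mR => (u.2, u.1))
      (measurable_fun_pair measurable_snd measurable_fst)).
by move=> y x; rewrite mule_ge0.
Qed.

(** The backward weights are dual to the propagation: weighted masses do not
    change along the past. *)
Lemma integral_propagate F j (h : H) : measurable_fun setT F -> (forall x, 0 <= F x) ->
  \int[leb]_y (propagate F (h j) y * bw j y h) =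
  \int[leb]_x (F x * bw j.+1 x h).
Proof.
move=> mF F0.
pose K (y x : mR) := F x * ((p x y)%:E * (g (h j) y)%:E * bw j y h).
have mpgb : measurable_fun setT (fun u : mR * mR =>
    (p u.2 u.1)%:E * (g (h j) u.1)%:E * bw j u.1 h).
  apply: emeasurable_funM; last first.
    by apply: measurable_backward_weight => //; exact: measurable_cst.
  by apply: emeasurable_funM; [exact: mpe|apply: mge => //; exact: measurable_cst].
have mK : measurable_fun setT (fun u : mR * mR => K u.1 u.2).
  by apply: emeasurable_funM => //; exact: measurableT_comp.
have K0 y x : 0 <= K y x by rewrite !mule_ge0.
transitivity (\int[leb]_y \int[leb]_x K y x).
  apply: eq_integral => y _; rewrite /propagate -ge0_integralZl//; last 2 first.
  - exact: mFpy.
  - by move=> x _; rewrite mule_ge0.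
  rewrite -ge0_integralZr//; last 2 first.
  - by apply: emeasurable_funM; [exact: measurable_cst|exact: mFpy].
  - by move=> x _; rewrite !mule_ge0.
  by apply: eq_integral => x _; rewrite /K muleCA !muleA; congr (_ * _); rewrite muleAC -muleA.
rewrite (tonelli leb leb mK K0); apply: eq_integral => x _.
rewrite /K /= ge0_integralZl//.
- exact: (measurableT_comp mpgb (g := fun y : mR => (y, x))).
- by move=> y _; rewrite !mule_ge0.
Qed.

(** Almost every state where [F] is positive jumps to [y] with density at least
    [c]. *)
Lemma merging_le_propagate F z z' y : measurable_fun setT F -> (forall x, 0 <= F x) ->
  (\forall x \ae leb, g z x = 0%R -> F x = 0) ->
  (g z' y)%:E * (W1 z y * c%:E * \int[leb]_x F x) <= propagate F z' y.
Proof.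
move=> mF F0 Fz; apply: lee_wpmul2l => //.
rewrite /W1 indicE; have [/set_mem zyW|_] := boolP (_ \in W); last first.
  by rewrite !mul0e integral_ge0// => x _; rewrite mule_ge0.
rewrite mul1e -ge0_integralZl ?lee_fin ?(ltW c0)//.
apply: ae_ge0_le_integral => //.
- by move=> x _; rewrite mule_ge0// lee_fin ltW.
- by apply: emeasurable_funM => //; exact: measurable_cst.
- by move=> x _; rewrite mule_ge0.
- exact: mFpy.
- apply: (ae_imply2 Fz (Wc zyW)) => x Fx px _.
  have [gx|gx] := eqVneq (g z x) 0%R; first by rewrite Fx// mul0e mule0.
  by rewrite muleC lee_wpmul2l// lee_fin px.
Qed.

(** Weighted mass that two densities share, at time [- j]. *)
Definition overlap (F F' : mR -> R) (j : nat) (h : H) : \bar R :=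
  \int[leb]_x ((Num.min (F x) (F' x))%:E * bw j x h).

(** Doeblin's argument: the part of each density that the overlap misses is
    spread over the merging set with density at least [c], and what the two parts
    have in common there adds to the overlap. The factor [B] converts the total
    weight of the next state into the backward weight of the present one. For
    [delta = 0] the lemma says that the overlap grows along the orbit. *)
Lemma overlap_step (F F' G G' : mR -> R) j (h : H) (delta : R) :
  measurable_fun setT F -> measurable_fun setT F' ->
  measurable_fun setT G -> measurable_fun setT G' ->
  (forall x, 0 <= F x)%R -> (forall x, 0 <= F' x)%R ->
  (forall x, 0 <= G x)%R -> (forall x, 0 <= G' x)%R ->
  (\forall y \ae leb, (F y)%:E = propagate (EFin \o G) (h j) y) ->
  (\forall y \ae leb, (F' y)%:E = propagate (EFin \o G') (h j) y) ->
  (\forall x \ae leb, g (h j.+1) x = 0%R -> G x = 0%R) ->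
  (\forall x \ae leb, g (h j.+1) x = 0%R -> G' x = 0%R) ->
  \int[leb]_x ((G x)%:E * bw j.+1 x h) = 1 ->
  \int[leb]_x ((G' x)%:E * bw j.+1 x h) = 1 ->
  (0 <= delta)%R -> delta%:E * V j h <= U j h ->
  B%:E * overlap G G' j.+1 h + (c * delta)%:E * (1 - overlap G G' j.+1 h) <=
  B%:E * overlap F F' j h.
Proof.
move=> mF mF' mG mG' F0 F'0 G0 G'0 FE F'E Gz G'z G1 G'1 delta0 good.
pose q x := Num.min (G x) (G' x).
have mq : measurable_fun setT q by exact: measurable_minr.
have q0 x : (0 <= q x)%R by rewrite le_min G0 G'0.
have mqe : measurable_fun setT (EFin \o q) by exact/measurable_EFinP.
pose o := overlap G G' j.+1 h.
have oE : o = \int[leb]_x ((q x)%:E * bw j.+1 x h) by [].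
pose L := propagate (EFin \o q) (h j).
have half (K E : mR -> R) : measurable_fun setT K -> (forall x, q x <= K x)%R ->
    (\forall x \ae leb, g (h j.+1) x = 0%R -> K x = 0%R) ->
    \int[leb]_x ((K x)%:E * bw j.+1 x h) = 1 ->
    (\forall y \ae leb, (E y)%:E = propagate (EFin \o K) (h j) y) ->
    let D := \int[leb]_x (K x - q x)%:E in
    [/\ 0 <= D, o <= 1, 1 - o <= B%:E * V j h * D &
      \forall y \ae leb,
        L y + (g (h j) y)%:E * (W1 (h j.+1) y * c%:E * D) <= (E y)%:E].
  move=> mK qK Kz K1 KE D.
  pose d x : \bar R := (K x - q x)%:E.
  have d0 x : 0 <= d x by rewrite lee_fin subr_ge0.
  have md : measurable_fun setT d by apply/measurable_EFinP; exact: measurable_funB.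
  have Kqd x : (K x)%:E = (q x)%:E + d x by rewrite -EFinD addrC subrK.
  have D0 : 0 <= D by apply: integral_ge0 => x _; exact: d0.
  have KoD : 1 = o + \int[leb]_x (d x * bw j.+1 x h).
    have qb0 x : 0 <= (q x)%:E * bw j.+1 x h by rewrite mule_ge0 ?lee_fin.
    have db0 x : 0 <= d x * bw j.+1 x h by rewrite mule_ge0.
    have mqb := emeasurable_funM mqe (mbw j.+1 h).
    have mdb := emeasurable_funM md (mbw j.+1 h).
    rewrite -K1 oE -(ge0_integralD leb measurableT (fun x _ => qb0 x) mqb (fun x _ => db0 x) mdb).
    by apply: eq_integral => x _; rewrite Kqd ge0_muleDl// lee_fin.
  have I0 : 0 <= \int[leb]_x (d x * bw j.+1 x h).
    by apply: integral_ge0 => x _; rewrite mule_ge0.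
  have o0 : 0 <= o by rewrite oE; apply: integral_ge0 => x _; rewrite mule_ge0 ?lee_fin.
  have o1 : o <= 1 by rewrite KoD leeDl.
  have ofin : o \is a fin_num by rewrite ge0_fin_numE// (le_lt_trans o1)// ltry.
  split => //.
  - rewrite {1}KoD addeAC subee// add0e /D -(ge0_integralZl _ _ md)//; last first.
      by rewrite mule_ge0 ?V0// lee_fin ltW.
    apply: ge0_le_integral; first exact: measurableT.
    + by move=> x _; rewrite mule_ge0.
    + exact: emeasurable_funM.
    + by apply: emeasurable_funM => //; exact: measurable_cst.
    + move=> x _; rewrite muleC; apply: lee_wpmul2r => //.
      exact: (backward_weight_le mp p0 mg g0 (ltW B0) pB).
  - have dz : \forall x \ae leb, g (h j.+1) x = 0%R -> d x = 0.
      apply: (ae_imply Kz) => x Kx gx; rewrite /d Kx// sub0r.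
      by congr EFin; apply/eqP; rewrite oppr_eq0 eq_le q0 -{1}(Kx gx) qK.
    apply: (ae_imply KE) => y ->.
    have -> : propagate (EFin \o K) (h j) y = L y + propagate d (h j) y.
      rewrite /L /propagate -ge0_muleDr; last 2 first.
      + by apply: integral_ge0 => x _; rewrite mule_ge0 ?lee_fin.
      + by apply: integral_ge0 => x _; rewrite mule_ge0.
      congr (_ * _); rewrite -ge0_integralD//.
      + by apply: eq_integral => x _; rewrite /= Kqd ge0_muleDl// lee_fin.
      + by move=> x _; rewrite mule_ge0 ?lee_fin.
      + exact: mFpy.
      + by move=> x _; rewrite mule_ge0.
      + exact: mFpy.
    by apply: leeD2l; exact: (merging_le_propagate _ _ md d0 dz).
have qG x : (q x <= G x)%R by rewrite ge_min lexx.
have qG' x : (q x <= G' x)%R by rewrite ge_min lexx orbT.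
have [D0 o1 oD GD] := half _ _ mG qG Gz G1 FE.
have [D'0 _ oD' GD'] := half _ _ mG' qG' G'z G'1 F'E.
set D := \int[leb]_x _ in D0 oD GD; set D' := \int[leb]_x _ in D'0 oD' GD'.
pose r := Order.min D D'.
have r0 : 0 <= r by rewrite le_min D0 D'0.
have orV : 1 - o <= B%:E * V j h * r by rewrite /r minEle; case: ifP.
pose rho (y : mR) := (g (h j) y)%:E * (W1 (h j.+1) y * c%:E * r).
have rho0 y : 0 <= rho y by rewrite !mule_ge0 ?lee_fin// ltW.
have mrho : measurable_fun setT rho.
  apply: emeasurable_funM; first by apply: mge => //; exact: measurable_cst.
  apply: emeasurable_funM; last exact: measurable_cst.
  by apply: emeasurable_funM; [exact: mW1|exact: measurable_cst].
have L0 y : 0 <= L y by apply: propagate_ge0 => x; rewrite lee_fin.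
have mL : measurable_fun setT L.
  by apply: measurable_propagate => // x; rewrite lee_fin.
have lower : \int[leb]_y ((L y + rho y) * bw j y h) <= overlap F F' j h.
  apply: ae_ge0_le_integral => //.
  - by move=> y _; rewrite mule_ge0// adde_ge0.
  - by apply: emeasurable_funM => //; exact: emeasurable_funD.
  - by move=> y _; rewrite mule_ge0// lee_fin le_min F0 F'0.
  - by apply: emeasurable_funM => //; apply/measurable_EFinP; exact: measurable_minr.
  - apply: (ae_imply2 GD GD') => y Fy F'y _; apply: lee_wpmul2r => //.
    have rD : rho y <= (g (h j) y)%:E * (W1 (h j.+1) y * c%:E * D).
      apply: lee_wpmul2l => //; apply: lee_wpmul2l; last by rewrite ge_min lexx.
      by rewrite mule_ge0// lee_fin ltW.
    have rD' : rho y <= (g (h j) y)%:E * (W1 (h j.+1) y * c%:E * D').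
      apply: lee_wpmul2l => //; apply: lee_wpmul2l; last by rewrite ge_min lexx orbT.
      by rewrite mule_ge0// lee_fin ltW.
    rewrite minEle; case: ifP => _.
      exact: le_trans (leeD2l _ rD) Fy.
    exact: le_trans (leeD2l _ rD') F'y.
apply: le_trans (lee_wpmul2l _ lower); last by rewrite lee_fin ltW.
have -> : \int[leb]_y ((L y + rho y) * bw j y h) = o + c%:E * r * U j h.
  transitivity (\int[leb]_y (L y * bw j y h + rho y * bw j y h)).
    by apply: eq_integral => y _; rewrite ge0_muleDl.
  have Lb0 y : 0 <= L y * bw j y h by rewrite mule_ge0.
  have rb0 y : 0 <= rho y * bw j y h by rewrite mule_ge0.
  have mLb := emeasurable_funM mL (mbw j h).
  have mrb := emeasurable_funM mrho (mbw j h).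
  rewrite (ge0_integralD leb measurableT (fun y _ => Lb0 y) mLb (fun y _ => rb0 y) mrb).
  congr (_ + _); first by rewrite integral_propagate// => x; rewrite lee_fin.
  rewrite /U -ge0_integralZl//.
  - apply: eq_integral => y _; rewrite /rho -[(\1_W _)%:E]/(W1 (h j.+1) y) -!muleA.
    rewrite (muleCA _ c%:E) (muleCA _ r) (muleCA _ c%:E) (muleCA _ r).
    by rewrite (muleCA (g _ _)%:E).
  - apply: emeasurable_funM; first exact: mW1.
    by apply: emeasurable_funM => //; apply: mge => //; exact: measurable_cst.
  - by move=> y _; rewrite !mule_ge0.
  - by rewrite mule_ge0// lee_fin ltW.
have o0 : 0 <= o by rewrite oE; apply: integral_ge0 => x _; rewrite mule_ge0 ?lee_fin.
have cU0 : 0 <= c%:E * r * U j h by rewrite !mule_ge0 ?lee_fin ?(ltW c0).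
rewrite (ge0_muleDr B%:E o0 cU0); apply: leeD2l.
apply: (@le_trans _ _ ((c * delta)%:E * (B%:E * V j h * r))).
  by apply: lee_wpmul2l => //; rewrite lee_fin mulr_ge0// ltW.
have -> : (c * delta)%:E * (B%:E * V j h * r) = B%:E * (c%:E * r * (delta%:E * V j h)).
  rewrite EFinM -!muleA [RHS]muleCA; congr (_ * _); rewrite muleCA; congr (_ * _).
  by rewrite muleA muleC.
apply: lee_wpmul2l; first by rewrite lee_fin ltW.
by apply: lee_wpmul2l => //; rewrite mule_ge0// lee_fin ltW.
Qed.

(** Two pasts of filters with the same observations agree now, because their
    overlap increases to the whole mass. *)
Lemma filter_past_unique (h : H) (F F' : nat -> mR -> R) (delta : R) :
  (forall j, measurable_fun setT (F j)) -> (forall j, measurable_fun setT (F' j)) ->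
  (forall j x, 0 <= F j x)%R -> (forall j x, 0 <= F' j x)%R ->
  (forall j, \forall y \ae leb,
    (F j y)%:E = propagate (EFin \o F j.+1) (h j) y) ->
  (forall j, \forall y \ae leb,
    (F' j y)%:E = propagate (EFin \o F' j.+1) (h j) y) ->
  \int[leb]_x (F 0%N x)%:E = 1 -> \int[leb]_x (F' 0%N x)%:E = 1 ->
  (0 < delta)%R ->
  (forall n, exists2 j, (n <= j)%N & delta%:E * V j h <= U j h) ->
  \forall x \ae leb, F 0%N x = F' 0%N x.
Proof.
move=> mF mF' F0 F'0 FE F'E F1 F'1 delta0 good.
have mass (G : nat -> mR -> R) : (forall j, measurable_fun setT (G j)) ->
    (forall j x, 0 <= G j x)%R ->
    (forall j, \forall y \ae leb,
      (G j y)%:E = propagate (EFin \o G j.+1) (h j) y) ->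
    \int[leb]_x (G 0%N x)%:E = 1 ->
    forall j, \int[leb]_x ((G j x)%:E * bw j x h) = 1.
  move=> mG G0 GE G1; elim=> [|j IHj].
    by rewrite -G1; apply: eq_integral => x _; rewrite mule1.
  have mGe : measurable_fun setT (EFin \o G j.+1) by exact/measurable_EFinP.
  have Ge0 x : 0 <= (EFin \o G j.+1) x by rewrite lee_fin.
  rewrite -[LHS](integral_propagate j h mGe Ge0) -IHj; apply: ge0_ae_eq_integral => //.
  - by apply: emeasurable_funM => //; exact: measurable_propagate.
  - by apply: emeasurable_funM => //; apply/measurable_EFinP.
  - by move=> y _; rewrite mule_ge0 ?propagate_ge0.
  - by move=> y _; rewrite mule_ge0 ?lee_fin.
  - by apply: (ae_imply (GE j)) => y -> _.
have vanish (G : nat -> mR -> R) : (forall j, \forall y \ae leb,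
      (G j y)%:E = propagate (EFin \o G j.+1) (h j) y) ->
    forall j, \forall x \ae leb, g (h j) x = 0%R -> G j x = 0%R.
  move=> GE j; apply: (ae_imply (GE j)) => x + gx.
  by rewrite /propagate gx mul0e => -[].
pose o j := overlap (F j) (F' j) j h.
have mq j : measurable_fun setT (fun x : mR => (Num.min (F j x) (F' j x))%:E).
  by apply/measurable_EFinP; exact: measurable_minr.
have q0 j x : (0 <= Num.min (F j x) (F' j x))%R by rewrite le_min F0 F'0.
have o0 j : 0 <= o j by apply: integral_ge0 => x _; rewrite mule_ge0 ?lee_fin.
have o1 j : o j <= 1.
  rewrite -(mass F mF F0 FE F1 j); apply: ge0_le_integral => //.
  - by move=> x _; rewrite mule_ge0 ?lee_fin.
  - exact: emeasurable_funM.
  - by apply: emeasurable_funM => //; apply/measurable_EFinP.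
  - by move=> x _; rewrite lee_wpmul2r// lee_fin ge_min lexx.
have ofin j : o j \is a fin_num by rewrite ge0_fin_numE// (le_lt_trans (o1 j))// ltry.
have step_o j t : (0 <= t)%R -> t%:E * V j h <= U j h ->
    (B * fine (o j.+1) + c * t * (1 - fine (o j.+1)) <= B * fine (o j))%R.
  move=> t0 tVU; rewrite -lee_fin EFinD !EFinM EFinB !fineK//.
  rewrite -EFinM; apply: overlap_step => //.
  - exact: vanish.
  - exact: vanish.
  - exact: mass.
  - exact: mass.
pose u j := (1 - fine (o j))%R.
have u0 : u 0%N = 0%R.
  apply: (@nondecreasing_gain0 _ u (c * delta / B)%R).
  - by rewrite divr_gt0// mulr_gt0.
  - move=> j; rewrite /u subr_ge0 gerBl -!lee_fin fineK// o1/= o0//.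
  - move=> j; rewrite /u lerD2l lerN2 -(ler_pM2l B0).
    have := step_o j 0%R (lexx _); rewrite mul0e mulr0 mul0r addr0; exact.
  - move=> n; have [j nj gj] := good n; exists j => //.
    have := step_o j delta (ltW delta0) gj; rewrite /u => oj.
    rewrite -(ler_pM2l B0) mulrDr mulrA mulrCA mulfV ?gt_eqF// mulr1.
    lra.
have o01 : o 0%N = 1 by rewrite -(fineK (ofin 0%N)); congr EFin; move: u0; rewrite /u; lra.
have le (G : mR -> R) : measurable_fun setT G ->
    (forall x, Num.min (F 0%N x) (F' 0%N x) <= G x)%R ->
    \int[leb]_x (G x)%:E = 1 ->
    \forall x \ae leb, Num.min (F 0%N x) (F' 0%N x) = G x.
  move=> mG qG G1.
  have md : measurable_fun setT (fun x : mR => (G x - Num.min (F 0%N x) (F' 0%N x))%:E).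
    by apply/measurable_EFinP; apply: measurable_funB => //; exact: measurable_minr.
  have d0 x : 0 <= (G x - Num.min (F 0%N x) (F' 0%N x))%:E.
    by rewrite lee_fin subr_ge0.
  have := ge0_integralD leb measurableT (fun x _ => d0 x) md
    (fun x _ => (q0 0%N x : 0 <= (Num.min (F 0%N x) (F' 0%N x))%:E)) (mq 0%N).
  under eq_integral do rewrite -EFinD subrK.
  have -> : \int[leb]_x (Num.min (F 0%N x) (F' 0%N x))%:E = 1.
    by rewrite -o01; apply: eq_integral => x _; rewrite mule1.
  rewrite G1 => /esym dI.
  have dz : \int[leb]_x (G x - Num.min (F 0%N x) (F' 0%N x))%:E = 0.
    have I0 : 0 <= \int[leb]_x (G x - Num.min (F 0%N x) (F' 0%N x))%:E.
      by apply: integral_ge0 => x _; exact: d0.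
    by move: dI I0; case: (\int[leb]_x _) => [r| |] //= [] + _ => r1; congr EFin; lra.
  apply: (ae_imply ((ge0_integral_eq0P leb md d0).1 dz)) => x [] /eqP.
  by rewrite subr_eq0 => /eqP.
have FF : \forall x \ae leb, Num.min (F 0%N x) (F' 0%N x) = F 0%N x.
  by apply: le => // x; rewrite ge_min lexx.
have FF' : \forall x \ae leb, Num.min (F 0%N x) (F' 0%N x) = F' 0%N x.
  by apply: le => // x; rewrite ge_min lexx orbT.
by apply: (ae_imply2 FF FF') => x Fmin F'min; rewrite -[LHS]Fmin -[RHS]F'min.
Qed.

End overlap.

Section strong_merging.
Local Open Scope ereal_scope.
Context (R : realType).
Notation leb := (@lebesgue_measure R).
Notation mR := (measurableTypeR R).
Notation path := (path_space R).
Variables (m : probability (path_space R) R) (p g : R -> R -> R).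
Hypothesis mp : measurable_fun setT (fun u : R * R => p u.1 u.2).
Hypothesis p0 : forall x y, (0 <= p x y)%R.
Hypothesis mg : measurable_fun setT (fun u : R * R => g u.1 u.2).
Hypothesis g0 : forall z x, (0 <= g z x)%R.
Hypothesis m_inv : forall A, measurable A -> m (@Defs.shift R @^-1` A) = m A.
Hypothesis m_step : hidden_markov m p g.
Variables (B l : R) (W : set (mR * mR)).
Hypothesis B0 : (0 <= B)%R.
Hypothesis pB : forall x y, (p x y <= B)%R.
Hypothesis p1 : forall x, \int[leb]_y (p x y)%:E <= 1.
Hypothesis g1 : forall x, \int[leb]_z (g z x)%:E <= 1.
Hypothesis gl : \int[leb]_x \int[leb]_z (g z x)%:E <= l%:E.
Hypothesis mW : measurable W.

Definition frequent_merging (delta : R) : set path :=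
  lim_sup_set (fun k => @obs_past R @^-1` ~` weak_merging p g W delta k).

Lemma measurable_frequent_merging delta : measurable (frequent_merging delta).
Proof.
apply: bigcap_measurable => // n _; apply: bigcup_measurable => k _.
rewrite -[X in measurable X]setTI; apply: measurable_obs_past => //.
by apply: measurableC; exact: measurable_weak_merging.
Qed.

(** Mergings have the same positive probability at all times; for a small
    [delta], at most half of it is lost to the weak ones. *)
Lemma frequent_merging_gt0 :
  0 < m [set w | W (obs_past w 0%N, (at_time 1 w).1)] ->
  exists2 delta : R, (0 < delta)%R & 0 < m (frequent_merging delta).
Proof.
have mop := @measurable_obs_past R.
have mE (k n : int) : measurable [set w : path | W ((w k).2, (w n).1)].
  pose f (w : path) : mR * mR := ((at_time k w).2, (at_time n w).1).
  have mf : measurable_fun setT f.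
    apply: measurable_fun_pair.
      exact: (measurableT_comp measurable_snd (@measurable_at_time R k)).
    exact: (measurableT_comp measurable_fst (@measurable_at_time R n)).
  have -> : [set w : path | W ((w k).2, (w n).1)] = setT `&` f @^-1` W by rewrite setTI.
  exact: mf.
set E0 := [set w | _] => q0.
pose q := fine (m E0).
have qE : m E0 = q%:E.
  by rewrite fineK// fin_num_measure//; have := mE 0%R 1%R; rewrite /E0 /obs_past /past oppr0.
have q_gt0 : (0 < q)%R by rewrite -lte_fin -qE.
have l0 : (0 <= l)%R.
  rewrite -lee_fin (le_trans _ gl)//; apply: integral_ge0 => x _.
  by apply: integral_ge0 => z _; rewrite lee_fin.
have Bl0 : (0 <= B * l)%R by rewrite mulr_ge0.
pose delta := (q / (2 * (B * l + 1)))%R.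
have delta0 : (0 < delta)%R.
  by rewrite divr_gt0// mulr_gt0// ltr_pwDr.
exists delta => //.
apply: (@lt_le_trans _ _ (q / 2)%:E); first by rewrite lte_fin divr_gt0.
have mweak k : measurable (@obs_past R @^-1` weak_merging p g W delta k).
  by rewrite -[X in measurable X]setTI; apply: mop => //; exact: measurable_weak_merging.
have mgood k : measurable (@obs_past R @^-1` ~` weak_merging p g W delta k).
  rewrite -[X in measurable X]setTI; apply: mop => //.
  by apply: measurableC; exact: measurable_weak_merging.
apply: measure_lim_sup_ge => // k.
pose E := [set w : path | W ((w (- k.+1%:Z)%R).2, (w (- k%:Z)%R).1)].
have mEk : measurable E by exact: mE.
have mEq : m E = q%:E.
  rewrite -qE -(shiftn_invariant m_inv k.+1%:Z mEk); congr (m _).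
  apply/seteqP; split => w; rewrite /E /E0 /preimage /= /shiftn /obs_past /past /at_time.
    by rewrite addNr oppr0 -addn1 PoszD addrA addNr add0r.
  by rewrite addNr oppr0 -addn1 PoszD addrA addNr add0r.
set C := _ @^-1` _; set C' := @obs_past R @^-1` weak_merging p g W delta k.
have CC' : C = ~` C' by [].
have bad : m (E `&` C') <= (B * delta * l)%:E.
  apply: le_trans (bad_merging_le mp p0 mg g0 m_inv m_step B0 pB p1 g1 gl mW k (ltW delta0)).
  have -> : m (E `&` C') = \int[m]_w (\1_(E `&` C') w)%:E.
    have mEC : measurable (E `&` C') by apply: measurableI => //; exact: mweak.
    by rewrite (integral_indic m measurableT mEC) setIT.
  rewrite le_eqVlt; apply/orP; left; apply/eqP; apply: eq_integral => w _.
  by rewrite indicI /= EFinM.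
have split_E : m E = m (E `&` C) + m (E `&` C').
  rewrite addeC CC' -measureU//; first by rewrite -setIUr setUv setIT.
  - by apply: measurableI => //; exact: mweak.
  - by apply: measurableI => //; apply: measurableC; exact: mweak.
  - by rewrite setIACA setICr setI0.
have Eg : (q / 2)%:E <= m (E `&` C).
  have fin A : measurable A -> m A \is a fin_num by move=> mA; exact: fin_num_measure.
  have aE := fineK (fin _ (measurableI _ _ mEk (mgood k))).
  have bE := fineK (fin _ (measurableI _ _ mEk (mweak k))).
  move: split_E bad; rewrite mEq -/C -/C' in aE bE *.
  rewrite -aE -bE -EFinD !lee_fin => -[qab] ble.
  have : (B * delta * l <= q / 2)%R.
    rewrite (_ : B * delta * l = q / 2 * (B * l / (B * l + 1)))%R; last first.
      by rewrite /delta; field; apply/eqP; nra.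
    rewrite -[leRHS]mulr1; apply: ler_wpM2l; first by rewrite divr_ge0// ltW.
    by rewrite ler_pdivrMr ?ltr_pwDr// mul1r lerDl.
  lra.
have mC : measurable C by exact: mgood.
apply: (le_trans Eg); apply: le_measure; rewrite ?inE//.
by apply: measurableI.
Qed.

End strong_merging.

(** * The filtering kernel and the filtering cocycle *)

Section filter_law.
Local Open Scope ereal_scope.
Context (R : realType).
Notation leb := (@lebesgue_measure R).
Notation mR := (measurableTypeR R).
Notation path := (path_space R).
Variables (m : probability (path_space R) R) (f : history R * mR -> \bar R).
Hypothesis mf : measurable_fun setT f.
Hypothesis f0 : forall v, 0 <= f v.

(** The conditional density is a probability density for almost every history
    only; the uniform law on the unit interval replaces it elsewhere. *)
Definition path_density (w : path) (x : mR) : \bar R :=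
  if \int[leb]_u f (obs_past w, u) == 1 then f (obs_past w, x)
  else (\1_`[0%R, 1%R] (x : R))%:E.

Lemma path_density_ge0 w x : 0 <= path_density w x.
Proof. by rewrite /path_density; case: ifP => // _; rewrite lee_fin. Qed.

Lemma measurable_path_density_pair :
  measurable_fun setT (fun v : path * mR => path_density v.1 v.2).
Proof.
have mo : measurable_fun setT (fun v : path * mR => obs_past v.1).
  exact: (measurableT_comp (@measurable_obs_past R) measurable_fst).
apply: measurable_fun_ifT => /=.
- apply: (measurable_fun_bool true).
  have mt : measurable_fun setT (fun v : path * mR => \int[leb]_u f (obs_past v.1, u)).
    apply: (measurableT_comp (measurable_fun_integral_pair leb mf f0)
      (g := fun v : path * mR => obs_past v.1) mo).
  rewrite setTI (_ : _ @^-1` _ = setT `&` (fun v : path * mR =>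
      \int[leb]_u f (obs_past v.1, u)) @^-1` [set 1]).
    exact: mt measurableT _ (emeasurable_set1 1).
  by rewrite setTI; apply/seteqP; split => v /= /eqP.
- by apply: (measurableT_comp mf (g := fun v : path * mR => (obs_past v.1, v.2)));
    exact: measurable_fun_pair.
- apply/measurable_EFinP; apply: (measurableT_comp (f := \1_`[0%R, 1%R] : mR -> R)) => //.
Qed.

Lemma measurable_path_density w : measurable_fun setT (path_density w).
Proof. exact: (measurableT_comp measurable_path_density_pair (g := pair w)). Qed.

Lemma integral_path_density w : \int[leb]_x path_density w x = 1.
Proof.
rewrite /path_density; have [->//|_] := eqVneq (\int[leb]_u f (obs_past w, u)) 1.
rewrite integral_indic// setIT; apply: etrans (lebesgue_measure_itv _) _.
by rewrite /= lte_fin ltr01 -EFinD subr0.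
Qed.

Definition filter_law (w : path) : {measure set mR -> \bar R} :=
  density_measure leb (measurable_path_density w) (path_density_ge0 w).

Lemma filter_lawE w A : filter_law w A = \int[leb]_(x in A) path_density w x.
Proof. by []. Qed.

Lemma measurable_filter_law A : measurable A ->
  measurable_fun setT (fun w : path => filter_law w A).
Proof.
move=> mA.
have -> : (fun w => filter_law w A) =
    (fun w => \int[leb]_x ((\1_A x)%:E * path_density w x)).
  by apply/funext => w; rewrite filter_lawE integral_indicl.
apply: (@measurable_fun_integral _ _ _ _ _ leb
  (fun (w : path) (x : mR) => (\1_A x)%:E * path_density w x)).
  apply: emeasurable_funM; last exact: measurable_path_density_pair.
  apply/measurable_EFinP; apply: (measurableT_comp (f := \1_A : mR -> R)) => //.
by move=> w x; rewrite mule_ge0 ?lee_fin ?path_density_ge0.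
Qed.

Lemma filter_lawT w : filter_law w setT = 1.
Proof. by rewrite filter_lawE integral_path_density. Qed.

HB.instance Definition _ :=
  isKernel.Build _ _ _ _ _ filter_law measurable_filter_law.
HB.instance Definition _ :=
  Kernel_isProbability.Build _ _ _ _ _ filter_law filter_lawT.

Definition filter_kernel : R.-pker path ~> mR := filter_law.

End filter_law.

Section predict.
Local Open Scope ereal_scope.
Context (R : realType).
Notation leb := (@lebesgue_measure R).
Notation mR := (measurableTypeR R).
Variables (D : set R) (p : R -> R -> R).
Hypothesis mD : measurable D.
Hypothesis pD : transition_density D p.

Definition extended (x y : R) : R := ((fun u => p u.1 u.2) \_ (D `*` D)) (x, y).
Local Notation pI := extended.

Lemma extendedE x y : D x -> D y -> pI x y = p x y.
Proof. by move=> Dx Dy; rewrite /extended patchE mem_set. Qed.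

Lemma extended0l x y : ~ D x -> pI x y = 0%R.
Proof. by move=> Dx; rewrite /extended patchE memNset// => -[]. Qed.

Lemma extended0r x y : ~ D y -> pI x y = 0%R.
Proof. by move=> Dy; rewrite /extended patchE memNset// => -[]. Qed.

Lemma measurable_extended : measurable_fun setT (fun u : R * R => pI u.1 u.2).
Proof.
have [mp _ _] := pD.
rewrite (_ : (fun u => _) = (fun u : R * R => p u.1 u.2) \_ (D `*` D)); last first.
  by apply/funext => -[].
have mDD : measurable (D `*` D : set (R * R)) by apply: measurableX.
exact/(measurable_restrictT _ mDD).
Qed.

Lemma extended_ge0 x y : (0 <= pI x y)%R.
Proof.
have [_ p0 _] := pD; rewrite /extended patchE; case: ifPn => // /set_mem[].
exact: p0.
Qed.

Lemma integral_extended x A : D x -> measurable A ->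
  \int[leb]_(y in A) (pI x y)%:E = transition D p x A.
Proof.
move=> Dx mA; rewrite /transition integral_mkcond [RHS]integral_mkcond.
apply: eq_integral => y _; rewrite !patchE in_setI.
case: (boolP (y \in A)) => yA; rewrite ?andbT ?andbF//.
case: ifPn => [/set_mem Dy|yD]; first by rewrite extendedE.
by rewrite extended0r// => Dy; move/negP: yD; apply; exact: mem_set.
Qed.

Lemma integral_extended_le1 x : \int[leb]_y (pI x y)%:E <= 1.
Proof.
have [_ _ p1] := pD; have [Dx|Dx] := pselect (D x).
  by rewrite integral_extended// p1.
by rewrite integral0_eq// => y _; rewrite extended0l.
Qed.

Section bounded.
Variables (nu : {measure set mR -> \bar R}) (f : R -> R).
Hypothesis nuf : has_density nu f.
Hypothesis f1 : \int[leb]_x (f x)%:E = 1.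

Let mpe := measurable_EFin2 measurable_extended.
Let f0 x : (0 <= f x)%R. Proof. by case: nuf => _ + _; exact. Qed.
Let mf : measurable_fun setT f. Proof. by case: nuf. Qed.
Let pI0 x y : 0 <= (pI x y)%:E. Proof. by rewrite lee_fin extended_ge0. Qed.

Let nuT : nu setT = 1.
Proof. by case: nuf => _ _ ->. Qed.

Section nonneg.
Variables (k : R -> R) (M : R).
Hypothesis mk : measurable_fun setT k.
Hypothesis k0M : forall x, (0 <= k x <= M)%R.

Let k0 x : 0 <= (k x)%:E. Proof. by rewrite lee_fin; case/andP: (k0M x). Qed.
Let inner (x : mR) : \bar R := \int[leb]_y ((k y)%:E * (pI x y)%:E).

Let mkp : measurable_fun setT (fun u : mR * mR => (k u.2)%:E * (pI u.1 u.2)%:E).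
Proof.
apply: emeasurable_funM; last exact: mpe.
by apply/measurable_EFinP; exact: (measurableT_comp mk).
Qed.

Let inner0 x : 0 <= inner x.
Proof. by apply: integral_ge0 => y _; rewrite mule_ge0. Qed.

Let minner : measurable_fun setT inner.
Proof.
apply: (@measurable_fun_integral _ _ _ _ _ leb
  (fun x y : mR => (k y)%:E * (pI x y)%:E)) => // x y.
by rewrite mule_ge0.
Qed.

Let innerM x : inner x <= M%:E.
Proof.
have M0 : 0 <= M%:E by rewrite (le_trans (k0 0%R))// lee_fin; case/andP: (k0M 0%R).
apply: (@le_trans _ _ (\int[leb]_y (M%:E * (pI x y)%:E))).
  apply: ge0_le_integral => //.
  - by move=> y _; rewrite mule_ge0.
  - exact: (measurableT_comp mkp (g := pair x)).
  - by apply: emeasurable_funM => //; apply: mpe => //; exact: measurable_cst.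
  - by move=> y _; rewrite lee_wpmul2r// lee_fin; case/andP: (k0M y).
rewrite ge0_integralZl//; last by apply: mpe => //; exact: measurable_cst.
by rewrite -[leRHS]mule1 lee_wpmul2l// integral_extended_le1.
Qed.

Let inner_fin x : inner x \is a fin_num.
Proof. by rewrite ge0_fin_numE// (le_lt_trans (innerM x))// ltry. Qed.

Let inner_predict x : D x ->
  \int[leb]_(y in D) (k y * p x y)%:E = inner x.
Proof.
move=> Dx; rewrite integral_mkcond; apply: eq_integral => y _.
rewrite patchE; case: ifPn => [/set_mem Dy|/negP Dy]; first by rewrite extendedE.
by rewrite extended0r ?mule0// => /mem_set.
Qed.

Let outer_predict : \int[nu]_(x in D) inner x =
  \int[leb]_y ((k y)%:E * \int[leb]_x ((f x)%:E * (pI x y)%:E)).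
Proof.
have -> : \int[nu]_(x in D) inner x = \int[nu]_x inner x.
  rewrite integral_mkcond; apply: eq_integral => x _; rewrite patchE.
  case: ifPn => // /negP Dx; rewrite /inner integral0_eq// => y _.
  by rewrite extended0l ?mule0// => /mem_set.
have mfe : measurable_fun setT (fun x : mR => (f x)%:E) by exact/measurable_EFinP.
have fe0 x : 0 <= (f x)%:E by rewrite lee_fin.
rewrite (@ge0_integral_density _ _ _ leb (fun x : mR => (f x)%:E))//; last first.
  by case: nuf.
pose K (x y : mR) := (k y)%:E * (pI x y)%:E * (f x)%:E.
have mK : measurable_fun setT (fun u : mR * mR => K u.1 u.2).
  by apply: emeasurable_funM => //; exact: (measurableT_comp mfe).
have K0 x y : 0 <= K x y by rewrite !mule_ge0.
transitivity (\int[leb]_x \int[leb]_y K x y).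
  apply: eq_integral => x _; rewrite -ge0_integralZr//.
  - exact: (measurableT_comp mkp (g := pair x)).
  - by move=> y _; rewrite mule_ge0.
rewrite (tonelli leb leb mK K0); apply: eq_integral => y _.
rewrite -ge0_integralZl//.
- by apply: eq_integral => x _; rewrite /K -muleA [(f x)%:E * _]muleC.
- by apply: emeasurable_funM => //; apply: mpe => //; exact: measurable_cst.
- by move=> x _; rewrite mule_ge0.
Qed.

Let outer_fin : \int[nu]_(x in D) inner x \is a fin_num.
Proof.
have M0 : 0 <= M%:E by rewrite (le_trans (k0 0%R))// lee_fin; case/andP: (k0M 0%R).
rewrite ge0_fin_numE ?integral_ge0//.
apply: (@le_lt_trans _ _ (\int[nu]_(x in D) M%:E)).
  by apply: ge0_le_integral => //; exact: measurable_funTS.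
rewrite integral_cst// (@le_lt_trans _ _ M%:E) ?ltry//.
rewrite -[leRHS]mule1; apply: lee_wpmul2l => //.
by rewrite -nuT; apply: le_measure; rewrite ?inE.
Qed.

Lemma predictE : (predict D p nu k)%:E =
  \int[leb]_y ((k y)%:E * \int[leb]_x ((f x)%:E * (pI x y)%:E)).
Proof.
rewrite -outer_predict /predict /Rintegral.
rewrite -[RHS](fineK outer_fin); congr (fine _)%:E.
apply: eq_integral => x /set_mem Dx; rewrite inner_predict//.
exact: fineK.
Qed.

Lemma integrable_predict_inner x : D x ->
  leb.-integrable D (fun y => (k y * p x y)%:E).
Proof.
move=> Dx; apply/integrableP; split.
  apply/measurable_EFinP.
  apply: (eq_measurable_fun (fun y => k y * pI x y)%R).
    by move=> y /set_mem Dy; rewrite extendedE.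
  apply: measurable_funTS; apply/measurable_EFinP.
  exact: (measurableT_comp mkp (g := pair x)).
rewrite (_ : \int[leb]_(y in D) _ = inner x); first by rewrite (le_lt_trans (innerM x))// ltry.
rewrite -inner_predict//; apply: eq_integral => y /set_mem Dy.
by rewrite gee0_abs// -extendedE// EFinM mule_ge0.
Qed.

Lemma integrable_predict_outer :
  nu.-integrable D (fun x => (\int[leb]_(y in D) (k y * p x y))%:E)%R.
Proof.
have E x : D x -> ((\int[leb]_(y in D) (k y * p x y))%R)%:E = inner x.
  by move=> Dx; rewrite /Rintegral inner_predict// fineK.
apply/integrableP; split.
  apply: (eq_measurable_fun inner); last exact: measurable_funTS.
  by move=> x /set_mem Dx; rewrite E.
rewrite (_ : \int[nu]_(x in D) _ = \int[nu]_(x in D) inner x); first by move: outer_fin;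
    rewrite ge0_fin_numE ?integral_ge0.
by apply: eq_integral => x /set_mem Dx; rewrite E// gee0_abs.
Qed.

End nonneg.

Lemma predictB (k1 k2 : R -> R) (M : R) :
  measurable_fun setT k1 -> measurable_fun setT k2 ->
  (forall x, 0 <= k1 x <= M)%R -> (forall x, 0 <= k2 x <= M)%R ->
  predict D p nu (fun x => k1 x - k2 x)%R =
  (predict D p nu k1 - predict D p nu k2)%R.
Proof.
move=> mk1 mk2 k1M k2M; rewrite /predict.
rewrite -RintegralB//; last 2 first.
- exact: integrable_predict_outer k1M.
- exact: integrable_predict_outer k2M.
apply: eq_Rintegral => x /set_mem Dx; rewrite -RintegralB//.
- by apply: eq_Rintegral => y _; rewrite mulrBl.
- exact: integrable_predict_inner k1M _ Dx.
- exact: integrable_predict_inner k2M _ Dx.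
Qed.

End bounded.

Lemma eq_predict (nu : {measure set mR -> \bar R}) (k1 k2 : R -> R) :
  (forall y, D y -> k1 y = k2 y) -> predict D p nu k1 = predict D p nu k2.
Proof.
move=> k12; apply: eq_Rintegral => x _; apply: eq_Rintegral => y /set_mem Dy.
by rewrite k12.
Qed.

End predict.

Section update.
Local Open Scope ereal_scope.
Context (R : realType).
Notation leb := (@lebesgue_measure R).
Notation mR := (measurableTypeR R).
Variables (D : set R) (p g h : R -> R -> R) (M : R) (z : R).
Hypothesis mD : measurable D.
Hypothesis pD : transition_density D p.
Hypothesis mh : measurable_fun setT (h z).
Hypothesis hM : forall y, (0 <= h z y <= M)%R.
Hypothesis hg : forall y, D y -> h z y = g z y.
Variables (nu nu' : {measure set mR -> \bar R}) (f f' : R -> R).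
Hypothesis nuf : has_density nu f.
Hypothesis nuf' : has_density nu' f'.
Hypothesis f1 : \int[leb]_x (f x)%:E = 1.
Hypothesis f'1 : \int[leb]_x (f' x)%:E = 1.

Let mf : measurable_fun setT f. Proof. by case: nuf. Qed.
Let mf' : measurable_fun setT f'. Proof. by case: nuf'. Qed.
Let f0 x : (0 <= f x)%R. Proof. by case: nuf => _ + _; exact. Qed.
Let f'0 x : (0 <= f' x)%R. Proof. by case: nuf' => _ + _; exact. Qed.
Let pI := extended D p.
Let L (y : mR) : \bar R := \int[leb]_x ((f x)%:E * (pI x y)%:E).
Let N := predict D p nu (g z).

Let mL : measurable_fun setT L.
Proof.
apply: (@measurable_fun_integral _ _ _ _ _ leb
  (fun y x : mR => (f x)%:E * (pI x y)%:E)).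
  apply: emeasurable_funM.
    by apply/measurable_EFinP; exact: (measurableT_comp mf).
  exact: (measurable_EFin2 (measurable_extended mD pD)).
by move=> y x; rewrite mule_ge0 ?lee_fin// extended_ge0.
Qed.

Let L0 y : 0 <= L y.
Proof. by apply: integral_ge0 => x _; rewrite mule_ge0 ?lee_fin// extended_ge0. Qed.

Let h0 y : (0 <= h z y)%R. Proof. by case/andP: (hM y). Qed.

Let hL0 y : 0 <= (h z y)%:E * L y. Proof. by rewrite mule_ge0 ?lee_fin. Qed.

Let mhL : measurable_fun setT (fun y : mR => (h z y)%:E * L y).
Proof. by apply: emeasurable_funM => //; exact/measurable_EFinP. Qed.

Let M0 : (0 <= M)%R.
Proof. by case/andP: (hM 0%R) => h00; exact: le_trans. Qed.

Lemma predict_likelihood (k : R -> R) (C : R) : measurable_fun setT k ->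
  (forall x, 0 <= k x <= C)%R ->
  (predict D p nu (fun y => k y * g z y)%R)%:E =
  \int[leb]_y ((k y)%:E * propagate pI h (EFin \o f) z y).
Proof.
move=> mk kC.
rewrite (@eq_predict _ D p nu _ (fun y => k y * h z y)%R); last first.
  by move=> y Dy; rewrite hg.
rewrite (@predictE _ D p mD pD nu f nuf f1 _ (C * M)).
- by apply: eq_integral => y _; rewrite EFinM -muleA.
- exact: measurable_funM.
- by move=> x; case/andP: (kC x) => k0 kC'; case/andP: (hM x) => h0' hM';
    rewrite mulr_ge0//= ler_pM.
Qed.

Let integral_nu' (k : R -> R) : measurable_fun setT k -> (forall x, (0 <= k x)%R) ->
  \int[nu']_x (k x)%:E = \int[leb]_x ((k x)%:E * (f' x)%:E).
Proof.
move=> mk k0; have mfe : measurable_fun setT (fun x : mR => (f' x)%:E) by exact/measurable_EFinP.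
apply: (@ge0_integral_density _ _ _ leb (fun x : mR => (f' x)%:E)) => //.
- by case: nuf'.
- exact/measurable_EFinP.
Qed.

Let nu'T : nu' setT = 1.
Proof. by case: nuf' => _ _ ->. Qed.

Let integral_nu'_fin (k : R -> R) (C : R) : measurable_fun setT k ->
  (forall x, 0 <= k x <= C)%R -> \int[nu']_x (k x)%:E \is a fin_num.
Proof.
move=> mk kC; have k0 x : (0 <= k x)%R by case/andP: (kC x).
rewrite ge0_fin_numE; last by apply: integral_ge0 => x _; rewrite lee_fin.
apply: (@le_lt_trans _ _ (\int[nu']_(x in setT) C%:E)).
  apply: ge0_le_integral => //.
  - by move=> x _; rewrite lee_fin.
  - exact/measurable_EFinP.
  - by move=> x _; rewrite lee_fin; case/andP: (kC x).
by rewrite integral_cst// nu'T mule1 ltry.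
Qed.

(** The update acts on densities by the propagation, up to normalisation. *)
Lemma update_density : (0 < N)%R ->
  (forall phi : R -> R, measurable_fun setT phi ->
    (exists C, forall x, `|phi x| <= C)%R ->
    update D p g z nu phi = (\int[nu']_x phi x)%R) ->
  \forall y \ae leb, (N * f' y)%:E = propagate pI h (EFin \o f) z y.
Proof.
move=> N0 upd.
have mNf : measurable_fun setT (fun y : mR => (N * f' y)%:E).
  by apply/measurable_EFinP; exact: measurable_funM.
have Nf0 y : 0 <= (N * f' y)%:E by rewrite lee_fin mulr_ge0// ltW.
have eqN : ae_eq leb setT (fun y : mR => (N * f' y)%:E)
    (fun y : mR => propagate pI h (EFin \o f) z y).
  apply: integral_ae_eq => //.
    apply/integrableP; split => //.
    have -> : \int[leb]_y `|(N * f' y)%:E| = N%:E * \int[leb]_y (f' y)%:E.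
      rewrite -ge0_integralZl//.
      + by apply: eq_integral => y _; rewrite gee0_abs.
      + exact/measurable_EFinP.
      + by move=> y _; rewrite lee_fin.
      + by rewrite lee_fin ltW.
    by rewrite f'1 mule1 ltry.
  move=> A _ mA.
  have m1A : measurable_fun setT (\1_A : R -> R) by exact: measurable_indic.
  have A01 x : (0 <= (\1_A x : R) <= 1)%R.
    by rewrite indicE; case: (_ \in _); rewrite ?lexx ?ler01.
  rewrite (integral_indicl leb A) [RHS](integral_indicl leb A).
  rewrite -(@predict_likelihood (\1_A) 1%R m1A A01).
  have := upd \1_A m1A; rewrite /update -/N => /(_ _)/(congr1 ( *%R^~ N)).
  rewrite divfK ?gt_eqF// => ->; last first.
    by exists 1%R => x; rewrite ger0_norm; case/andP: (A01 x).
  rewrite /Rintegral EFinM (fineK (integral_nu'_fin m1A A01)).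
  rewrite integral_nu'//.
  rewrite muleC -ge0_integralZl//.
  - by apply: eq_integral => y _; rewrite EFinM muleCA.
  - by apply: emeasurable_funM; exact/measurable_EFinP.
  - by move=> y _; rewrite mule_ge0 ?lee_fin//; case/andP: (A01 y).
  - by rewrite lee_fin ltW.
by apply: (ae_imply eqN) => y /(_ I).
Qed.

(** A test function is split into its positive and negative parts. *)
Lemma density_update : (0 < N)%R ->
  (\forall y \ae leb, (N * f' y)%:E = propagate pI h (EFin \o f) z y) ->
  forall phi : R -> R, measurable_fun setT phi ->
    (exists C, forall x, `|phi x| <= C)%R ->
    update D p g z nu phi = (\int[nu']_x phi x)%R.
Proof.
move=> N0 Nf phi mphi [C phiC].
have pos (k : R -> R) : measurable_fun setT k -> (forall x, 0 <= k x <= C)%R ->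
    predict D p nu (fun y => k y * g z y)%R = (N * \int[nu']_x k x)%R.
  move=> mk kC; have k0 x : (0 <= k x)%R by case/andP: (kC x).
  apply: EFin_inj; rewrite (@predict_likelihood k C mk kC).
  rewrite EFinM /Rintegral (fineK (integral_nu'_fin mk kC)).
  rewrite integral_nu'// -ge0_integralZl//; last 3 first.
  - by apply: emeasurable_funM; exact/measurable_EFinP.
  - by move=> y _; rewrite mule_ge0 ?lee_fin.
  - by rewrite lee_fin ltW.
  apply: ge0_ae_eq_integral => //.
  - by apply: emeasurable_funM => //; exact/measurable_EFinP.
  - apply: emeasurable_funM; first exact: measurable_cst.
    by apply: emeasurable_funM; exact/measurable_EFinP.
  - by move=> y _; apply: mule_ge0; [rewrite lee_fin|exact: hL0].
  - by move=> y _; rewrite !mule_ge0 ?lee_fin// ltW.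
  - by apply: (ae_imply Nf) => y <- _; rewrite EFinM muleCA.
pose k1 x := Num.max (phi x) 0%R; pose k2 x := Num.max (- phi x)%R 0%R.
have mk1 : measurable_fun setT k1 by exact: measurable_maxr.
have mk2 : measurable_fun setT k2.
  by apply: measurable_maxr => //; exact: measurable_funN.
have C0 : (0 <= C)%R by rewrite (le_trans _ (phiC 0%R)).
have k1C x : (0 <= k1 x <= C)%R.
  by rewrite le_max lexx orbT ge_max C0 (le_trans (ler_norm _) (phiC x)).
have k2C x : (0 <= k2 x <= C)%R.
  by rewrite le_max lexx orbT ge_max C0 (le_trans _ (phiC x))// -normrN ler_norm.
have phiE x : phi x = (k1 x - k2 x)%R.
  rewrite /k1 /k2; case: (leP (phi x) 0%R) => px; case: (leP (- phi x)%R 0%R) => npx; lra.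
rewrite /update -/N.
have -> : predict D p nu (fun y => phi y * g z y)%R =
    predict D p nu (fun y => k1 y * h z y - k2 y * h z y)%R.
  by apply: eq_predict => y Dy; rewrite phiE hg// mulrBl.
rewrite (@predictB _ D p mD pD nu f nuf f1 _ _ (C * M)); last 4 first.
- exact: measurable_funM.
- exact: measurable_funM.
- by move=> x; case/andP: (k1C x) => ? ?; case/andP: (hM x) => ? ?; rewrite mulr_ge0//= ler_pM.
- by move=> x; case/andP: (k2C x) => ? ?; case/andP: (hM x) => ? ?; rewrite mulr_ge0//= ler_pM.
have E k : predict D p nu (fun y => k y * h z y)%R = predict D p nu (fun y => k y * g z y)%R.
  by apply: eq_predict => y Dy; rewrite hg.
rewrite !E !pos// -mulrBr mulrAC mulfV ?gt_eqF// mul1r -RintegralB//.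
- by apply: eq_Rintegral => x _; rewrite phiE.
- apply/integrableP; split; first exact/measurable_EFinP.
  under eq_integral do rewrite gee0_abs ?lee_fin ?(andP (k1C _)).1//.
  by have := integral_nu'_fin mk1 k1C; rewrite fin_numElt => /andP[].
- apply/integrableP; split; first exact/measurable_EFinP.
  under eq_integral do rewrite gee0_abs ?lee_fin ?(andP (k2C _)).1//.
  by have := integral_nu'_fin mk2 k2C; rewrite fin_numElt => /andP[].
Qed.

End update.

(** * The observation density *)

Section observation_model.
Local Open Scope ereal_scope.
Context (R : realType).
Notation leb := (@lebesgue_measure R).
Notation mR := (measurableTypeR R).

Lemma lipschitz_measurable (D : set R) (s : R -> R) : measurable D ->
  [lipschitz s x | x in D] -> measurable_fun D s.
Proof.
move=> mD [k [k_real lips]]; apply: subspace_continuous_measurable_fun => //.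
apply/subspace_continuousP => x Dx; apply/cvgrPdist_lt => e e0.
pose K := (Num.max k 0 + 1)%R.
have K0 : (0 < K)%R by rewrite ltr_wpDl// le_max lexx orbT.
have kK : (k < K)%R by rewrite ltr_pwDr// le_max lexx.
rewrite /within/=; apply/nbhs_ballP; exists (e / K)%R; first by rewrite /= divr_gt0.
move=> y /= xy Dy; have := lips _ kK (x, y) (conj Dx Dy) => /=.
move/le_lt_trans; apply; rewrite mulrC -ltr_pdivlMr//.
Qed.

Variables (D : set R) (s psi : R -> R) (eps : R).
Hypothesis mD : measurable D.
Hypothesis ms : measurable_fun D s.
Hypothesis s0 : forall x, D x -> (0 < s x)%R.
Hypothesis psi0 : forall t, (0 <= psi t)%R.
Hypothesis mpsi : measurable_fun setT psi.
Hypothesis psi1 : \int[leb]_t (psi t)%:E = 1.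
Hypothesis psi_supp : forall t, (psi t != 0 -> - eps <= t <= eps)%R.

(** Extended by a positive constant, so that the noise is not degenerate
    anywhere. *)
Definition noise_scale (x : R) : R := if x \in D then s x else 1%R.
Local Notation sD := noise_scale.

Lemma noise_scale_gt0 x : (0 < sD x)%R.
Proof. by rewrite /sD; case: ifPn => // /set_mem; exact: s0. Qed.

Lemma measurable_noise_scale : measurable_fun setT sD.
Proof.
have -> : sD = (fun x => (s \_ D) x + \1_(~` D) x)%R.
  apply/funext => x; rewrite /sD patchE indicE in_setC.
  by case: (x \in D); rewrite ?addr0 ?add0r.
apply: measurable_funD; first exact/(measurable_restrictT _ mD).
by apply: measurable_indic; exact: measurableC.
Qed.

Definition noise_density (z x : R) : R := ((sD x)^-1 * psi ((z - x) / sD x))%R.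
Local Notation g1 := noise_density.

Lemma noise_density_ge0 z x : (0 <= g1 z x)%R.
Proof. by rewrite mulr_ge0// invr_ge0 ltW// noise_scale_gt0. Qed.

Lemma measurable_noise_density : measurable_fun setT (fun u : R * R => g1 u.1 u.2).
Proof.
have mV : measurable_fun setT (fun x => (sD x)^-1)%R.
  have -> : (fun x => (sD x)^-1)%R = (@powR R ^~ (-1)%R) \o sD.
    by apply/funext => x /=; rewrite powR_inv1// ltW// noise_scale_gt0.
  exact: measurableT_comp measurable_noise_scale.
have msV : measurable_fun setT (fun u : R * R => (sD u.2)^-1)%R.
  exact: (measurableT_comp mV measurable_snd).
apply: measurable_funM => //; apply: (measurableT_comp mpsi).
by apply: measurable_funM => //; exact: measurable_funB.
Qed.

Lemma integral_noise_density x : \int[leb]_z (g1 z x)%:E = 1.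
Proof.
have sx := noise_scale_gt0 x.
have mgx : measurable_fun setT (fun z : R => (g1 z x)%:E).
  apply/measurable_EFinP.
  exact: (measurableT_comp measurable_noise_density (measurable_pair2 x)).
rewrite (ge0_integral_affine x sx mgx); last by move=> z; rewrite lee_fin noise_density_ge0.
rewrite -ge0_integralZl//; last 3 first.
- have mt : measurable_fun setT (fun t : R => x + sD x * t)%R.
    by apply: measurable_funD => //; exact: measurable_funM.
  exact: (measurableT_comp mgx mt).
- by move=> z _; rewrite lee_fin noise_density_ge0.
- by rewrite lee_fin ltW.
rewrite -psi1; apply: eq_integral => t _; rewrite -EFinM /g1 mulrA mulfV ?gt_eqF// mul1r.
by rewrite addrAC subrr add0r mulrAC mulfV ?gt_eqF// mul1r.
Qed.

(** Cut off in both arguments, so that all integrals run over the whole line. *)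
Definition obs_likelihood (z x : R) : R := (\1_D z * \1_D x * g1 z x)%R.
Local Notation gD := obs_likelihood.

Lemma obs_likelihoodE z x : D z -> D x -> gD z x = obs_density s psi eps z x.
Proof.
move=> Dz Dx; rewrite /gD !indicE !mem_set// !mul1r /g1 /obs_density.
rewrite /sD mem_set//; have sx := s0 Dx.
have [->|psi_neq0] := eqVneq (psi ((z - x) / s x)) 0%R; first by rewrite !(mulr0, mul0r).
have /andP[] := psi_supp psi_neq0.
rewrite ler_pdivlMr// ler_pdivrMr// => lo hi.
rewrite indicE mem_set ?mulr1//= in_itv/=; apply/andP; split.
  by move: lo; rewrite mulNr; lra.
by move: hi; lra.
Qed.

Lemma obs_likelihood_ge0 z x : (0 <= gD z x)%R.
Proof. by apply: mulr_ge0; [rewrite mulr_ge0|exact: noise_density_ge0]. Qed.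

Lemma obs_likelihood_le z x : (gD z x <= \1_D x * g1 z x)%R.
Proof.
rewrite /gD -mulrA; apply: ler_piMl; first by rewrite mulr_ge0// noise_density_ge0.
by rewrite indicE; case: (_ \in _).
Qed.

Lemma measurable_obs_likelihood : measurable_fun setT (fun u : R * R => gD u.1 u.2).
Proof.
have m1 : measurable_fun setT (\1_D : R -> R) by exact: measurable_indic.
apply: measurable_funM; last exact: measurable_noise_density.
by apply: measurable_funM; exact: (measurableT_comp m1).
Qed.

Lemma integral_obs_likelihood_le x : \int[leb]_z (gD z x)%:E <= (\1_D x)%:E.
Proof.
have mgx (k : R -> R -> R) : measurable_fun setT (fun u : R * R => k u.1 u.2) ->
    measurable_fun setT (fun z : R => (k z x)%:E).
  move=> mk; apply/measurable_EFinP.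
  exact: (measurableT_comp mk (measurable_pair2 x)).
rewrite -[leRHS]mule1 -[X in _ <= _ * X](integral_noise_density x) -ge0_integralZl//; last 2 first.
- exact: (mgx g1 measurable_noise_density).
- by move=> z _; rewrite lee_fin noise_density_ge0.
apply: ge0_le_integral => //.
- by move=> z _; rewrite lee_fin obs_likelihood_ge0.
- exact: (mgx gD measurable_obs_likelihood).
- apply: emeasurable_funM => //.
  exact: (mgx g1 measurable_noise_density).
- by move=> z _; rewrite -EFinM lee_fin obs_likelihood_le.
Qed.

End observation_model.

(** * Existence and uniqueness of the equivariant measure *)

Section equivariant.
Local Open Scope ereal_scope.
Context (R : realType).
Notation leb := (@lebesgue_measure R).
Notation mR := (measurableTypeR R).
Notation path := (path_space R).
Variables (D : set R) (p g h : R -> R -> R) (M : R).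
Variable m : probability (path_space R) R.
Hypothesis mD : measurable D.
Hypothesis pD : transition_density D p.
Hypothesis mh : measurable_fun setT (fun u : R * R => h u.1 u.2).
Hypothesis hM : forall z y, (0 <= h z y <= M)%R.
Hypothesis hg : forall z y, D z -> D y -> h z y = g z y.
Hypothesis hD : forall z y, ~ D y -> h z y = 0%R.
Hypothesis m_erg : invariant_ergodic m.
Hypothesis obsD : \forall w \ae m, D ((w : path) 1%R).2.

Let pI := extended D p.
Let mp := measurable_extended mD pD.
Let p0 x y : (0 <= pI x y)%R := extended_ge0 pD x y.
Let h0 z y : (0 <= h z y)%R. Proof. by case/andP: (hM z y). Qed.
Let m_inv : forall A, measurable A -> m (@Defs.shift R @^-1` A) = m A.
Proof. by case: m_erg. Qed.

Hypothesis m_step : hidden_markov m pI h.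

Let mhz z : measurable_fun setT (h z).
Proof. exact: (measurableT_comp mh (measurable_pair1 z)). Qed.

Let f := filter_density m.
Let mf : measurable_fun setT f := measurable_filter_density mp p0 mh h0 m_inv m_step.
Let f0 v : 0 <= f v := filter_density_ge0 mp p0 mh h0 m_inv m_step v.
Let ffin v : f v \is a fin_num := filter_density_fin_num mp p0 mh h0 m_inv m_step v.

Let shift_back w : Defs.shift (shiftn (- 1) w) = w :> path.
Proof. by apply/funext => n; rewrite /shiftn /Defs.shift -addrA subrr addr0. Qed.

(** Bayes' rule writes the density as a multiple of the likelihood. *)
Lemma filter_support : \forall w \ae m, \forall x \ae leb,
  ~ obs_support D g (w 0%R).2 x -> f (obs_past w, x) = 0.
Proof.
have B := ae_shiftn m_inv (-1) (bayes mp p0 mh h0 m_inv m_step).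
have E := ae_shiftn m_inv (-1) (evidence_gt0 mp p0 mh h0 m_inv m_step).
have Z := ae_shiftn m_inv (-1) obsD.
apply: (ae_imply2 B (filterI E Z)) => w Bw [Ew Zw].
apply: (ae_imply Bw) => x; rewrite shift_back => + Jx.
have z0 : (at_time 1 (shiftn (-1) w)).2 = (w 0%R).2 by rewrite /at_time /shiftn subrr.
move: Ew Zw; rewrite [X in D X]z0 z0 => Ew Dz.
have -> : unnormalized m pI h (obs_past (shiftn (-1) w)) (w 0%R).2 x = 0.
  rewrite /unnormalized; have [Dx|Dx] := pselect (D x); last by rewrite hD// mule0.
  rewrite hg//; have [->|gx] := eqVneq (g (w 0%R).2 x) 0%R; first by rewrite mule0.
  by case: Jx; apply: subset_closure.
by move/esym/eqP; rewrite mule_eq0 gt_eqF//= => /eqP.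
Qed.

Lemma filter_law_density w : \int[leb]_x f (obs_past w, x) = 1 ->
  (\forall x \ae leb, ~ obs_support D g (w 0%R).2 x -> f (obs_past w, x) = 0) ->
  exists fr : R -> R, [/\ cone0 (obs_support D g (w 0%R).2) fr,
    has_density (filter_law mf f0 w) fr,
    \int[leb]_x (fr x)%:E = 1 &
    \forall x \ae leb, (fr x)%:E = f (obs_past w, x)].
Proof.
move=> fw1 fwJ; set J := obs_support D g (w 0%R).2.
have mJ : measurable J by apply: closed_measurable; exact: closed_closure.
pose fr x := (\1_J x * fine (f (obs_past w, x)))%R.
have mfw : measurable_fun setT (fun x : mR => f (obs_past w, x)).
  exact: (measurableT_comp mf (measurable_pair1 (obs_past w))).
have mfr : measurable_fun setT fr.
  apply: measurable_funM; first exact: measurable_indic.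
  exact: (measurableT_comp (fine_measurable measurableT) mfw).
have mfre : measurable_fun setT (fun x : mR => (fr x)%:E) by exact/measurable_EFinP.
have fr0 x : (0 <= fr x)%R by rewrite mulr_ge0// fine_ge0.
have frE : \forall x \ae leb, (fr x)%:E = f (obs_past w, x).
  apply: (ae_imply fwJ) => x Jx; rewrite /fr indicE.
  case: (boolP (x \in J)) => [_|/negP xJ].
    by rewrite mul1r fineK.
  by rewrite mul0r Jx// => /mem_set.
have fr1 : \int[leb]_x (fr x)%:E = 1.
  rewrite -fw1; apply: ge0_ae_eq_integral => //.
  - by move=> x _; rewrite lee_fin.
  - by apply: (ae_imply frE) => x -> _.
exists fr; split => //.
- split => //.
  + by move=> x Jx; rewrite /fr indicE memNset// mul0r.
  + apply/integrableP; split => //.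
    under eq_integral do rewrite /comp gee0_abs ?lee_fin ?fr0//.
    by rewrite fr1 ltry.
  + move=> frz; have : \int[leb]_x (fr x)%:E = 0.
      have /(_ _)/= := ge0_integral_eq0P leb mfre.
      move=> /(_ (fun x => fr0 x)) [_]; apply.
      by apply: (ae_imply frz) => x /(_ I) ->.
    by rewrite fr1 => /eqP; rewrite onee_eq0.
- split => // A mA; rewrite filter_lawE [LHS](integral_indicl leb A) [RHS](integral_indicl leb A).
  have m1A : measurable_fun setT (fun x : mR => (\1_A x : R)%:E) by exact/measurable_EFinP.
  apply: ge0_ae_eq_integral => //.
  + by apply: emeasurable_funM => //; exact: measurable_path_density.
  + exact: emeasurable_funM.
  + by move=> x _; rewrite mule_ge0 ?lee_fin ?path_density_ge0.
  + by move=> x _; rewrite mule_ge0 ?lee_fin.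
  + by apply: (ae_imply frE) => x -> _; rewrite /path_density fw1 eqxx.
Qed.

Lemma filter_equivariant : ac_equivariant D p g m (filter_kernel mf f0).
Proof.
have T := filter_density_integral1 mp p0 mh h0 m_inv m_step.
have Ts := ae_shiftn m_inv 1 T.
have S := filter_support.
have Ss := ae_shiftn m_inv 1 S.
have B := bayes mp p0 mh h0 m_inv m_step.
have E := evidence_gt0 mp p0 mh h0 m_inv m_step.
apply: (ae_imply2 (filterI (filterI T S) (filterI Ts Ss)) (filterI (filterI B E) obsD)).
move=> w [[Tw Sw] [Tsw Ssw]] [[Bw Ew] Dz].
have [fr [cfr dfr fr1 frE]] := filter_law_density Tw Sw.
have [fr' [_ dfr' fr'1 fr'E]] := filter_law_density Tsw Ssw.
have propE y : propagate pI h (EFin \o fr) (w 1%R).2 y =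
    unnormalized m pI h (obs_past w) (w 1%R).2 y.
  rewrite /propagate /unnormalized muleC; congr (_ * _).
  have mpy : measurable_fun setT (fun x : mR => (pI x y)%:E).
    by apply: (measurable_EFin2 mp) => //; exact: measurable_cst.
  have mfw : measurable_fun setT (fun x : mR => f (obs_past w, x)).
    exact: (measurableT_comp mf (measurable_pair1 (obs_past w))).
  have mfre : measurable_fun setT (EFin \o fr).
    by case: dfr => mfr _ _; exact/measurable_EFinP.
  have fr0 x : (0 <= fr x)%R by case: dfr => _ + _; exact.
  apply: ge0_ae_eq_integral => //.
  - exact: emeasurable_funM.
  - exact: emeasurable_funM.
  - by move=> x _; rewrite mule_ge0 ?lee_fin.
  - by move=> x _; rewrite mule_ge0 ?lee_fin ?f0.
  - by apply: (ae_imply frE) => x /= -> _.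
have NE : (predict D p (filter_law mf f0 w) (g (w 1%R).2))%:E =
    evidence m pI h (obs_past w) (w 1%R).2.
  rewrite (@eq_predict _ D p _ _ (fun y => cst 1 y * g (w 1%R).2 y)%R); last first.
    by move=> y _; rewrite mul1r.
  rewrite (@predict_likelihood _ D p g h M (w 1%R).2 mD pD (mhz _) (hM _) (fun y => hg Dz (y := y))
    _ fr dfr fr1 (cst 1%R) 1%R)//; last by move=> x; rewrite ler01 lexx.
  by apply: eq_integral => y _; rewrite mul1e propE.
have N0 : (0 < predict D p (filter_law mf f0 w) (g (w 1%R).2))%R.
  by rewrite -lte_fin NE; exact: Ew.
split => //; first exact: filter_lawT.
- by exists fr.
- apply: (@density_update _ D p g h M (w 1%R).2 mD pD (mhz _) (hM _) (fun y => hg Dz (y := y))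
    _ _ fr fr' dfr dfr' fr1 fr'1) => //.
  apply: (ae_imply2 Bw fr'E) => y By fy; rewrite propE By EFinM NE.
  by congr (_ * _).
Qed.

Variables (c l delta B : R) (W : set (mR * mR)).
Hypothesis B0 : (0 < B)%R.
Hypothesis pB : forall x y, (pI x y <= B)%R.
Hypothesis mW : measurable W.
Hypothesis c0 : (0 < c)%R.
Hypothesis Wc : forall z y, W (z, y) ->
  \forall x \ae leb, h z x != 0%R -> (c <= pI x y)%R.
Hypothesis delta0 : (0 < delta)%R.
Hypothesis fm0 : 0 < m (frequent_merging pI h W delta).

Section pair.
Variables nu nu' : path -> {measure set mR -> \bar R}.

Definition agree (w : path) := forall A, measurable A -> nu w A = nu' w A.

Let cocycle_at (w : path) (k : path -> {measure set mR -> \bar R}) :=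
  [/\ k w setT = 1,
    (exists2 f, cone0 (obs_support D g (w 0%R).2) f & has_density (k w) f),
    (0 < predict D p (k w) (g (w 1%R).2))%R &
    forall phi : R -> R, measurable_fun setT phi ->
      (exists M, forall x, `|phi x| <= M)%R ->
      Defs.filter_map D p g w (k w) phi = (\int[k (Defs.shift w)]_x phi x)%R].

Let agree_shift w : cocycle_at w nu -> cocycle_at w nu' ->
  nu (Defs.shift w) setT = 1 -> nu' (Defs.shift w) setT = 1 ->
  agree w -> agree (Defs.shift w).
Proof.
move=> [_ _ _ upd] [_ _ _ upd'] T1 T1' agr A mA.
have m1A : measurable_fun setT (\1_A : R -> R) by exact: measurable_indic.
have A1 : exists C, forall x, (`|\1_A x : R| <= C)%R.
  by exists 1%R => x; rewrite indicE; case: (_ \in _); rewrite ?normr1 ?normr0.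
have := upd \1_A m1A A1; have := upd' \1_A m1A A1.
have -> : Defs.filter_map D p g w (nu w) \1_A = Defs.filter_map D p g w (nu' w) \1_A.
  have eqp k : predict D p (nu w) k = predict D p (nu' w) k.
    rewrite /predict /Rintegral; congr fine.
    by apply: eq_measure_integral => C mC _; exact: agr.
  by rewrite /Defs.filter_map /update !eqp.
have fin (k : {measure set mR -> \bar R}) : k setT = 1 -> k A \is a fin_num.
  move=> k1; rewrite ge0_fin_numE// (@le_lt_trans _ _ 1) ?ltry// -k1.
  by apply: le_measure; rewrite ?inE.
rewrite /Rintegral !integral_indic// !setIT => -> eqA.
by rewrite -(fineK (fin _ T1)) -(fineK (fin _ T1')) eqA.
Qed.

Let density_step w k fk fk' : D (w 1%R).2 -> cocycle_at w k ->
  has_density (k w) fk -> has_density (k (Defs.shift w)) fk' ->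
  k (Defs.shift w) setT = 1 ->
  \forall y \ae leb, (predict D p (k w) (g (w 1%R).2) * fk' y)%:E =
    propagate pI h (EFin \o fk) (w 1%R).2 y.
Proof.
move=> Dz [k1 _ N0 upd] dk dk' k'1.
have fk1 : \int[leb]_x (fk x)%:E = 1 by rewrite -k1; case: dk => _ _ ->.
have fk'1 : \int[leb]_x (fk' x)%:E = 1 by rewrite -k'1; case: dk' => _ _ ->.
exact: (@update_density _ D p g h M (w 1%R).2 mD pD (mhz _) (hM _) (fun y => hg Dz (y := y))
    _ _ fk fk' dk dk' fk1 fk'1).
Qed.

(** The past densities, rescaled so that the propagation needs no
    normalisation. *)
Let rescaled_past w k : (forall n : nat, D ((shiftn (- n%:Z) w) 1%R).2 /\
    cocycle_at (shiftn (- n%:Z) w) k) ->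
  exists F : nat -> mR -> R,
    [/\ forall j, measurable_fun setT (F j), forall j x, (0 <= F j x)%R,
      forall j, \forall y \ae leb,
        (F j y)%:E = propagate pI h (EFin \o F j.+1) (obs_past w j) y,
      \int[leb]_x (F 0%N x)%:E = 1 & has_density (k w) (F 0%N)].
Proof.
move=> H.
have back (j : nat) : Defs.shift (shiftn (- j.+1%:Z) w) = shiftn (- j%:Z) w :> path.
  apply/funext => n; rewrite /shiftn /Defs.shift; congr w.
  by rewrite -addn1 PoszD opprD addrACA subrr addr0.
have obs (j : nat) : ((shiftn (- j.+1%:Z) w) 1%R).2 = obs_past w j.
  rewrite /shiftn /obs_past; congr (w _).2.
  by rewrite -addn1 PoszD opprD addrCA subrr addr0.
have [fk dk] : {fk : nat -> R -> R &
    forall j : nat, has_density (k (shiftn (- j%:Z) w)) (fk j)}.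
  apply: (@choice _ _ (fun (j : nat) fj => has_density (k (shiftn (- j%:Z) w)) fj)).
  by move=> j; have [_ [_ [fj _ dj] _ _]] := H j; exists fj.
pose N (j : nat) : R := predict D p (k (shiftn (- j.+1%:Z) w)) (g (obs_past w j)).
have N0 (j : nat) : (0 < N j)%R.
  by have [_ [_ _ + _]] := H j.+1; rewrite obs.
pose C (j : nat) : R := (\prod_(i < j) N i)%R.
have C0 j : (0 < C j)%R by apply: prodr_gt0.
pose F (j : nat) (x : mR) : R := ((C j)^-1 * fk j x)%R.
have mfk j : measurable_fun setT (fk j) by case: (dk j).
have fk0 j x : (0 <= fk j x)%R by case: (dk j) => _ + _; exact.
have F00 : F 0%N = fk 0%N by apply/funext => x; rewrite /F /C big_ord0 invr1 mul1r.
have dk0 := dk 0%N; rewrite oppr0 shiftn0 in dk0.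
exists F; rewrite F00; split => //.
- by move=> j; rewrite /F; apply: measurable_funM => //; exact: mfk.
- by move=> j x; rewrite mulr_ge0// invr_ge0 ltW.
- move=> j; have [Dz coc] := H j.+1.
  have k1 : k (Defs.shift (shiftn (- j.+1%:Z) w)) setT = 1.
    by rewrite back; have [_ []] := H j.
  have dkj := dk j; rewrite -back in dkj.
  apply: (ae_imply (density_step Dz coc (dk j.+1) dkj k1)) => y.
  rewrite obs -/(N j) => E.
  have -> : propagate pI h (EFin \o F j.+1) (obs_past w j) y =
      ((C j.+1)^-1)%:E * propagate pI h (EFin \o fk j.+1) (obs_past w j) y.
    rewrite /propagate muleCA; congr (_ * _); rewrite -ge0_integralZl//.
    + by apply: eq_integral => x _; rewrite /F /= EFinM muleA.
    + apply: emeasurable_funM; first by apply/measurable_EFinP; exact: mfk.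
      by apply: (measurable_EFin2 mp) => //; exact: measurable_cst.
    + by move=> x _; rewrite mule_ge0 ?lee_fin.
    + by rewrite lee_fin invr_ge0 ltW.
  rewrite -E -EFinM /F /C big_ord_recr /=; congr EFin.
  rewrite invfM -!mulrA; congr (_ * _)%R.
  by rewrite mulrA mulVf ?mul1r// gt_eqF.
- by have [_ [+ _ _ _]] := H 0%N; rewrite oppr0 shiftn0 => <-; case: dk0 => _ _ ->.
Qed.

(** The two families agree at a path with frequent mergings, and from there on. *)
Lemma equivariant_agree : ac_equivariant D p g m nu -> ac_equivariant D p g m nu' ->
  \forall w \ae m, agree w.
Proof.
move=> eqnu eqnu'.
pose G w := [/\ D (w 1%R).2, cocycle_at w nu & cocycle_at w nu'].
have aeG : \forall w \ae m, G w.
  by apply: (ae_imply2 obsD (filterI eqnu eqnu')) => w Dw [? ?]; split.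
have aeGn : \forall w \ae m, forall n : nat, G (shiftn (- n%:Z) w).
  by apply: ae_foralln => n; exact: (ae_shiftn m_inv).
have mfm : measurable (frequent_merging pI h W delta).
  exact: measurable_frequent_merging.
have rec := ae_past_recurrent m_erg mfm fm0.
apply: (ae_imply2 aeGn rec) => w Gw [k recw].
have Gk (i n : nat) : (i <= k)%N ->
    G (shiftn (- n%:Z) (shiftn (- (k - i)%N%:Z) w)).
  by move=> ik; rewrite shiftnD -opprD -PoszD; exact: Gw.
have start : agree (shiftn (- k%:Z) w).
  set v := shiftn (- k%:Z) w.
  have Gv (n : nat) : G (shiftn (- n%:Z) v).
    by have := Gk 0%N n (leq0n _); rewrite subn0.
  have [F [mF F0 FE F1 dF]] := rescaled_past (fun n => let: And3 a b _ := Gv n in conj a b).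
  have [F' [mF' F'0 F'E F'1 dF']] := rescaled_past (fun n => let: And3 a _ b := Gv n in conj a b).
  have FF : \forall x \ae leb, F 0%N x = F' 0%N x.
    apply: (filter_past_unique mp p0 mh h0 B0 pB mW c0 Wc mF mF' F0 F'0 FE F'E F1 F'1 delta0).
    move=> n; have [j /= nj good] := recw n I; exists j => //.
    by rewrite leNgt; apply/negP.
  move=> A mA; case: dF => _ _ ->//; case: dF' => _ _ ->//.
  rewrite [LHS](integral_indicl leb A) [RHS](integral_indicl leb A).
  have m1A : measurable_fun setT (fun x : mR => (\1_A x : R)%:E) by exact/measurable_EFinP.
  apply: ge0_ae_eq_integral => //.
  - by apply: emeasurable_funM => //; exact/measurable_EFinP.
  - by apply: emeasurable_funM => //; exact/measurable_EFinP.
  - by move=> x _; rewrite mule_ge0 ?lee_fin.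
  - by move=> x _; rewrite mule_ge0 ?lee_fin.
  - by apply: (ae_imply FF) => x -> _.
have forward (i : nat) : (i <= k)%N -> agree (shiftn (- (k - i)%N%:Z) w).
  elim: i => [|i IHi] ik; first by rewrite subn0.
  have fw : Defs.shift (shiftn (- (k - i)%N%:Z) w) = shiftn (- (k - i.+1)%N%:Z) w :> path.
    apply/funext => n; rewrite /shiftn /Defs.shift; congr w.
    by rewrite -(subnSK ik) -addn1 PoszD opprD addrACA subrr addr0.
  have G0 j : (j <= k)%N -> G (shiftn (- (k - j)%N%:Z) w).
    by move=> jk; have := Gk j 0%N jk; rewrite oppr0 shiftn0.
  have [_ c1 c1'] := G0 _ (ltnW ik); have [_ [t _ _ _] [t' _ _ _]] := G0 _ ik.
  by rewrite -fw; apply: agree_shift => //; rewrite ?fw//; exact/IHi/ltnW.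
by have := forward k (leqnn k); rewrite subnn oppr0 shiftn0.
Qed.

End pair.

End equivariant.

(** * Mergings have positive probability *)

Section model.
Local Open Scope ereal_scope.
Context (R : realType).
Notation leb := (@lebesgue_measure R).
Notation mR := (measurableTypeR R).
Notation path := (path_space R).
Notation H := (history R).
Variables (a b : R) (p : R -> R -> R) (s psi : R -> R) (eps : R).
Context (d : measure_display) (Omega : measurableType d) (P : probability Omega R).
Variables (X Z xi : int -> {RV P >-> R}).
Variables (c : R) (I' : set R).
Let D : set R := `[a, b]%classic.
Let g := obs_density s psi eps.
Let m := distribution P (joint_path X Z).

Hypothesis pD : transition_density D p.
Hypothesis Xmarkov : markov_chain P D p X.
Hypothesis xid : forall n, has_density (distribution P (xi n)) psi.
Hypothesis psi_supp : forall t, (psi t != 0 -> - eps <= t <= eps)%R.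
Hypothesis xii : mutually_independent P xi.
Hypothesis Xxi : independent_processes P X xi.
Hypothesis s0 : forall x, D x -> (0 < s x)%R.
Hypothesis lips : [lipschitz s x | x in D].
Hypothesis ZE : forall n w, Z n w = (X n w + s (X n w) * xi n w)%R.
Hypothesis ZD : forall n, \forall w \ae P, D (Z n w).
Hypothesis m_erg : invariant_ergodic m.
Hypothesis c0 : (0 < c)%R.
Hypothesis pc : forall x y, D x -> D y -> (p x y < c^-1)%R.
Hypothesis gc : forall z x, D z -> D x -> (g z x < c^-1)%R.

Let mD : measurable D. Proof. exact: measurable_itv. Qed.
Let ms : measurable_fun D s := lipschitz_measurable mD lips.
Let mpsi : measurable_fun setT psi. Proof. by case: (xid 0%R). Qed.
Let psi0 t : (0 <= psi t)%R. Proof. by case: (xid 0%R) => _ + _; exact. Qed.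
Let psi1 : \int[leb]_t (psi t)%:E = 1.
Proof. by case: (xid 0%R) => _ _ <-//; exact: probability_setT. Qed.
Let m_inv : forall A, measurable A -> m (@Defs.shift R @^-1` A) = m A.
Proof. by case: m_erg. Qed.

Let pI := extended D p.
Let sD := noise_scale D s.
Let g1 := noise_density D s psi.
Let h := obs_likelihood D s psi.
Let mp := measurable_extended mD pD.
Let p0 x y : (0 <= pI x y)%R := extended_ge0 pD x y.
Let mg1 : measurable_fun setT (fun u : R * R => g1 u.1 u.2) :=
  measurable_noise_density mD ms s0 mpsi.
Let mh : measurable_fun setT (fun u : R * R => h u.1 u.2) :=
  measurable_obs_likelihood mD ms s0 mpsi.
Let h0 z x : (0 <= h z x)%R. Proof. exact: obs_likelihood_ge0. Qed.
Let g10 z x : (0 <= g1 z x)%R. Proof. exact: noise_density_ge0. Qed.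

Lemma extended_le x y : (pI x y <= c^-1)%R.
Proof.
have [Dx|Dx] := pselect (D x); last by rewrite /pI extended0l// invr_ge0 ltW.
have [Dy|Dy] := pselect (D y); last by rewrite /pI extended0r// invr_ge0 ltW.
by rewrite /pI extendedE// ltW// pc.
Qed.

Let hg z y : D z -> D y -> h z y = g z y.
Proof. exact: obs_likelihoodE. Qed.

Let hD z y : ~ D y -> h z y = 0%R.
Proof. by move=> Dy; rewrite /h /obs_likelihood [\1_D y]indicE memNset// mulr0 mul0r. Qed.

Let hDl z y : ~ D z -> h z y = 0%R.
Proof. by move=> Dz; rewrite /h /obs_likelihood indicE memNset// !mul0r. Qed.

Lemma likelihood_le z x : (0 <= h z x <= c^-1)%R.
Proof.
rewrite h0/=; have [Dx|Dx] := pselect (D x); last by rewrite hD// invr_ge0 ltW.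
have [Dz|Dz] := pselect (D z); last by rewrite hDl// invr_ge0 ltW.
by rewrite hg// ltW// gc.
Qed.

Lemma step_noise : hidden_markov m pI g1.
Proof.
have [XD markov] := Xmarkov.
move=> F mF F0; apply: (@one_step R _ _ P X Z xi pI sD psi c^-1) => //.
- exact: extended_le.
- exact: measurable_noise_scale.
- by move=> x; exact: noise_scale_gt0.
- move=> E A sE mA; have := markov 0%R E A sE mA; rewrite add0r => ->.
  by apply: eq_integral => w _; rewrite integral_extended.
- by move=> n w; rewrite ZE /sD /noise_scale mem_set.
Qed.

Lemma ae_coordinate (n : int) (S : set (mR * mR)) : measurable S ->
  (\forall w \ae P, S (X n w, Z n w)) -> \forall w \ae m, S ((w : path) n).
Proof.
move=> mS [N [mN N0 SN]]; exists (@at_time R n @^-1` ~` S).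
have mE : measurable (@at_time R n @^-1` ~` S).
  rewrite -[X in measurable X]setTI; apply: (@measurable_at_time R n) => //.
  exact: measurableC.
split => //; rewrite /m /distribution /pushforward.
apply: subset_measure0 N0 => //.
have mj := @measurable_joint_path R _ Omega X Z.
by have := mj measurableT _ mE; rewrite setTI.
Qed.

Lemma obs_in_interval : \forall w \ae m, D ((w : path) 1%R).2.
Proof.
apply: (ae_coordinate (n := 1%R) (S := [set u : mR * mR | D u.2])).
  rewrite -[X in measurable X]setTI.
  by apply: (@measurable_snd _ _ mR mR); [exact: measurableT|exact: mD].
exact: ZD.
Qed.

(** As the observations stay in the state space, the noise density can be cut
    off outside it. *)
Lemma step_likelihood : hidden_markov m pI h.
Proof.
move=> F mF F0.
pose G (u : history (R * R)%type * (R * R)) := (\1_D u.2.2)%:E * F u.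
have mG : measurable_fun setT G.
  apply: emeasurable_funM => //; apply/measurable_EFinP.
  apply: (measurableT_comp (f := \1_D : R -> R)); first exact: measurable_indic.
  exact: measurableT_comp measurable_snd measurable_snd.
have G0 u : 0 <= G u by rewrite mule_ge0 ?lee_fin.
have mpast : measurable_fun setT (fun w : path => (past w, at_time 1 w)).
  apply: measurable_fun_pair; first exact: measurable_past.
  exact: measurable_at_time.
transitivity (\int[m]_w G (past w, at_time 1 w)).
  apply: ge0_ae_eq_integral => //.
  - exact: (measurableT_comp mF mpast).
  - exact: (measurableT_comp mG mpast).
  - by apply: (ae_imply obs_in_interval) => w Dw _; rewrite /G /= indicE mem_set// mul1e.
rewrite (step_noise mG G0); apply: eq_integral => w _.
apply: eq_integral => x _; apply: eq_integral => z _.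
rewrite /G /= muleA -EFinM; congr (_%:E * _); rewrite /h /obs_likelihood -/g1.
have [Dx|Dx] := pselect (D x); last by rewrite /pI extended0r// !mul0r.
have -> : \1_D x = 1%R :> R by rewrite indicE mem_set.
by rewrite mulr1 -mulrA (mulrC (g1 z x)).
Qed.

Definition unreached : set ((mR * mR) * mR) :=
  [set v | h v.1.1 v.2 != 0%R /\ (pI v.2 v.1.2 < c)%R].

Lemma measurable_unreached : measurable unreached.
Proof.
have m1 : measurable_fun setT (fun v : (mR * mR) * mR => (h v.1.1 v.2)%:E).
  apply: (measurable_EFin2 mh) => //.
  exact: measurableT_comp measurable_fst measurable_fst.
have m2 : measurable_fun setT (fun v : (mR * mR) * mR => (pI v.2 v.1.2)%:E).
  apply: (measurable_EFin2 mp) => //.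
  exact: measurableT_comp measurable_snd measurable_fst.
have -> : unreached = (setT `&` [set v | (h v.1.1 v.2)%:E != 0]) `&`
    (setT `&` [set v | (pI v.2 v.1.2)%:E < c%:E]).
  by rewrite !setTI; apply/seteqP; split => v [/= ? ?]; split.
apply: measurableI.
  apply: emeasurable_neq => //; exact: measurable_cst.
apply: emeasurable_fun_lt => //; exact: measurable_cst.
Qed.

(** [(z, y)] is in the merging set when almost every state that may have produced
    the observation [z] jumps to [y] with density at least [c]. The integral makes
    the set measurable. *)
Definition merging_set : set (mR * mR) :=
  [set u | \int[leb]_x (\1_unreached (u, x))%:E = 0].
Local Notation W := merging_set.

Let munr d1 (T : measurableType d1) (f : T -> (mR * mR) * mR) : measurable_fun setT f ->
  measurable_fun setT (fun v => (\1_unreached (f v))%:E : \bar R).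
Proof.
move=> mf; apply/measurable_EFinP.
exact: (measurableT_comp (measurable_indic (D := setT) measurable_unreached) mf).
Qed.

Lemma measurable_merging_set : measurable W.
Proof.
have -> : W = setT `&` (fun u => \int[leb]_x (\1_unreached (u, x))%:E) @^-1` [set 0].
  by rewrite setTI.
apply: (measurable_fun_integral_pair leb (munr (@measurable_id _ _ setT))) => //.
Qed.

Lemma merging_setP z y : W (z, y) <->
  \forall x \ae leb, h z x != 0%R -> (c <= pI x y)%R.
Proof.
have mu : measurable_fun setT (fun x : mR => (\1_unreached ((z, y), x))%:E : \bar R).
  exact: (munr (measurable_pair1 _)).
have u0 x : 0 <= (\1_unreached ((z, y), x))%:E :> \bar R by rewrite lee_fin.
rewrite /W /=; split=> [/(ge0_integral_eq0P leb mu u0) Wzy|Wzy].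
  apply: (ae_imply Wzy) => x [] /eqP; rewrite indicE pnatr_eq0 eqb0 => /negP xu hx.
  by rewrite leNgt; apply/negP => px; apply: xu; exact/mem_set.
apply/(ge0_integral_eq0P leb mu u0); apply: (ae_imply Wzy) => x px.
rewrite indicE memNset// => -[/= /px]; by rewrite leNgt => /negP.
Qed.

(** Probability that the state [v.2] jumps into the merging set of [v.1]. *)
Definition merging_density (v : mR * mR) : \bar R :=
  \int[leb]_y ((pI v.2 y)%:E * (\1_W (v.1, y))%:E).
Local Notation K := merging_density.

Let m1W d1 (T : measurableType d1) (f1 f2 : T -> mR) : measurable_fun setT f1 ->
  measurable_fun setT f2 -> measurable_fun setT (fun v => (\1_W (f1 v, f2 v))%:E : \bar R).
Proof.
move=> mf1 mf2; apply/measurable_EFinP.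
apply: (measurableT_comp (measurable_indic (D := setT) measurable_merging_set)
  (g := fun v => (f1 v, f2 v))).
exact: measurable_fun_pair.
Qed.

Lemma measurable_merging_density : measurable_fun setT K.
Proof.
apply: (@measurable_fun_integral _ _ _ _ _ leb (fun (v : mR * mR) (y : mR) =>
  (pI v.2 y)%:E * (\1_W (v.1, y))%:E)).
  apply: emeasurable_funM.
    by apply: (measurable_EFin2 mp) => //; exact: measurableT_comp measurable_snd measurable_fst.
  by apply: m1W => //; exact: measurableT_comp measurable_fst measurable_fst.
by move=> v y; rewrite mule_ge0 ?lee_fin.
Qed.

Lemma merging_density_ge0 v : 0 <= K v.
Proof. by apply: integral_ge0 => y _; rewrite mule_ge0 ?lee_fin. Qed.

Let J := obs_support D g.

Definition doeblin (z : R) := exists F : set R, [/\ nontrivial_interval F, F `<=` D &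
  \forall x \ae leb, J z x -> forall y, F y -> (c < p x y)%R].

Lemma doeblin_merging z : D z -> doeblin z ->
  \forall x \ae leb, h z x != 0%R -> K (z, x) != 0.
Proof.
move=> Dz [F [[Fitv [u [v [Fu Fv uv]]]] FD aep]].
have JE x : h z x != 0%R -> D x /\ J z x.
  move=> hx; have Dx : D x by apply: contrapT => Dx; move: hx; rewrite hD ?eqxx.
  by split => //; apply: subset_closure; split => //; rewrite -hg.
have FW y : F y -> W (z, y).
  move=> Fy; apply/merging_setP; apply: (ae_imply aep) => x px hx.
  have [Dx Jx] := JE _ hx.
  by rewrite /pI extendedE//; [exact/ltW/px|exact: FD].
apply: (ae_imply aep) => x px hx; have [Dx Jx] := JE _ hx.
rewrite gt_eqF//.
apply: (@lt_le_trans _ _ (\int[leb]_y (c%:E * (\1_`[u, v] (y : R))%:E))).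
  rewrite ge0_integralZl//; last by rewrite lee_fin ltW.
    rewrite integral_indic// setIT.
    rewrite [X in _ * X](_ : _ = (v - u)%:E); last first.
      by apply: etrans (lebesgue_measure_itv _) _; rewrite /= lte_fin uv -EFinD.
    by rewrite -EFinM lte_fin mulr_gt0// subr_gt0.
  by apply/measurable_EFinP; exact: measurable_indic.
apply: ge0_le_integral => //.
- by move=> y _; rewrite mule_ge0 ?lee_fin// ltW.
- by apply: emeasurable_funM => //; exact/measurable_EFinP.
- apply: emeasurable_funM; first by apply: (measurable_EFin2 mp) => //; exact: measurable_cst.
  by apply: m1W => //; exact: measurable_cst.
- move=> y _; rewrite /= !indicE.
  case: (boolP (y \in _)) => [/set_mem /=|_]; last by rewrite mule0 mule_ge0 ?lee_fin.
  rewrite in_itv/= => /andP[uy yv].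
  have Fy : F y by apply: Fitv Fu Fv _ _; rewrite uy yv.
  have -> : ((z, y) \in W) = true by apply/mem_set; exact: FW.
  rewrite !mule1 lee_fin /pI extendedE//; last exact: FD.
  exact/ltW/px.
Qed.

Hypothesis mI' : measurable I'.
Hypothesis doeb : \forall w \ae m, I' ((w : path) 0%R).2 -> D (w 0%R).2 /\ doeblin (w 0%R).2.

(** Given the observation, the law of the state is absolutely continuous with
    respect to the likelihood, and almost every state that the likelihood charges
    has a positive merging density. *)
Lemma state_obs_merging :
  \forall w \ae m, I' ((w : path) 0%R).2 -> K ((w 0%R).2, (w 0%R).1) != 0.
Proof.
pose A : set (mR * mR) := [set v | K v = 0].
have mA : measurable A.
  have -> : A = setT `&` K @^-1` [set 0] by rewrite setTI.
  exact: measurable_merging_density.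
have mA1 : measurable_fun setT (fun v : mR * mR => (\1_A v)%:E : \bar R).
  by apply/measurable_EFinP; exact: measurable_indic.
have mhA : measurable_fun setT (fun v : mR * mR => (h v.1 v.2)%:E * (\1_A v)%:E).
  by apply: emeasurable_funM => //; exact: (measurable_EFin2 mh).
have hA0 v : 0 <= (h v.1 v.2)%:E * (\1_A v)%:E by rewrite mule_ge0 ?lee_fin.
pose b0 (z : mR) := \int[leb]_x ((h z x)%:E * (\1_A (z, x))%:E).
have mb0 : measurable_fun setT b0 by exact: (measurable_fun_integral_pair leb mhA hA0).
have mhAz z : measurable_fun setT (fun x : mR => (h z x)%:E * (\1_A (z, x))%:E).
  exact: (measurableT_comp mhA (measurable_pair1 z)).
pose C : set mR := I' `&` b0 @^-1` [set 0].
have mC : measurable C.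
  apply: measurableI; first exact: mI'.
  rewrite -[X in measurable X]setTI.
  exact: mb0.
pose F (u : (H * mR) * (mR * mR)) : \bar R := (\1_C u.2.1)%:E * (\1_A u.2)%:E.
have mF : measurable_fun setT F.
  apply: emeasurable_funM; last exact: (measurableT_comp mA1 measurable_snd).
  apply/measurable_EFinP; apply: (measurableT_comp (measurable_indic (D := setT) mC)).
  exact: measurableT_comp measurable_fst measurable_snd.
have F0 u : 0 <= F u by rewrite mule_ge0 ?lee_fin.
have F_null : \int[m]_w F (state_obs w, ((at_time 1 w).2, (at_time 1 w).1)) = 0.
  rewrite (step mp p0 mh h0 step_likelihood mF F0).
  apply: integral0_eq => w _; apply: integral0_eq => z _.
  have [Cz|Cz] := pselect (C z); last first.
    by apply: integral0_eq => x _; rewrite /F /= indicE memNset// mul0e mule0.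
  have [_ bz] := Cz.
  have mpx : measurable_fun setT (fun x : mR =>
      (pI (at_time 0 w).1 x)%:E * (h z x)%:E * F (state_obs w, (z, x))).
    apply: emeasurable_funM.
      apply: emeasurable_funM; last by apply: (measurable_EFin2 mh) => //; exact: measurable_cst.
      by apply: (measurable_EFin2 mp) => //; exact: measurable_cst.
    apply: (measurableT_comp mF (g := fun x : mR => (state_obs w, (z, x)))).
    apply: measurable_fun_pair; first exact: measurable_cst.
    exact: measurable_pair1.
  apply/(ge0_integral_eq0P leb mpx).
    by move=> x; rewrite !mule_ge0 ?lee_fin.
  apply: (ae_imply ((ge0_integral_eq0P leb (mhAz z) (fun x => hA0 (z, x))).1 bz)) => x hAx.
  by rewrite /F /= -muleA [_ * (\1_A _)%:E]muleC [(h z x)%:E * _]muleA hAx mul0e mule0.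
have mFw : measurable_fun setT (fun w : path =>
    F (state_obs w, ((at_time 1 w).2, (at_time 1 w).1))).
  apply: (measurableT_comp mF); apply: measurable_fun_pair; first exact: measurable_state_obs.
  apply: measurable_fun_pair.
    exact: (measurableT_comp measurable_snd (@measurable_at_time R 1)).
  exact: (measurableT_comp measurable_fst (@measurable_at_time R 1)).
have aeF := ae_shiftn m_inv (-1) ((ge0_integral_eq0P m mFw (fun=> F0 _)).1 F_null).
apply: (ae_imply2 aeF doeb) => w Fw dw Iw; apply/eqP => Kw.
have [Dz dz] := dw Iw.
set z0 : mR := (w 0%R).2.
have bz : b0 z0 = 0.
  apply/(ge0_integral_eq0P leb (mhAz z0) (fun x => hA0 (z0, x))).
  apply: (ae_imply (doeblin_merging Dz dz)) => x hK.
  have [->|hx] := eqVneq (h z0 x) 0%R; first by rewrite mul0e.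
  by rewrite indicE memNset ?mule0//; move/eqP: (hK hx).
have Cz : C z0 by split; [exact: Iw|exact: bz].
have w0 : at_time 1 (shiftn (-1) w) = w 0%R by rewrite /at_time /shiftn subrr.
rewrite w0 in Fw.
have C1 : \1_C z0 = 1%R :> R by rewrite indicE mem_set.
have A1 : \1_A (z0, (w 0%R).1) = 1%R :> R by rewrite indicE mem_set.
have : (\1_C z0)%:E * (\1_A (z0, (w 0%R).1))%:E = 0 :> \bar R := Fw.
by rewrite C1 A1 mule1 => /eqP; rewrite onee_eq0.
Qed.

(** Given the present state and observation, a merging has probability
    [merging_density]. *)
Lemma merging_gt0 : 0 < m [set w : path | I' (w 0%R).2] ->
  0 < m [set w : path | W (obs_past w 0%N, (at_time 1 w).1)].
Proof.
move=> I'0.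
pose F (u : history (R * R)%type * (R * R)) : \bar R := (\1_W ((u.1 0%N).2, u.2.1))%:E.
have mF : measurable_fun setT F.
  apply: (m1W (f1 := fun u : history (R * R)%type * (R * R) => (u.1 0%N).2)).
    apply: (measurableT_comp measurable_snd).
    exact: (measurableT_comp (@measurable_history_coord _ _ 0%N) measurable_fst).
  exact: measurableT_comp measurable_fst measurable_snd.
have F0 u : 0 <= F u by rewrite lee_fin.
set E := [set w | _].
have mE : measurable E.
  pose f (w : path) : mR * mR := ((at_time 0 w).2, (at_time 1 w).1).
  have mf : measurable_fun setT f.
    apply: measurable_fun_pair.
      exact: (measurableT_comp measurable_snd (@measurable_at_time R 0)).
    exact: (measurableT_comp measurable_fst (@measurable_at_time R 1)).
  have -> : E = setT `&` f @^-1` W.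
    by rewrite setTI /E /f /obs_past oppr0.
  exact: (mf measurableT _ measurable_merging_set).
pose Kw (w : path) := K ((w 0%R).2, (w 0%R).1).
have mKw : measurable_fun setT Kw.
  apply: (measurableT_comp measurable_merging_density
      (g := fun w : path => ((w 0%R).2, (w 0%R).1))).
  apply: measurable_fun_pair.
    exact: (measurableT_comp measurable_snd (@measurable_at_time R 0)).
  exact: (measurableT_comp measurable_fst (@measurable_at_time R 0)).
have EK : m E = \int[m]_w Kw w.
  transitivity (\int[m]_w F (past w, at_time 1 w)).
    transitivity (\int[m]_w (\1_E w)%:E) => //.
    by rewrite (integral_indic m measurableT mE) setIT.
  rewrite (step_noise mF F0); apply: eq_integral => w _; apply: eq_integral => x _.
  have mg1x : measurable_fun setT (fun z : R => (g1 z x)%:E).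
    by apply/measurable_EFinP; exact: (measurableT_comp mg1 (measurable_pair2 x)).
  transitivity (\int[leb]_z ((pI (at_time 0 w).1 x)%:E * F (past w, (x, 0%R)) * (g1 z x)%:E)).
    by apply: eq_integral => z _; rewrite EFinM muleAC.
  rewrite ge0_integralZl//; last 2 first.
  - by move=> z _; rewrite lee_fin.
  - by rewrite mule_ge0 ?lee_fin.
  by rewrite integral_noise_density// mule1 /F /= /past oppr0.
rewrite lt0e measure_ge0 andbT EK; apply/eqP => K0.
have aeK := (ge0_integral_eq0P m mKw (fun=> merging_density_ge0 _)).1 K0.
have [N [mN N0 IN]] : \forall w \ae m, ~ I' ((w : path) 0%R).2.
  by apply: (ae_imply2 aeK state_obs_merging) => w Kw0 KwI Iw; move: (KwI Iw);
      rewrite -/(Kw w) Kw0 eqxx.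
have mII : measurable [set w : path | I' (w 0%R).2].
  have ms0 : measurable_fun setT (fun w : path => (w 0%R).2 : R).
    exact: (measurableT_comp measurable_snd (@measurable_at_time R 0)).
  by have := ms0 measurableT _ mI'; rewrite setTI.
have : m [set w : path | I' (w 0%R).2] = 0.
  by apply: subset_measure0 N0 => // w Iw; apply: IN => /(_ Iw).
by move=> I0; rewrite I0 ltxx in I'0.
Qed.

End model.

Theorem proposition2p7
  (R : realType)
  (a b : R) (p : R -> R -> R) (mu : probability (measurableTypeR R) R)
  (s psi : R -> R) (eps : R)
  (d : measure_display) (Omega : measurableType d) (P : probability Omega R)
  (X Z xi : int -> {RV P >-> R})
  (c : R) (I' : set R) :
  let I : set R := `[a, b]%classic in
  let g := obs_density s psi eps in
  let J := obs_support I g in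
  let muZ := distribution P (Z 0) in
  let bmu := distribution P (joint_path X Z) in
  a <= b ->
  transition_density I p ->
  stationary_measure I p mu ->
  mu `<< lebesgue_measure ->
  markov_chain P I p X ->
  (forall n A, measurable A -> distribution P (X n) A = mu A) ->
  (forall n, has_density (distribution P (xi n)) psi) ->
  (forall t, psi t != 0 -> - eps <= t <= eps) ->
  mutually_independent P xi ->
  independent_processes P X xi ->
  (forall x, I x -> 0 < s x) ->
  [lipschitz s x | x in I] ->
  (forall n w, Z n w = X n w + s (X n w) * xi n w) ->
  (forall n, \forall w \ae P, I (Z n w)) ->
  invariant_ergodic bmu ->
  0 < c ->
  I' `<=` I -> measurable I' -> (0 < muZ I')%E ->
  (\forall z \ae muZ, I' z ->
     exists F : set R, [/\ nontrivial_interval F, F `<=` I,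
       (\forall x \ae @lebesgue_measure R,
          J z x -> forall y, F y -> c < p x y) &
       exists F' : set R, [/\ nontrivial_interval F', F' `<=` F &
         forall z', F' z' ->
           J z' `<=` F /\ forall y, J z' y -> c < g z' y]]) ->
  (forall x y, I x -> I y -> p x y < c^-1) ->
  (forall z x, I z -> I x -> g z x < c^-1) ->
  exists muhat : R.-pker (path_space R) ~> (measurableTypeR R),
    ac_equivariant I p g bmu muhat /\
    forall nu : path_space R -> {measure set (measurableTypeR R) -> \bar R},
      ac_equivariant I p g bmu nu ->
      \forall w \ae bmu, forall A, measurable A -> nu w A = muhat w A.
Proof.
move=> I g J muZ bmu ab pI mu_stat mu_leb Xmarkov Xmu xid psi_supp xii Xxi s0 lips ZE ZI m_erg
  c0 I'I mI' I'0 doeb pc gc.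
have mI : measurable I by exact: measurable_itv.
have ms := lipschitz_measurable mI lips.
have [mpsi psi0 psi1] : [/\ measurable_fun setT psi, (forall t, 0 <= psi t) &
    (\int[@lebesgue_measure R]_t (psi t)%:E = 1)%E].
  by have [? ? E] := xid 0; split => //; rewrite -E// probability_setT.
pose h := obs_likelihood I s psi.
have mh : measurable_fun setT (fun u : R * R => h u.1 u.2).
  exact: measurable_obs_likelihood.
have hM := likelihood_le xid psi_supp s0 c0 gc.
have hg z y : I z -> I y -> h z y = g z y by exact: obs_likelihoodE.
have hI z y : ~ I y -> h z y = 0.
  by move=> Iy; rewrite /h /obs_likelihood [\1_I y]indicE memNset// mulr0 mul0r.
have obsI := obs_in_interval X ZI.
have m_step := step_likelihood pI Xmarkov xid xii Xxi s0 lips ZE ZI c0 pc.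
have m_inv : forall A, measurable A -> bmu (@Defs.shift R @^-1` A) = bmu A.
  by case: m_erg.
have mp := measurable_extended mI pI.
have p0 x y : 0 <= extended I p x y := extended_ge0 pI x y.
have h0 z x : 0 <= h z x by case/andP: (hM z x).
exists (filter_kernel (measurable_filter_density mp p0 mh h0 m_inv m_step)
  (filter_density_ge0 mp p0 mh h0 m_inv m_step)).
have eqmu := filter_equivariant mI pI mh hM hg hI m_erg obsI m_step.
split; first exact: eqmu.
move=> nu eqnu.
have B0 : 0 < c^-1 by rewrite invr_gt0.
have pB := extended_le c0 pc.
have mW : measurable (merging_set a b p s psi c) := measurable_merging_set c pI xid s0 lips.
have [delta delta0 fm0] : exists2 delta : R, 0 < delta &
    (0 < bmu (frequent_merging (extended I p) h (merging_set a b p s psi c) delta))%E.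
  have hle x : (\int[@lebesgue_measure R]_z (h z x)%:E <= (\1_I x)%:E)%E.
    exact: integral_obs_likelihood_le.
  apply: (frequent_merging_gt0 mp p0 mh h0 m_inv m_step (ltW B0) pB (l := b - a)) => //.
  - exact: integral_extended_le1.
  - by move=> x; apply: le_trans (hle x) _; rewrite lee_fin indicE; case: (_ \in _).
  - apply: (@le_trans _ _ (\int[@lebesgue_measure R]_x (\1_I x)%:E)%E).
      apply: ge0_le_integral => //.
      + by move=> x _; apply: integral_ge0 => z _; rewrite lee_fin.
      + apply: (@measurable_fun_integral _ _ _ _ _ (@lebesgue_measure R)
          (fun x z : measurableTypeR R => (h z x)%:E)) => //=.
        * exact: (measurable_EFin2 mh).
        * by move=> x z; rewrite lee_fin.
      + by apply/measurable_EFinP; exact: measurable_indic.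
    rewrite integral_indic// setIT.
    rewrite [leLHS](_ : _ = lebesgue_measure I)// [leLHS]lebesgue_measure_itv/=.
    by case: ifP => _; rewrite -?EFinD ?lee_fin ?subr_ge0.
  - apply: (merging_gt0 (I' :=
      I') pI Xmarkov xid psi_supp xii Xxi s0 lips ZE ZI m_erg c0 pc mI') => //.
    have [N [mN N0 doebN]] := doeb.
    have aeN : \forall w \ae bmu, ~ N ((w : path_space R) 0).2.
      apply: (ae_coordinate (n := 0) (S := [set u | ~ N u.2])).
        rewrite -[X in measurable X]setTI.
        by apply: (@measurable_snd _ _ (measurableTypeR R) (measurableTypeR R) measurableT (~` N));
          exact: measurableC.
      exists (Z 0 @^-1` N); split => //; last by move=> w /= /contrapT.
      by rewrite -[X in measurable X]setTI; apply: (@measurable_funPT _ _ _ _ (Z 0)).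
    apply: (ae_imply aeN) => w Nw I'w; split; first exact: I'I.
    have : I' (w 0).2 -> exists F, [/\ nontrivial_interval F, F `<=` I,
        (\forall x \ae @lebesgue_measure R, J (w 0).2 x -> forall y, F y -> c < p x y) &
        exists F' : set R, [/\ nontrivial_interval F', F' `<=` F &
          forall z', F' z' -> J z' `<=` F /\ forall y, J z' y -> c < g z' y]].
      by apply: contrapT => nF; apply: Nw; exact: doebN.
    by move=> /(_ I'w)[F [Fitv FI Fp _]]; exists F.
exact: (equivariant_agree mI pI mh hM hg m_erg obsI B0 pB mW c0
  (fun z y => (merging_setP c pI xid s0 lips z y).1) delta0 fm0 eqnu eqmu).
Qed.
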